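(* Let $X=\bigoplus_{i=1}^m\ell^{p_i}$ with $1\le p_i<\infty$, let $V_0=\bigoplus_iW_i$ be a split subspace with $W_i\subset\ell^{p_i}$, $\dim W_i=n_i$, $\sum_in_i=n\ge1$, and let $\Sigma_{\vec n}$ be its stratum. Represent subspaces $V$ near $V_0$ as graphs of $\Phi=(\Phi_{ij})$, $\Phi_{ij}:W_j\to W_i^c\subseteq\ell^{p_i}$, and let $\Phi_{\mathrm{off}}=(\Phi_{ij})_{i\ne j}$. In this chart, the block $\beta_{\vec n+\vec\delta}$ ($\vec\delta\in\mathbb Z^m$, $\sum_i\delta_i=0$) is a polynomial in $\Phi$, homogeneous of degree $\tfrac12\|\vec\delta\|_1$ at lowest order in $\Phi_{\mathrm{off}}$; the degree-one blocks are the unit exchanges $\vec\delta=e_i-e_j$ ($i\neq j$) and their coordinates are the entries of $\Phi_{ij}$. Consequently $$\operatorname{dist}\big(V,\Sigma_{\vec n}\big)\ \asymp\ \|\Phi_{\mathrm{off}}\|\ \asymp\ \max_{i\ne j}\frac{\big\|\beta_{\vec n+e_i-e_j}(V)\big\|}{\big\|\beta_{\vec n}(V)\big\|},\qquad \big\|\beta_{\vec n+\vec\delta}(V)\big\|=O\big(\operatorname{dist}(V,\Sigma_{\vec n})^{\|\vec\delta\|_1/2}\big),$$ the nearest stratum point being the diagonal truncation $\bigoplus_i\operatorname{graph}(\Phi_{ii})$. All comparisons are local to the fixed chart with the pivot block $\beta_{\vec n}(V)$ bounded below, with constants depending on $n$, $m$, the exponents, and the pivot lower bound.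
   Context: Scalars are complex. $X$ carries any fixed absolute norm on the sum. Write $\ell^{p_i}=\ell^{p_i}(A_i)$ with $A_1,\dots,A_m$ disjoint copies of $\mathbb N$, and $A=\bigsqcup_iA_i$ (totally ordered). For a basis $v_1,\dots,v_n$ of an $n$-dimensional subspace $V\subset X$ and an $n$-element $I=\{i_1<\dots<i_n\}\subset A$, $p_I=\det(v_r(i_s))_{r,s}$ (up to a common scalar; near $V_0$ the basis is the one induced from a fixed basis of $V_0$ by the graph representation). For $\vec a\in\mathbb Z_{\ge0}^m$ with $\sum_ia_i=n$, the block of type $\vec a$ is $\beta_{\vec a}(V)=(p_I)$ over $I$ with $|I\cap A_i|=a_i$ for all $i$ (a block with some negative $a_i$ is zero); its norm is the coordinate mixed norm, an iterated norm taking the $\ell^{p_i}$-norm in the $\binom{A_i}{a_i}$-variable. A subspace is split if $V=\bigoplus_i(V\cap\ell^{p_i})$; the vertex stratum is $\Sigma_{\vec n}=\{V\text{ split},\ \dim(V\cap\ell^{p_i})=n_i\ \forall i\}\cong\prod_i\mathrm{Gr}_{n_i}(\ell^{p_i})$. $W_i^c$ is a fixed closed complement of $W_i$ in $\ell^{p_i}$ (with respect to coordinates adapted to $V_0$), and $V$ is the graph $\{w+\Phi w: w\in V_0\}$ with $\Phi:\bigoplus_jW_j\to\bigoplus_iW_i^c$; in the chart $\Sigma_{\vec n}=\{\Phi_{\mathrm{off}}=0\}$. $\operatorname{dist}$ is distance with respect to the gap metric: the gap between subspaces $M,N$ is $\max\{\delta(M,N),\delta(N,M)\}$, $\delta(M,N)=\sup_{u\in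 M,\|u\|=1}\operatorname{dist}(u,N)$. $f\asymp g$ means each is bounded by a constant multiple of the other. $\operatorname{graph}(\Phi_{ii})\subset\ell^{p_i}$ is $\{w+\Phi_{ii}w:w\in W_i\}$.
   Formalization: The diagonal truncation is shown to be a nearest stratum point only up to a constant factor (exact nearness fails in general), and the constants also depend on the norm on the sum and on a bound for the size of the chart (projections, basis of V_0, ‖Φ‖). *)

(* Defs.v *)
From HB Require Import structures.
From mathcomp Require Import all_boot all_order all_algebra finmap.
From mathcomp Require Import boolp classical_sets functions reals ereal esum exp.
From mathcomp Require Import complex.
(* mpoly is not imported: its notations clash with those of mathcomp-analysis. *)
From mathcomp Require mpoly.

Set Implicit Arguments.
Unset Strict Implicit.
Unset Printing Implicit Defensive.
Import Order.TTheory GRing.Theory Num.Theory.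
Local Open Scope classical_set_scope.
Local Open Scope ring_scope.

Section LinearAlgebra.
Variables (C : fieldType) (E F : lmodType C).

Definition subspace (S : set E) : Prop :=
  S 0 /\ forall (a : C) (x y : E), S x -> S y -> S (a *: x + y).

Definition basis_of (S : set E) (d : nat) (v : 'I_d -> E) : Prop :=
  (forall c : 'I_d -> C, \sum_r c r *: v r = 0 -> forall r, c r = 0) /\
  S = [set x | exists c : 'I_d -> C, x = \sum_r c r *: v r].

Definition has_dim (S : set E) (d : nat) : Prop :=
  exists v : 'I_d -> E, basis_of S v.

Definition linear_on (S : set E) (f : E -> F) : Prop :=
  forall (a : C) (x y : E), S x -> S y -> f (a *: x + y) = a *: f x + f y.

End LinearAlgebra.

(* Complex sequences; [R[i]^o] is [R[i]] seen as a vector space over itself. *)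
Notation cseq R := (nat -> R[i]^o).
(* Elements of X: the i-th component is a sequence indexed by A_i = nat, so
   that the index set A is ['I_m * nat]. *)
Notation mseq R m := ('I_m -> nat -> R[i]^o).

Section SumSpace.
Variables (R : realType) (m : nat) (p : 'I_m -> R).

Definition lpnorm (q : R) (x : cseq R) : \bar R :=
  ((\esum_(k in [set: nat]) (Normc.normc (x k) `^ q)%:E) `^ q^-1)%E.

Definition lp (q : R) : set (cseq R) := [set x | (lpnorm q x < +oo)%E].

Definition nlp (q : R) (x : cseq R) : R := fine (lpnorm q x).

Definition Xspace : set (mseq R m) := [set x | forall i, lp (p i) (x i)].

Definition absolute_norm (N : 'rV[R]_m -> R) : Prop :=
  [/\ forall x, N x = 0 -> x = 0,
      forall (a : R) x, N (a *: x) = `|a| * N x,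
      forall x y, N (x + y) <= N x + N y
    & forall x, N (map_mx (fun a => `|a|) x) = N x].

Variable N : 'rV[R]_m -> R.

Definition Xnorm (x : mseq R m) : R := N (\row_i nlp (p i) (x i)).

Definition dist_pt (u : mseq R m) (S : set (mseq R m)) : R :=
  inf [set Xnorm (u - v) | v in S].

Definition half_gap (S T : set (mseq R m)) : R :=
  sup [set dist_pt u T | u in [set u | S u /\ Xnorm u = 1]].

Definition gap (S T : set (mseq R m)) : R :=
  Num.max (half_gap S T) (half_gap T S).

Definition dist (V : set (mseq R m)) (Sigma : set (set (mseq R m))) : R :=
  inf [set gap V W | W in Sigma].

Definition embed (i : 'I_m) (y : cseq R) : mseq R m :=
  fun l => if l == i then y else 0.

(* V `&` l^{p_i}, read inside l^{p_i} *)
Definition part (V : set (mseq R m)) (i : 'I_m) : set (cseq R) :=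
  [set y | V (embed i y)].

Definition direct_sum (W : 'I_m -> set (cseq R)) : set (mseq R m) :=
  [set x | forall i, W i (x i)].

Definition stratum (nn : 'I_m -> nat) : set (set (mseq R m)) :=
  [set V | [/\ subspace V, V `<=` Xspace, V = direct_sum (part V)
             & forall i, has_dim (part V i) (nn i)]].

End SumSpace.

(* The fixed data of a graph chart around a split subspace: V_0 is the direct
   sum of the [W i], and [bas] is the fixed basis of V_0 (an arbitrary one). *)
Record chart (R : realType) (m : nat) (p : 'I_m -> R) (nn : 'I_m -> nat)
    (n : nat) := Chart {
  W : 'I_m -> set (cseq R);
  Wc : 'I_m -> set (cseq R);
  bas : 'I_n -> mseq R m;
  W_sub : forall i, W i `<=` lp (p i);
  W_dim : forall i, has_dim (W i) (nn i);
  Wc_sub : forall i, Wc i `<=` lp (p i);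
  Wc_subspace : forall i, subspace (Wc i);
  Wc_closed : forall i x, lp (p i) x ->
    (forall e : R, 0 < e -> exists2 y, Wc i y & nlp (p i) (x - y) < e) ->
    Wc i x;
  W_Wc_sum : forall i x, lp (p i) x ->
    exists w u, [/\ W i w, Wc i u & x = w + u];
  W_Wc_cap : forall i x, W i x -> Wc i x -> x = 0;
  bas_basis : basis_of (direct_sum W) bas }.

(* Phi = (Phi i j), with Phi i j relevant on W_j only *)
Notation blockop R m := ('I_m -> 'I_m -> (nat -> R[i]^o) -> nat -> R[i]^o).

Section Chart.
Variables (R : realType) (m : nat) (p : 'I_m -> R) (nn : 'I_m -> nat) (n : nat).
Variable ch : chart p nn n.

Definition V0 : set (mseq R m) := direct_sum (W ch).

Definition chart_op (Phi : blockop R m) : Prop :=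
  forall i j, linear_on (W ch j) (Phi i j) /\
    (forall w, W ch j w -> Wc ch i (Phi i j w)).

Definition app (Phi : blockop R m) (x : mseq R m) : mseq R m :=
  fun i => \sum_j Phi i j (x j).

Definition diag_part (Phi : blockop R m) : blockop R m :=
  fun i j => if i == j then Phi i j else 0.

Definition off_part (Phi : blockop R m) : blockop R m :=
  fun i j => if i == j then 0 else Phi i j.

Definition graph (Phi : blockop R m) : set (mseq R m) :=
  [set w + app Phi w | w in V0].

Definition diag_graph (Phi : blockop R m) (i : 'I_m) : set (cseq R) :=
  [set w + Phi i i w | w in W ch i].

Definition truncation (Phi : blockop R m) : set (mseq R m) :=
  direct_sum (diag_graph Phi).

Definition graph_basis (Phi : blockop R m) (r : 'I_n) : mseq R m :=
  bas ch r + app Phi (bas ch r).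

Variable N : 'rV[R]_m -> R.

Definition opnorm (Phi : blockop R m) : R :=
  sup [set Xnorm p N (app Phi x) | x in [set x | V0 x /\ Xnorm p N x = 1]].

(* K bounds the projections of l^{p_i} onto W_i along W_i^c and the fixed
   basis of V_0. *)
Definition chart_bound (K : R) : Prop :=
  (forall i w u, W ch i w -> Wc ch i u ->
     nlp (p i) w <= K * nlp (p i) (w + u)) /\
  (forall r, Xnorm p N (bas ch r) <= K).

End Chart.

Section Blocks.
Variables (R : realType) (m : nat) (p : 'I_m -> R) (n : nat).

(* A finite I `<=` A is given by the family of its traces on the A_i;
   [points I] lists I in the lexicographic order of A. *)
Notation index_set := ('I_m -> {fset nat}).

Definition points (I : index_set) : seq ('I_m * nat) :=
  [seq (i, k) | i <- enum 'I_m, k <- sort leq (I i)].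

Definition coord (x : mseq R m) (I : index_set) (s : nat) : R[i] :=
  nth 0 [seq (x a.1 a.2 : R[i]) | a <- points I] s.

(* Meant for I with n points. *)
Definition plucker (v : 'I_n -> mseq R m) (I : index_set) : R[i] :=
  \det (\matrix_(r < n, s < n) coord (v r) I s).

Definition has_type (a : 'I_m -> int) (I : index_set) : Prop :=
  forall i, #|` I i|%:Z = a i.

(* Iterated norm over the variables in the list [s], outermost first. *)
Fixpoint mixed_norm (a : 'I_m -> int) (s : seq 'I_m)
    (f : index_set -> \bar R) (I : index_set) : \bar R :=
  match s with
  | [::] => f I
  | i :: s' =>
      ((\esum_(J in [set J : {fset nat} | #|` J|%:Z = a i])
          (mixed_norm a s' f (fun l => if l == i then J else I l) `^ p i)%E)
        `^ (p i)^-1)%E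
  end.

(* The norm of the block of type [a]; it is 0 if some [a i] is negative, since
   the sum over [J] is then empty. *)
Definition block_norm (s : seq 'I_m) (a : 'I_m -> int)
    (v : 'I_n -> mseq R m) : \bar R :=
  mixed_norm a s (fun I => (Normc.normc (plucker v I))%:E) (fun _ => fset0).

End Blocks.

Section Types.
Variable m : nat.

Definition shift (nn : 'I_m -> nat) (delta : 'I_m -> int) : 'I_m -> int :=
  fun i => (nn i)%:Z + delta i.

Definition unit_exchange (i j : 'I_m) : 'I_m -> int :=
  fun l => (l == i)%:Z - (l == j)%:Z.

(* ||delta||_1 / 2, an integer when the entries of delta sum to 0 *)
Definition half_l1 (delta : 'I_m -> int) : nat := ((\sum_i `|delta i|)./2)%N.

(* I with the point a of A_j removed and the point k of A_i added *)
Definition exchange (I : 'I_m -> {fset nat}) (i j : 'I_m) (k a : nat) :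
    'I_m -> {fset nat} :=
  fun l => if l == i then (k |` I l)%fset
           else if l == j then (I l `\ a)%fset else I l.

End Types.

(* The coordinates in P are adapted to the chart: W_i^c consists of the
   sequences vanishing on P_i, and the basis of V_0 is dual to P. *)
Definition adapted (R : realType) (m : nat) (p : 'I_m -> R) (nn : 'I_m -> nat)
    (n : nat) (ch : chart p nn n) (P : 'I_m -> {fset nat}) : Prop :=
  [/\ has_type (fun i => (nn i)%:Z) P,
      forall i, Wc ch i = [set x | lp (p i) x /\ forall k, k \in P i -> x k = 0]
    & forall r s : 'I_n, coord (bas ch r) P s = (r == s)%:R].

Definition pivot_norm (R : realType) (m : nat) (p : 'I_m -> R) (n : nat)
    (s : seq 'I_m) (nn : 'I_m -> nat) (v : 'I_n -> mseq R m) : \bar R :=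
  block_norm p s (fun i => (nn i)%:Z) v.

Definition max_ratio (R : realType) (m : nat) (p : 'I_m -> R) (n : nat)
    (s : seq 'I_m) (nn : 'I_m -> nat) (v : 'I_n -> mseq R m) : R :=
  \big[Num.max/0]_(ij : 'I_m * 'I_m | ij.1 != ij.2)
    (fine (block_norm p s (shift nn (unit_exchange ij.1 ij.2)) v) /
     fine (pivot_norm p s nn v)).

Definition comparable_by (R : realType) (C f g : R) : Prop :=
  f <= C * g /\ g <= C * f.

(* Main.v *)
(* Choose in every W_i a basis that is nearly normalized together with its dual
   functionals (a near-maximizer of the determinant, as in Auerbach's lemma), and
   extend the functionals by 0 on W_i^c. In this frame the row of a basis vector
   of W_j has diagonal entries in the columns of A_j and entries of Phi_off in the
   other columns. Scaling Phi_off by t therefore multiplies a term of the Leibniz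
   expansion of a block coordinate by t^k, where k is the number of rows matched
   with a column of another component, and the least such k over all matchings of
   type n + delta is |delta|_1 / 2.

   Upper bounds: every Leibniz term is dominated by a product of one sequence per
   component, whose mixed norm factors. Lower bounds: by duality in l^p, applying
   the dual functionals (with one of them replaced by a functional norming
   Phi_ij w) to the coordinates of a block costs a bounded factor and
   returns the pivot determinant, respectively an entry of Phi_ij times it.

   Distance: truncating Phi bounds dist(V, Sigma) by Phi_off. Conversely, if a
   split S is eta-close to V, take w in W_j and v = w + Phi w in V; a nearby z in S
   has its i-th component z_i in S again, which is near some v' in V. As
   v_i = Phi_ij w lies in W_i^c, the projection of v' onto V_0 has size O(eta),
   hence so have v', z_i and Phi_ij w. *)

Require Import Defs.
From HB Require Import structures.
From mathcomp Require Import all_boot all_order all_algebra perm finmap.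
From mathcomp Require Import boolp classical_sets functions reals ereal esum exp.
From mathcomp Require Import complex.
From mathcomp Require mpoly.
From mathcomp Require Import cardinality fsbigop topology normedtype sequences measure hoelder.
From mathcomp Require Import ring lra zify.
(* Imported again because topology shadows the predicate subspace. *)
Require Import Defs.

Set Implicit Arguments.
Unset Strict Implicit.
Unset Printing Implicit Defensive.
Import Order.TTheory GRing.Theory Num.Theory.
Local Open Scope ring_scope.

(** * Matchings with prescribed fibers *)

(** Uniformity in the chart shapes the argument. A chart comes with an arbitrary basis and
    arbitrarily placed complements, so every estimate is made in a frame, whose functionals are
    bounded on W_i by the universal constant 2. The position of the complements enters through the
    bound K for the projections, and the given basis through one determinant, common to all block
    coordinates, which is comparable to the pivot block and cancels in the ratios. Lower bounds
    cannot be read off from single coordinates, since a block may be spread over infinitely many of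
    them. Instead a functional applied to a column is traded for a sum over all coordinates of its
    component, which again leaves minors of the same vectors. Near-maximizers and finitely supported
    norming functionals avoid compactness and duality theory, and treat the exponent 1 like the
    others. That the least number of mismatches is attained serves twice: the lowest-order part does
    not vanish identically, and |delta|_1 / 2 is at most n for every type without negative entries,
    so that one constant works for all delta. *)

Section Matchings.
Variables m n : nat.
Implicit Types (sg tau : 'I_n -> 'I_m) (delta : 'I_m -> int).

Definition mismatches sg tau : {set 'I_n} := [set s | sg s != tau s].

Definition fiber_diff tau sg (i : 'I_m) : int :=
  #|[set s | tau s == i]|%:Z - #|[set s | sg s == i]|%:Z.

Lemma fiber_diffE tau sg i :
  fiber_diff tau sg i = \sum_s ((tau s == i)%:Z - (sg s == i)%:Z).
Proof.
rewrite /fiber_diff -!sum1_card !(big_morph _ PoszD (erefl 0%:Z)).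
rewrite sumrB; congr (_ - _); rewrite big_mkcond;
 apply: eq_bigr => s _; by rewrite inE; case: ifP.
Qed.

Lemma sum_abs_diff (x y : 'I_m) :
  (\sum_i `|(y == i)%:Z - (x == i)%:Z| = (x != y).*2)%N.
Proof.
have [->|xy] := eqVneq x y; first by rewrite big1// => i _; rewrite subrr.
rewrite (bigD1 x)//= (bigD1 y)/=; last by rewrite eq_sym.
rewrite big1 => [|i /andP[ix iy]].
  by rewrite !eqxx (negbTE xy) eq_sym (negbTE xy).
by rewrite ![_ == i]eq_sym (negbTE ix) (negbTE iy).
Qed.

Lemma sum_abs_mismatches sg tau :
  (\sum_i \sum_s `|(tau s == i)%:Z - (sg s == i)%:Z| =
   #|mismatches sg tau|.*2)%N.
Proof.
rewrite exchange_big /=; under eq_bigr do rewrite sum_abs_diff.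
rewrite -sum1_card -muln2 big_distrl/= [RHS]big_mkcond; apply: eq_bigr => s _.
by rewrite inE -muln2; case: eqP.
Qed.

(** A mismatch takes an index out of one fiber and puts it into another, so it contributes at most 2
    to the sum of the |delta i|. *)
Lemma half_l1_le_mismatches sg tau delta :
  (forall i, delta i = fiber_diff tau sg i) ->
  (half_l1 delta <= #|mismatches sg tau|)%N.
Proof.
move=> h; rewrite /half_l1 -[X in (_ <= X)%N]doubleK half_leq//.
rewrite -sum_abs_mismatches; apply: leq_sum => i _.
rewrite h fiber_diffE; elim/big_rec2: _ => // s x y _ xy.
lia.
Qed.

(** Encodes an index as a component together with a position in it. This gives a first matching with
    prescribed fibers, and later glues bases of the components into one family. *)
Lemma exists_fibers (a : 'I_m -> nat) : (\sum_i a i = n)%N ->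
  exists (f : 'I_n -> {i : 'I_m & 'I_(a i)}), bijective f.
Proof.
move=> ha; have e : #|{: {i : 'I_m & 'I_(a i)}}| = n.
  by rewrite card_tagged sumnE big_map big_enum /= -[RHS]ha; apply: eq_bigr => i _;
    rewrite card_ord.
exists (fun s => enum_val (cast_ord (esym e) s)).
apply: (@Bijective _ _ _ (fun x => cast_ord e (enum_rank x))) => x.
  by rewrite enum_valK; apply: val_inj.
by rewrite cast_ordK enum_rankK.
Qed.

Lemma fiber_tag (a : 'I_m -> nat) (f : 'I_n -> {i : 'I_m & 'I_(a i)}) i :
  bijective f -> #|[set s | tag (f s) == i]| = a i.
Proof.
move=> bf; rewrite -(card_ord (a i)).
rewrite -[RHS](card_imset _ (f := Tagged (fun i => 'I_(a i)))); last first.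
  by move=> x y; apply: eq_from_Tagged.
rewrite -(card_imset _ (bij_inj bf)); apply: eq_card => x.
apply/imsetP/imsetP => [[s]|[k _ ->]].
  rewrite inE => /eqP <- ->; case: (f s) => j k /=.
  by exists k.
have [g fK gK] := bf; exists (g (Tagged (fun i => 'I_(a i)) k)); last by rewrite gK.
by rewrite inE gK /=.
Qed.

(** Equality in [half_l1_le_mismatches]. Take [tau] with the fewest mismatches among all maps with
    these fibers. If some index were moved into component i and another one out of it, transposing
    two values would repair a mismatch without creating one. So every component only gains or only
    loses, and nothing cancels in the sum for [delta i]. *)
Lemma exists_matching sg (a : 'I_m -> nat) delta : (\sum_i a i = n)%N ->
  (forall i, delta i = (a i)%:Z - #|[set s | sg s == i]|%:Z) ->
  exists tau, (forall i, #|[set s | tau s == i]| = a i) /\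
    #|mismatches sg tau| = half_l1 delta.
Proof.
move=> ha hd.
pose P (t : {ffun 'I_n -> 'I_m}) := [forall i, #|[set s | t s == i]| == a i].
have [f bf] := exists_fibers ha.
pose t0 : {ffun 'I_n -> 'I_m} := [ffun s => tag (f s)].
have Pt0 : P t0.
  apply/forallP => i; rewrite -(fiber_tag i bf); apply/eqP.
  by apply: eq_card => s; rewrite !inE ffunE.
case: (arg_minnP (fun t : {ffun 'I_n -> 'I_m} => #|mismatches sg t|) Pt0).
move=> t /forallP Pt tmin.
have swap s s' : t s = sg s' -> t s != sg s -> sg s' != t s' -> False.
  move=> e1 n1 n2; pose t' : {ffun 'I_n -> 'I_m} := [ffun x => t (tperm s s' x)].
  have Pt' : P t'.
    apply/forallP => i; rewrite -(eqP (Pt i)); apply/eqP.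
    rewrite -[RHS](card_imset _ (@perm_inj _ (tperm s s'))); apply: eq_card => x.
    rewrite inE ffunE; apply/idP/imsetP => [h|[y]].
      by exists (tperm s s' x); rewrite ?tpermK// inE.
    by rewrite inE => h ->; rewrite tpermK.
  have := tmin _ Pt'; rewrite leqNgt => /negP; apply; apply: proper_card.
  apply/properP; split.
    apply/fintype.subsetP => x; rewrite !inE ffunE; case: tpermP => [-> _|-> _|//].
      by rewrite eq_sym.
    by [].
  by exists s'; rewrite inE// ffunE tpermR e1 eqxx.
exists t; split=> [i|]; first exact/eqP.
apply: double_inj; rewrite -sum_abs_mismatches.
have same i : (`|delta i| = \sum_s `|(t s == i)%:Z - (sg s == i)%:Z|)%N.
  have -> : delta i = \sum_s ((t s == i)%:Z - (sg s == i)%:Z).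
    by rewrite hd -fiber_diffE /fiber_diff (eqP (Pt i)).
  have [/existsP[s /andP[/eqP h1 h2]]|/existsPn h] :=
      boolP [exists s, (t s == i) && (sg s != i)].
    have pos s' : 0 <= (t s' == i)%:Z - (sg s' == i)%:Z.
      have [h3|//] := eqVneq (sg s') i; rewrite ?subr0//.
      have [h4|h4] := eqVneq (t s') i; first by [].
      by case: (swap s s'); rewrite ?h1 ?h3// eq_sym.
    apply/eqP; rewrite -eqz_nat (big_morph _ PoszD (erefl 0%:Z)) gez0_abs.
      by apply/eqP; apply: eq_bigr => s' _; rewrite gez0_abs.
    by apply: sumr_ge0.
  have neg s' : 0 <= (sg s' == i)%:Z - (t s' == i)%:Z.
    have := h s'; rewrite negb_and negbK => /orP[/negbTE ->|-> //].
    by rewrite subr0.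
    by rewrite subr_ge0 lez_nat leq_b1.
  rewrite -abszN -sumrN; apply/eqP.
  rewrite -eqz_nat (big_morph _ PoszD (erefl 0%:Z)) gez0_abs.
    by apply/eqP; apply: eq_bigr => s' _; rewrite -abszN opprB gez0_abs.
  by apply: sumr_ge0 => s' _; rewrite opprB.
have -> : (\sum_i \sum_s `|(t s == i)%:Z - (sg s == i)%:Z| = \sum_i `|delta i|)%N.
  by apply: eq_bigr => i _; rewrite same.
have : (\sum_i `|delta i| = #|mismatches sg t|.*2)%N.
  by rewrite -sum_abs_mismatches; apply: eq_bigr => i _; rewrite same.
by rewrite /half_l1 => ->; rewrite doubleK.
Qed.

End Matchings.

Lemma half_l1_unit_exchange m (delta : 'I_m -> int) : \sum_i delta i = 0 ->
  half_l1 delta = 1%N <->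
  exists i j : 'I_m, i != j /\ delta = unit_exchange i j.
Proof.
move=> d0; split; last first.
  move=> [i [j [ij ->]]]; rewrite /half_l1 /unit_exchange.
  have := sum_abs_diff j i; rewrite eq_sym ij.
  by under eq_bigr do rewrite [i == _]eq_sym [j == _]eq_sym; move=> ->.
rewrite /half_l1 => h.
have [i di] : exists i, 0 < delta i.
  apply/existsP; apply: contrapT => /negP; rewrite negb_exists => /forallP hn.
  have {}hn i : delta i <= 0 by rewrite leNgt.
  have : \sum_i - delta i == 0 by rewrite sumrN d0 oppr0.
  rewrite psumr_eq0 => [/allP hz|i _]; last by rewrite oppr_ge0.
  move: h; rewrite big1// => i _; have := hz i (mem_index_enum _).
  by rewrite /= oppr_eq0 => /eqP ->.
have [j dj] : exists j, delta j < 0.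
  apply/existsP; apply: contrapT => /negP; rewrite negb_exists => /forallP hn.
  have {}hn k : 0 <= delta k by rewrite leNgt.
  have := d0; move/eqP; rewrite psumr_eq0 => [/allP hz|//].
  by have := hz i (mem_index_enum _); rewrite /= gt_eqF.
have ij : i != j by apply/eqP => e; move: di dj; rewrite e; lia.
exists i, j; split=> //.
have hs : (\sum_(k | (k != i) && (k != j)) `|delta k| + `|delta i| + `|delta j|)%N
    = (\sum_k `|delta k|)%N.
  by rewrite [RHS](bigD1 i)//= [in RHS](bigD1 j) 1?eq_sym//=; lia.
have hz : \sum_(k | (k != i) && (k != j)) delta k + delta i + delta j = 0.
  rewrite -[RHS]d0 [RHS](bigD1 i)//= [in RHS](bigD1 j) 1?eq_sym//=.
  by rewrite -addrA addrC -addrA.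
have h3 : (\sum_k `|delta k| <= 3)%N.
  by rewrite leqNgt; apply/negP => h4; have := half_leq h4; rewrite h.
(* Halving rounds down, so the total of the |delta k| could be 3, leaving 1 for the other indices.
   Parity excludes this: a sum of absolute values is congruent mod 2 to the sum itself. *)
have r0 : (\sum_(k | (k != i) && (k != j)) `|delta k|)%N = 0%N.
  have : exists z : int, (\sum_(k | (k != i) && (k != j)) `|delta k|)%N%:Z =
      \sum_(k | (k != i) && (k != j)) delta k + 2 * z.
    elim/big_rec2: _ => [|k x y _ [z hz']]; first by exists 0.
    by have [/ltW p|p] := ltP 0 (delta k);
      [exists z|exists (z - delta k)]; lia.
  have : (`|(\sum_(k | (k != i) && (k != j)) delta k)%R| <=
     \sum_(k | (k != i) && (k != j)) `|delta k|)%N.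
    elim/big_rec2: _ => // k x y _; lia.
  set A := (\sum_(k | _) `|_|)%N in hs *; set B := \sum_(k | _) _ in hz *.
  by move: h3; rewrite -hs => h3 h4 [z hz']; lia.
move: hs hz; rewrite r0 => hs.
have rz k : k != i -> k != j -> delta k = 0.
  move=> ki kj; move/eqP: r0; rewrite sum_nat_eq0 => /forallP/(_ k).
  by rewrite ki kj /= absz_eq0 => /eqP.
rewrite big1 => [hz|k /andP[ki kj]]; last exact: rz.
apply: funext => k; rewrite /unit_exchange.
have [->|ki] := eqVneq k i; first by rewrite (negbTE ij); lia.
have [->|kj] := eqVneq k j; first by lia.
by rewrite rz.
Qed.

(** * Determinants with labelled columns *)

Section ColumnDeterminant.
Variable C : comNzRingType.

(* Labels beyond the n-th are ignored, missing ones give zero columns. *)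
Definition coldet (T : Type) n (F : T -> 'I_n -> C) (L : seq T) : C :=
  \det (\matrix_(r < n, s < n) nth 0 [seq F a r | a <- L] s).

Lemma coldet_map (S T : Type) n (f : S -> T) (F : T -> 'I_n -> C) L :
  coldet F (map f L) = coldet (fun a => F (f a)) L.
Proof.
by congr (\det _); apply/matrixP => r s; rewrite !mxE -map_comp.
Qed.

Lemma coldet_tuple (T : Type) n (F : T -> 'I_n -> C) (L : n.-tuple T) :
  coldet F L = \det (\matrix_(r < n, s < n) F (tnth L s) r).
Proof.
congr (\det _); apply/matrixP => r s; rewrite !mxE.
by rewrite (nth_map (tnth_default L s)) ?size_tuple// -tnth_nth.
Qed.

Lemma coldet_rows (T : Type) n (F G : T -> 'I_n -> C) (c : 'M[C]_n) L :
  (forall a r, F a r = \sum_s c r s * G a s) ->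
  coldet F L = \det c * coldet G L.
Proof.
move=> h; rewrite -det_mulmx; congr (\det _); apply/matrixP => r s; rewrite !mxE.
under eq_bigr do rewrite mxE.
have [sL|sL] := ltnP s (size L); last first.
  rewrite nth_default ?size_map// big1 // => j _.
  by rewrite nth_default ?size_map// mulr0.
case: L sL => // a L sL; rewrite (nth_map a)// h.
by apply: eq_bigr => j _; rewrite (nth_map a).
Qed.

Lemma coldet_perm (T : eqType) n (L L' : seq T) : size L = n -> perm_eq L' L ->
  exists e : nat, forall F : T -> 'I_n -> C, coldet F L' = (-1) ^+ e * coldet F L.
Proof.
move=> sL pL; have sL' : size L' = n by rewrite (perm_size pL).
have [tL tLE] : exists t : n.-tuple T, L = t by exists (Tuple (introT eqP sL)).
have [tL' tLE'] : exists t : n.-tuple T, L' = t by exists (Tuple (introT eqP sL')).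
move: pL; rewrite tLE tLE' => /tuple_permP[g hg].
have {hg} -> : tL' = [tuple tnth tL (g i) | i < n] by apply: val_inj.
exists (g : bool) => F; rewrite !coldet_tuple.
have -> : \matrix_(r < n, s < n) F (tnth [tuple tnth tL (g i) | i < n] s) r =
    col_perm g (\matrix_(r < n, s < n) F (tnth tL s) r).
  by apply/matrixP => r s; rewrite !mxE tnth_mktuple.
by rewrite col_permE det_mulmx det_perm odd_permV mulrC.
Qed.

(** The [kap r] are the cofactors of the first column. They are chosen before [a], so one linear
    form serves all possible first columns. For n = 0 the determinant is 1 and no such form
    exists. *)
Lemma coldet_cons (T : Type) n (F : T -> 'I_n -> C) (L : seq T) :
  exists kap : 'I_n -> C, forall a, (0 < n)%N ->
    coldet F (a :: L) = \sum_r kap r * F a r.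
Proof.
case: n F => [|n] F; first by exists (fun=> 0).
exists (fun r : 'I_n.+1 => (-1) ^+ (r + (@ord0 n))%N *
  \det (\matrix_(i < n, j < n) nth 0 [seq F b (lift r i) | b <- L] j)) => a _.
rewrite /coldet (expand_det_col _ ord0); apply: eq_bigr => r _.
rewrite mxE /= mulrC /cofactor; congr (_ * _ * _); congr (\det _).
by apply/matrixP => i j; rewrite !mxE /=.
Qed.

Lemma coldet_dup (T : eqType) n (F : T -> 'I_n -> C) (L : seq T) :
  size L = n -> ~~ uniq L -> coldet F L = 0.
Proof.
move=> sL; have [tL ->] : exists t : n.-tuple T, L = t.
  by exists (Tuple (introT eqP sL)).
have x0 : 'I_n -> T by exact: tnth tL.
rewrite coldet_tuple; case: n F tL sL x0 => [|n'] F tL sL x0.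
  by rewrite tuple0.
move=> /(uniqPn (x0 ord0))[i [j [ij jn e]]].
have jn' : (j < n'.+1)%N by rewrite -[X in (_ < X)%N](size_tuple tL).
have lin : (i < n'.+1)%N := ltn_trans ij jn'.
rewrite -det_tr; apply: (@determinant_alternate _ _ _ (Ordinal lin) (Ordinal jn')).
  by rewrite -val_eqE /= ltn_eqF.
by move=> r; rewrite !mxE !(tnth_nth (x0 ord0)) /= e.
Qed.

End ColumnDeterminant.

Lemma prod_neq0 (C : comNzRingType) (T : finType) (F : T -> C) :
  \prod_r F r != 0 -> forall r, F r != 0.
Proof.
by move=> h r; apply: contra_neq h => e; rewrite (bigD1 r)//= e mul0r.
Qed.

(** * Order of vanishing of a determinant when its mismatched entries are scaled *)

Section TwistedDeterminant.
Variables (C : comNzRingType) (m n : nat) (sg c : 'I_n -> 'I_m).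
Variables (delta : 'I_m -> int) (A : 'M[C]_n).
Hypothesis dE : forall i, delta i = fiber_diff c sg i.

(** Row r belongs to component [sg r], column s to component [c s]. For the matrix of a graph in a
    frame, scaling the mismatched entries amounts to scaling Phi_off. *)
Definition twist (t : C) : 'M[C]_n :=
  \matrix_(r, s) (if sg r == c s then A r s else t * A r s).

Let mis (g : 'S_n) := mismatches sg (c \o g).

Lemma fiber_diff_perm (g : 'S_n) i : fiber_diff (c \o g) sg i = fiber_diff c sg i.
Proof.
rewrite /fiber_diff; congr (_%:Z - _).
rewrite -(card_imset _ (@perm_inj _ g)); apply: eq_card => x.
rewrite inE; apply/imsetP/idP => [[y]|h]; first by rewrite inE => h ->.
by exists ((g^-1)%g x); rewrite ?permKV// inE /= permKV.
Qed.

Lemma half_l1_le_mis (g : 'S_n) : (half_l1 delta <= #|mis g|)%N.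
Proof. by apply: half_l1_le_mismatches => i; rewrite fiber_diff_perm. Qed.

Lemma det_twistE t : \det (twist t) =
  \sum_(g : 'S_n) (-1) ^+ g * (t ^+ #|mis g| * \prod_r A r (g r)).
Proof.
apply: eq_bigr => g _; congr (_ * _).
rewrite -prodr_const [X in X * _]big_mkcond -big_split; apply: eq_bigr => r _ /=.
by rewrite !mxE inE /=; case: eqP => _; rewrite ?mul1r.
Qed.

(** The natural subtraction in the exponent never truncates, by [half_l1_le_mis]. *)
Definition twist_poly : {poly C} :=
  \sum_(g : 'S_n) ((-1) ^+ g * \prod_r A r (g r)) *: 'X^(#|mis g| - half_l1 delta).

Lemma det_twist t : \det (twist t) = t ^+ half_l1 delta * twist_poly.[t].
Proof.
rewrite det_twistE /twist_poly horner_sum mulr_sumr; apply: eq_bigr => g _.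
rewrite hornerZ hornerXn -[in LHS](subnKC (half_l1_le_mis g)) exprD.
have e (w x y z : C) : w * (x * y * z) = x * (w * z * y) by ring.
exact: e.
Qed.

Lemma twist_poly0 : twist_poly.[0] =
  \sum_(g : 'S_n | #|mis g| == half_l1 delta) (-1) ^+ g * \prod_r A r (g r).
Proof.
rewrite /twist_poly horner_sum [RHS]big_mkcond; apply: eq_bigr => g _.
rewrite hornerZ hornerXn expr0n subn_eq0 eqn_leq half_l1_le_mis andbT.
by case: ifP; rewrite ?mulr1 ?mulr0.
Qed.

(** Under the support condition, a permutation with nonzero product has its mismatches among those
    of [tau]. As [tau] attains the minimum, the two sets coincide, so the permutation follows [tau]
    in every row and all surviving terms carry the same power of t. *)
Lemma det_twist_matching tau t : #|mismatches sg tau| = half_l1 delta ->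
  (forall r s, A r s != 0 -> c s = sg r \/ c s = tau r) ->
  \det (twist t) =
    t ^+ half_l1 delta * \det (\matrix_(r, s) if c s == tau r then A r s else 0).
Proof.
move=> ht hA; rewrite det_twistE mulr_sumr; apply: eq_bigr => g _.
rewrite [RHS]mulrCA; congr (_ * _).
have [/forallP h|/forallPn[r0 hr0]] := boolP [forall r, c (g r) == tau r].
  congr (_ ^+ _ * _).
    rewrite -ht; apply: eq_card => r; rewrite !inE /= (eqP (h r)) //.
  by apply: eq_bigr => r _; rewrite mxE h.
rewrite [X in _ = _ * X](bigD1 r0)//= mxE (negbTE hr0) mul0r mulr0.
have [->|/prod_neq0 hn] := eqVneq (\prod_r A r (g r)) 0; first by rewrite mulr0.
have sub : mis g \subset mismatches sg tau.
  apply/fintype.subsetP => r; rewrite !inE /= => h.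
  by case: (hA _ _ (hn r)) h => ->; rewrite ?eqxx.
have /eqP e : mis g == mismatches sg tau.
  by rewrite eqEcard sub ht half_l1_le_mis.
case: (hA _ _ (hn r0)) => [h1|h1]; last by rewrite h1 eqxx in hr0.
have : r0 \notin mis g by rewrite inE /= h1 eqxx.
by rewrite e inE negbK => /eqP h2; rewrite h1 h2 eqxx in hr0.
Qed.

End TwistedDeterminant.

(* Expanding the determinant of one more vector along its last column gives a
   combination of the vectors whose last coefficient is the previous minor. *)
Lemma independent_minor (C : fieldType) (T : Type) n (v : 'I_n -> T -> C) :
  (forall c : 'I_n -> C, (forall x, \sum_r c r * v r x = 0) -> forall r, c r = 0) ->
  exists pt : 'I_n -> T, \det (\matrix_(r, s) v r (pt s)) != 0.
Proof.
elim: n v => [|n IH] v ind.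
  have e : 'I_0 -> T by case.
  by exists e; rewrite det_mx00 oner_eq0.
have [|pt hpt] := IH (fun r => v (lift ord_max r)).
  move=> c hc r.
  have := ind (fun s => if unlift ord_max s is Some r then c r else 0) _
    (lift ord_max r); rewrite liftK; apply => x.
  rewrite (bigD1 ord_max)//= unlift_none mul0r add0r -[RHS](hc x).
  rewrite (reindex_onto (lift ord_max) (fun s => odflt r (unlift ord_max s))) /=.
    apply: eq_big => s; last by rewrite liftK.
    by rewrite liftK eqxx andbT eq_sym neq_lift.
  by move=> s; case: (unliftP ord_max s) => [s' ->|->]; rewrite ?eqxx.
pose pt' x (s : 'I_n.+1) := if unlift ord_max s is Some s' then pt s' else x.
pose cf x r := cofactor (\matrix_(r, s) v r (pt' x s)) r ord_max.
have cfE x y r : cf x r = cf y r.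
  rewrite /cf /cofactor; congr (_ * \det _); apply/matrixP => i j.
  by rewrite !mxE /pt' liftK.
have dE x y : \det (\matrix_(r, s) v r (pt' x s)) = \sum_r cf y r * v r x.
  rewrite (expand_det_col _ ord_max); apply: eq_bigr => r _.
  by rewrite -/(cf x r) (cfE x y) !mxE /pt' unlift_none mulrC.
have cn0 y : cf y ord_max != 0.
  rewrite /cf /cofactor mulf_neq0 ?signr_eq0//.
  apply: contraNneq hpt => /eqP; rewrite eq_sym => /eqP ->; apply/eqP.
  congr (\det _); apply/matrixP => i j; rewrite !mxE /pt' liftK.
  by [].
apply: contrapT => hn.
have hz x : \det (\matrix_(r, s) v r (pt' x s)) = 0.
  by apply/eqP; apply: contrapT => /negP h; apply: hn; exists (pt' x).
case: (pselect (inhabited T)) => [[y]|nT].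
  apply: (negP (cn0 y)); apply/eqP; apply: (ind (cf y)) => x.
  by rewrite -(dE x y).
have := ind (fun=> 1) _ ord_max => /= h; have := oner_neq0 C.
by rewrite h ?eqxx// => x; case: nT.
Qed.

(** * Index sets as lists of points *)

Section Points.
Variable m : nat.
Implicit Type I : 'I_m -> {fset nat}.

Lemma perm_points I :
  perm_eq (points I) [seq (i, k) | i <- enum 'I_m, k <- enum_fset (I i)].
Proof. by apply: perm_allpairs_dep => // i _; rewrite perm_sort. Qed.

Lemma mem_points I i k : ((i, k) \in points I) = (k \in I i).
Proof.
rewrite (perm_mem (perm_points I)); apply/allpairsPdep/idP.
  by move=> [i' [k' [_ h [-> ->]]]].
by move=> h; exists i, k; rewrite mem_enum.
Qed.

Lemma uniq_points I : uniq (points I).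
Proof.
rewrite (perm_uniq (perm_points I)); apply: allpairs_uniq_dep.
- exact: enum_uniq.
- by move=> i _; exact: fset_uniq.
- by move=> [i k] [i' k'] _ _ /= [-> ->].
Qed.

Lemma count_points I i : count (fun a => a.1 == i) (points I) = #|` I i|.
Proof.
rewrite (seq.permP (perm_points I)) count_flatten sumnE -map_comp big_map big_enum /=.
rewrite (bigD1 i)//= big1 => [|j ji]; rewrite /= count_map.
  by rewrite addn0 (eq_count (a2 := predT)) ?count_predT// => k /=; rewrite eqxx.
by rewrite (eq_count (a2 := pred0)) ?count_pred0// => k /=; rewrite (negbTE ji).
Qed.

Lemma size_points I : size (points I) = (\sum_i #|` I i|)%N.
Proof.
rewrite (perm_size (perm_points I)) size_flatten /shape -map_comp sumnE big_map.
by rewrite big_enum; apply: eq_bigr => i _; rewrite /= size_map.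
Qed.

Lemma points_traces (L : seq ('I_m * nat)) : uniq L ->
  perm_eq L (points (fun i => [fset a.2 | a in L & a.1 == i]%fset)).
Proof.
move=> uL; apply: uniq_perm => //; first exact: uniq_points.
move=> [i k]; rewrite mem_points; apply/idP/imfsetP => [h|[[i' k'] /=]].
  by exists (i, k) => //=; rewrite !inE h eqxx.
by rewrite inE /= => /andP[h /eqP <-] ->.
Qed.

Variables (n : nat) (nn : 'I_m -> nat) (sg : 'I_n -> 'I_m).
Hypothesis nn_sum : (\sum_i nn i = n)%N.
Hypothesis sg_fiber : forall i, size [seq t <- enum 'I_n | sg t == i] = nn i.

(** The link between block types and matchings: labelling the columns of a block coordinate by their
    components, the fibers differ from those of the row labels [sg] by [delta]. *)
Lemma index_tuple delta I : \sum_i delta i = 0 -> has_type (shift nn delta) I ->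
  exists2 pt : n.-tuple ('I_m * nat), points I = pt &
    forall i, delta i = fiber_diff (fun s => (tnth pt s).1) sg i.
Proof.
move=> d0 hI; have sz : size (points I) = n.
  apply/eqP; rewrite -eqz_nat size_points -nn_sum.
  rewrite !(big_morph _ PoszD (erefl 0%:Z)) -[X in _ == X]addr0 -[X in _ + X]d0.
  by rewrite -big_split /=; apply/eqP; apply: eq_bigr => i _; exact: hI.
exists (Tuple (introT eqP sz)) => // i; set pt := Tuple _.
have -> : delta i = #|` I i|%:Z - (nn i)%:Z by rewrite hI /shift addrC addKr.
rewrite /fiber_diff; congr (_%:Z - _%:Z); last first.
  by rewrite -sg_fiber cardsE cardE [in RHS]/enum_mem -enumT; congr size; apply: eq_filter.
rewrite -count_points -[points I]/(val pt) -[X in count _ X](map_tnth_enum pt).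
rewrite count_map cardsE cardE [in RHS]/enum_mem -enumT size_filter.
by apply: eq_count.
Qed.

End Points.

Section UnitTwist.
Variables (C : comNzRingType) (m n : nat) (sg c : 'I_n -> 'I_m).
Variables (i j : 'I_m).
Hypothesis ij : i != j.
Hypothesis dE : forall l, unit_exchange i j l = fiber_diff c sg l.
Implicit Type A : 'M[C]_n.

Let mis (g : 'S_n) := mismatches sg (c \o g).

Lemma half_l1_unit : half_l1 (unit_exchange i j) = 1%N.
Proof.
apply/half_l1_unit_exchange; last by exists i, j.
rewrite /unit_exchange sumrB (bigD1 i)//= big1 => [|l /negbTE ->//].
by rewrite eqxx (bigD1 j)//= big1 ?eqxx => [|l /negbTE ->//].
Qed.

Lemma single_mismatch (g : 'S_n) s : mis g = [set s] ->
  [/\ sg s = j, c (g s) = i & forall r, r != s -> sg r = c (g r)].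
Proof.
move=> hg; have hr r : r != s -> sg r = c (g r).
  move=> rs; have : r \notin mis g by rewrite hg inE.
  by rewrite inE negbK => /eqP.
have hs : sg s != c (g s).
  have : s \in mis g by rewrite hg inE.
  by rewrite inE.
have hd l : unit_exchange i j l = (c (g s) == l)%:Z - (sg s == l)%:Z.
  rewrite dE -(fiber_diff_perm sg c g) fiber_diffE (bigD1 s)//= big1 ?addr0//.
  by move=> r rs; rewrite hr// subrr.
split=> //.
- have := hd (sg s); rewrite /unit_exchange eqxx [c _ == _]eq_sym (negbTE hs).
  by case: (sg s =P j) => // _; case: eqP.
- have := hd (c (g s)); rewrite /unit_exchange eqxx (negbTE hs).
  by case: (c (g s) =P i) => // _; case: eqP.
Qed.

(** The coefficient of the mismatched entry [A s s'] in the part of degree one. All other factors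
    have row and column in the same component, so it depends only on the diagonal blocks of A; see
    [eq_exchange_cofactor]. *)
Definition exchange_cofactor A s s' : C :=
  \sum_(g : 'S_n | (mis g == [set s]) && (g s == s'))
    (-1) ^+ g * \prod_(r | r != s) A r (g r).

Lemma eq_exchange_cofactor A A' s s' :
  (forall r t, sg r = c t -> A r t = A' r t) ->
  exchange_cofactor A s s' = exchange_cofactor A' s s'.
Proof.
move=> h; apply: eq_bigr => g /andP[/eqP hg _]; congr (_ * _).
apply: eq_bigr => r rs; apply: h.
by have [_ _ ->] := single_mismatch hg.
Qed.

Lemma twist_poly0_unit A : (twist_poly sg c (unit_exchange i j) A).[0] =
  \sum_(s | sg s == j) \sum_(s' | c s' == i) exchange_cofactor A s s' * A s s'.
Proof.
rewrite (twist_poly0 A dE) half_l1_unit.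
transitivity (\sum_s \sum_(g : 'S_n | mis g == [set s])
    (-1) ^+ g * \prod_r A r (g r)).
  under [RHS]eq_bigr do rewrite big_mkcond; rewrite exchange_big /= big_mkcond.
  apply: eq_bigr => g _; case: ifPn => [/cards1P[s0 e]|hn].
    rewrite -/(mis g) in e; rewrite [RHS](bigD1 s0)//= e eqxx.
    rewrite [X in _ + X]big1 ?addr0// => s ss.
    by rewrite (inj_eq set1_inj) eq_sym (negbTE ss).
  rewrite big1// => s _; case: eqP => // e; move: hn.
  by rewrite -/(mis g) e cards1.
rewrite [RHS]big_mkcond; apply: eq_bigr => s _.
transitivity (\sum_(s' | c s' == i) if sg s == j then
    exchange_cofactor A s s' * A s s' else 0); last first.
  by case: ifP => // _; rewrite big1.
rewrite (partition_big (fun g : 'S_n => g s) (fun s' => c s' == i)) /=; last first.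
  by move=> g /eqP /single_mismatch[_ -> _].
apply: eq_bigr => s' _.
have [sj|sj] := eqVneq (sg s) j; last first.
  rewrite big_pred0// => g; apply/negP => /andP[/eqP /single_mismatch[h _ _] _].
  by rewrite h eqxx in sj.
rewrite mulr_suml; apply: eq_bigr => g /andP[_ /eqP gs].
by rewrite (bigD1 s)//= gs -mulrA; congr (_ * _); rewrite mulrC.
Qed.

End UnitTwist.

Section MatchingFibers.
Variables (m n : nat) (nn : 'I_m -> nat) (sg : 'I_n -> 'I_m).
Hypothesis nn_sum : (\sum_i nn i = n)%N.
Hypothesis sg_fiber : forall i, size [seq t <- enum 'I_n | sg t == i] = nn i.

Lemma card_fiber (tau : 'I_n -> 'I_m) i :
  #|[set s | tau s == i]| = size [seq t <- enum 'I_n | tau t == i].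
Proof.
by rewrite cardsE cardE [in LHS]/enum_mem -enumT; congr size; apply: eq_filter.
Qed.

Lemma exists_type_matching delta : \sum_i delta i = 0 ->
  (forall i, 0 <= shift nn delta i) ->
  exists tau : 'I_n -> 'I_m,
    (forall i, (size [seq t <- enum 'I_n | tau t == i])%:Z = shift nn delta i) /\
    #|mismatches sg tau| = half_l1 delta.
Proof.
move=> d0 d1; pose a i := `|shift nn delta i|%N.
have aE i : (a i)%:Z = shift nn delta i by rewrite /a gez0_abs.
have [||tau [h1 h2]] := @exists_matching m n sg a delta.
- apply/eqP; rewrite -eqz_nat (big_morph _ PoszD (erefl 0%:Z)).
  under eq_bigr do rewrite aE /shift.
  by rewrite big_split /= d0 addr0 -(big_morph _ PoszD (erefl 0%:Z)) nn_sum.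
- by move=> i; rewrite aE card_fiber sg_fiber /shift addrAC subrr add0r.
exists tau; split=> // i; by rewrite -card_fiber h1 aE.
Qed.

(* Some permutation contributes a nonzero term to the Leibniz formula, and it
   matches the components of the rows with those of the columns. *)
Lemma minor_type (C : comNzRingType) (A : 'M[C]_n) (tau c : 'I_n -> 'I_m) :
  \det A != 0 -> (forall r s, A r s != 0 -> c s = tau r) ->
  forall i, size [seq s <- enum 'I_n | c s == i] =
            size [seq r <- enum 'I_n | tau r == i].
Proof.
move=> dA hA i; have [g hg] : exists g : 'S_n, forall r, c (g r) = tau r.
  apply: contrapT => hn; move: dA => /negP; apply; apply/eqP.
  apply: big1 => g _; case: (eqVneq (\prod_i A i (g i)) 0) => [->|/prod_neq0 h].
    by rewrite mulr0.
  by case: hn; exists g => r; apply: hA.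
rewrite -!card_fiber -[RHS](card_imset _ (@perm_inj _ g)); apply: eq_card => s.
rewrite inE; apply/idP/imsetP => [h|[r]]; last by rewrite inE => h ->; rewrite hg.
by exists ((g^-1)%g s); rewrite ?permKV// inE -hg permKV.
Qed.

End MatchingFibers.

Section Exchange.
Variables (m : nat) (P : 'I_m -> {fset nat}) (i j : 'I_m) (a k : nat).
Hypotheses (ij : i != j) (aP : a \in P j) (kP : k \notin P i).

Lemma exchange_type (nn : 'I_m -> nat) : has_type (fun i => (nn i)%:Z) P ->
  has_type (shift nn (unit_exchange i j)) (exchange P i j k a).
Proof.
move=> hP l; rewrite /shift /unit_exchange /exchange.
case: (l =P i) => [->|_].
  by rewrite (negbTE ij) cardfsU1 kP PoszD hP addrC.
case: (l =P j) => [->|_]; last by rewrite hP subrr addr0.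
by have := hP j; rewrite (cardfsD1 a (P j)) aP PoszD => <-; rewrite add0r addrAC subrr add0r.
Qed.

Definition move_point (x : 'I_m * nat) := if x == (j, a) then (i, k) else x.

(** The new point is sorted into its place in the list, so the two lists agree only up to order.
    This is the origin of the sign in [adapted_exchange]. *)
Lemma perm_exchange :
  perm_eq (points (exchange P i j k a)) (map move_point (points P)).
Proof.
apply: uniq_perm; first exact: uniq_points.
  rewrite map_inj_in_uniq ?uniq_points// => x y hx hy; rewrite /move_point.
  have nik z : z \in points P -> (i, k) = z -> False.
    by move=> hz e; move: hz; rewrite -e mem_points (negbTE kP).
  case: eqP => [->|_]; case: eqP => [->|_]//.
    by move=> e; case: (nik y).
  by move=> e; case: (nik x).
move=> [l b]; rewrite mem_points /exchange; apply/idP/mapP => [|[[l' b']]].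
  case: (l =P i) => [->|/eqP li].
    rewrite !inE => /orP[/eqP ->|h].
      by exists (j, a); rewrite ?mem_points// /move_point eqxx.
    exists (i, b); rewrite ?mem_points// /move_point.
    by rewrite xpair_eqE (negbTE ij).
  case: (l =P j) => [->|/eqP lj].
    rewrite !inE => /andP[ba h]; exists (j, b); rewrite ?mem_points// /move_point.
    by rewrite xpair_eqE (negbTE ba) andbF.
  move=> h; exists (l, b); rewrite ?mem_points// /move_point.
  by rewrite xpair_eqE (negbTE lj).
rewrite mem_points /move_point => h; case: eqP => [_ [-> ->]|/eqP hn [-> ->]].
  by rewrite eqxx !inE eqxx.
case: eqP => [e|_]; first by rewrite !inE h orbT.
case: eqP => [e|_] //; rewrite !inE h andbT.
by move: hn; rewrite e xpair_eqE eqxx.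
Qed.

End Exchange.

Local Open Scope classical_set_scope.
Local Open Scope ring_scope.

Notation nc := Normc.normc.

Lemma ler_eq (R : numDomainType) (x y : R) : x = y -> x <= y.
Proof. by move=> ->. Qed.

(** * Sequence spaces *)

Section Modulus.
Variable R : realType.
Implicit Types x y : R[i].

Lemma nc_ge0 x : 0 <= nc x.
Proof. by case: x => a b; exact: sqrtr_ge0. Qed.

Lemma nc0 : nc (0 : R[i]) = 0. Proof. exact: Normc.normc0. Qed.

Lemma nc_add x y : nc (x + y) <= nc x + nc y.
Proof. exact: (@le_normcD R x y). Qed.

Lemma ncN x : nc (- x) = nc x.
Proof. exact: (@normcN R x). Qed.

Lemma nc_eq0 x : (nc x == 0) = (x == 0).
Proof. by apply/eqP/eqP => [/Normc.eq0_normc//|->]; exact: nc0. Qed.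

Lemma nc_gt0 x : (0 < nc x) = (x != 0).
Proof. by rewrite lt_neqAle nc_ge0 andbT eq_sym nc_eq0. Qed.

Lemma ncX x k : nc (x ^+ k) = nc x ^+ k.
Proof.
by elim: k => [|k IH]; rewrite ?Normc.normc1// !exprS Normc.normcM IH.
Qed.

Lemma nc_sum (I : Type) (r : seq I) (P : pred I) (F : I -> R[i]) :
  nc (\sum_(i <- r | P i) F i) <= \sum_(i <- r | P i) nc (F i).
Proof.
elim/big_rec2: _ => [|i a b _ h]; first by rewrite nc0.
by rewrite (le_trans (nc_add _ _))// lerD2l.
Qed.

Lemma nc_prod (I : Type) (r : seq I) (P : pred I) (F : I -> R[i]) :
  nc (\prod_(i <- r | P i) F i) = \prod_(i <- r | P i) nc (F i).
Proof.
by elim/big_rec2: _ => [|i a b _ <-]; rewrite ?Normc.normc1// Normc.normcM.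
Qed.

Lemma nc_sign k : nc ((-1) ^+ k : R[i]) = 1.
Proof. by rewrite ncX ncN Normc.normc1 expr1n. Qed.

Lemma nc_real (a : R) : nc a%:C%C = `|a|.
Proof. by rewrite /nc /= expr0n addr0 sqrtr_sqr. Qed.

Lemma nc_conj x : nc x^*%C = nc x.
Proof. by case: x => a b /=; rewrite sqrrN. Qed.

Lemma mulc_conj x : x * x^*%C = (nc x ^+ 2)%:C%C.
Proof. by rewrite -sqr_normc normc_def -rmorphXn; case: x. Qed.

Lemma nc_re x : `|complex.Re x| <= nc x.
Proof.
case: x => a b /=; rewrite -sqrtr_sqr ler_wsqrtr// lerDl.
exact: sqr_ge0.
Qed.

Lemma nc_im x : `|complex.Im x| <= nc x.
Proof.
case: x => a b /=; rewrite -sqrtr_sqr ler_wsqrtr// lerDr.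
exact: sqr_ge0.
Qed.

Lemma nc_le x : nc x <= `|complex.Re x| + `|complex.Im x|.
Proof.
case: x => a b /=; rewrite -[leRHS]ger0_norm ?addr_ge0//.
rewrite -[leRHS]sqrtr_sqr ler_wsqrtr// sqrrD !real_normK ?num_real//.
by rewrite lerD2r lerDl mulrn_wge0// mulr_ge0.
Qed.

End Modulus.

Section Sequences.
Variables (R : realType) (q : R).
Hypothesis q1 : 1 <= q.
Implicit Types x y : cseq R.

Let q0 : 0 < q. Proof. exact: lt_le_trans q1. Qed.
Let qn0 : q != 0. Proof. by rewrite gt_eqF. Qed.
Let qV0 : q^-1 != 0. Proof. by rewrite invr_eq0. Qed.
Let qVge0 : 0 <= q^-1. Proof. by rewrite invr_ge0 ltW. Qed.

Lemma lpnorm_ge0 x : (0 <= lpnorm q x)%E.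
Proof. exact: poweR_ge0. Qed.

Lemma esum_powq_ge0 x : (0 <= \esum_(k in [set: nat]) (nc (x k) `^ q)%:E)%E.
Proof. by apply: esum_ge0 => k _; rewrite lee_fin powR_ge0. Qed.

(** Gives access to Minkowski's inequality through the counting measure. *)
Lemma lpnorm_Lnorm x :
  lpnorm q x = Lnorm counting q%:E (EFin \o (fun k => nc (x k)) : nat -> \bar R).
Proof.
rewrite Lnorm_counting// /lpnorm; congr (poweR _ _).
rewrite nneseries_esum; last by move=> k _; rewrite poweR_ge0.
rewrite (_ : [set x0 | true] = [set: nat]); last by apply/seteqP; split.
by apply: eq_esum => k _ /=; rewrite ger0_norm// nc_ge0.
Qed.

Lemma le_lpnorm x y : (forall k, nc (x k) <= nc (y k)) ->
  (lpnorm q x <= lpnorm q y)%E.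
Proof.
move=> h; apply: gt0_ler_poweR => //.
- by rewrite in_itv /= esum_powq_ge0 leey.
- by rewrite in_itv /= esum_powq_ge0 leey.
- apply: le_esum => k _; rewrite lee_fin ge0_ler_powR//; first exact: ltW.
  + exact: nc_ge0.
  + exact: nc_ge0.
Qed.

Lemma lpnorm_triangle x y : (lpnorm q (x + y)%R <= lpnorm q x + lpnorm q y)%E.
Proof.
(* Minkowski is applied to the real sequences of moduli; their sum dominates x + y termwise. *)
pose z : cseq R := fun k => (nc (x k) + nc (y k))%:C%C.
have ncz k : nc (z k) = nc (x k) + nc (y k).
  by rewrite nc_real ger0_norm// addr_ge0 ?nc_ge0.
apply: (@le_trans _ _ (lpnorm q z)).
  by apply: le_lpnorm => k; rewrite ncz; exact: nc_add.
rewrite !lpnorm_Lnorm; apply: le_trans; last exact: minkowski_EFin.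
by rewrite le_eqVlt; apply/orP; left; apply/eqP; congr Lnorm; apply: funext => k;
  exact: (congr1 EFin (ncz k)).
Qed.

Lemma lpnormZ (a : R[i]) x : lpnorm q (a *: x) = ((nc a)%:E * lpnorm q x)%E.
Proof.
rewrite {1}/lpnorm.
transitivity (poweR (((nc a) `^ q)%:E *
    \esum_(k in [set: nat]) (nc (x k) `^ q)%:E)%E q^-1); last first.
  rewrite poweRM ?esum_powq_ge0 ?lee_fin ?powR_ge0//.
  by rewrite poweR_EFin -powRrM mulfV// powRr1 ?nc_ge0.
congr (poweR _ _).
have -> : (\esum_(k in [set: nat]) (nc ((a *: x) k) `^ q)%:E)%E =
    (\esum_(k in [set: nat]) (((nc a) `^ q)%:E * (nc (x k) `^ q)%:E))%E.
  by apply: eq_esum => k _; rewrite -EFinM -powRM ?nc_ge0// -Normc.normcM.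
rewrite -!nneseries_esumT.
- by rewrite nneseriesZl// => k _; rewrite lee_fin powR_ge0.
- by move=> k; rewrite lee_fin powR_ge0.
- by move=> k; rewrite -EFinM lee_fin mulr_ge0// powR_ge0.
Qed.

Lemma lp_nlp x : lp q x -> lpnorm q x = (nlp q x)%:E.
Proof. by move=> h; rewrite /nlp fineK// ge0_fin_numE// lpnorm_ge0. Qed.

Lemma nlp_ge0 x : 0 <= nlp q x.
Proof. by rewrite /nlp fine_ge0// lpnorm_ge0. Qed.

Lemma lpZ a x : lp q x -> lp q (a *: x).
Proof. by move=> h; rewrite /lp /= lpnormZ lp_nlp// -EFinM ltry. Qed.

Lemma lpD x y : lp q x -> lp q y -> lp q (x + y).
Proof.
move=> hx hy; rewrite /lp /=; apply: le_lt_trans (lpnorm_triangle _ _) _.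
by rewrite !lp_nlp// -EFinD ltry.
Qed.

Lemma lpN x : lp q x -> lp q (- x).
Proof. by rewrite -scaleN1r; exact: lpZ. Qed.

Lemma lpB x y : lp q x -> lp q y -> lp q (x - y).
Proof. by move=> hx hy; apply: lpD => //; exact: lpN. Qed.

Lemma lpnorm0 : lpnorm q (0 : cseq R) = 0%E.
Proof.
rewrite /lpnorm esum1 ?poweR0r// => k _.
by rewrite [X in nc X](_ : _ = 0)// nc0 powR0.
Qed.

Lemma lp0 : lp q (0 : cseq R).
Proof. by rewrite /lp /= lpnorm0 ltry. Qed.

Lemma nlp0 : nlp q (0 : cseq R) = 0.
Proof. by rewrite /nlp lpnorm0. Qed.

Lemma nlpZ a x : nlp q (a *: x) = nc a * nlp q x.
Proof.
rewrite /nlp lpnormZ; case: (lpnorm q x) (lpnorm_ge0 x) => [r| |]//= _.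
have [->|a0] := eqVneq (nc a) 0; first by rewrite mul0e mul0r.
by rewrite gt0_muley ?mulr0// lte_fin lt_neqAle eq_sym a0 nc_ge0.
Qed.

Lemma nlpN x : nlp q (- x) = nlp q x.
Proof. by rewrite -scaleN1r nlpZ ncN Normc.normc1 mul1r. Qed.

Lemma nlpB x y : nlp q (x - y) = nlp q (y - x).
Proof. by rewrite -nlpN opprB. Qed.

Lemma nlpD x y : lp q x -> lp q y -> nlp q (x + y) <= nlp q x + nlp q y.
Proof.
move=> hx hy; rewrite -lee_fin EFinD -!lp_nlp//; last exact: lpD.
exact: lpnorm_triangle.
Qed.

Lemma lp_sum (I : Type) (r : seq I) (P : pred I) (F : I -> cseq R) :
  (forall i, P i -> lp q (F i)) -> lp q (\sum_(i <- r | P i) F i).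
Proof. by move=> h; elim/big_ind: _ => //; [exact: lp0|exact: lpD]. Qed.

Lemma nlp_sum (I : Type) (r : seq I) (P : pred I) (F : I -> cseq R) :
  (forall i, P i -> lp q (F i)) ->
  nlp q (\sum_(i <- r | P i) F i) <= \sum_(i <- r | P i) nlp q (F i).
Proof.
move=> h; elim: r => [|i r IH]; first by rewrite !big_nil nlp0.
rewrite !big_cons; case: ifPn => // Pi.
rewrite (le_trans (nlpD (h _ Pi) (lp_sum _ _)))//; last by rewrite lerD2l.
Qed.

Lemma lpnorm_pow x :
  (\esum_(k in [set: nat]) (nc (x k) `^ q)%:E)%E = poweR (lpnorm q x) q.
Proof. by rewrite /lpnorm -poweRrM mulVf// poweRe1// esum_powq_ge0. Qed.

Lemma esum_ge1 (T : choiceType) (A : set T) (f : T -> \bar R) t :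
  (forall t, A t -> (0 <= f t)%E) -> A t -> (f t <= \esum_(k in A) f k)%E.
Proof.
move=> f0 At; apply: esum_ge; exists [set t]; last by rewrite fsbig_set1.
by split; [exact: finite_set1|move=> _ ->].
Qed.

Lemma nlp_coord x k : lp q x -> nc (x k) <= nlp q x.
Proof.
move=> hx.
have h : ((nc (x k) `^ q)%:E <= poweR (lpnorm q x) q)%E.
  rewrite -lpnorm_pow.
  by apply: (@esum_ge1 _ setT (fun k => (nc (x k) `^ q)%:E)) => // t _;
    rewrite lee_fin powR_ge0.
rewrite -[leLHS](powRr1 (nc_ge0 _)) -[leRHS](powRr1 (nlp_ge0 _)).
rewrite -[1](mulfV qn0) !powRrM ge0_ler_powR//; rewrite ?nnegrE ?powR_ge0//.
by move: h; rewrite lp_nlp// poweR_EFin lee_fin.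
Qed.

Lemma nlp_eq0 x : lp q x -> nlp q x = 0 -> x = 0.
Proof.
move=> hx h0; apply: funext => k; apply/eqP; rewrite -nc_eq0.
by rewrite eq_le nc_ge0 andbT -h0 nlp_coord.
Qed.

End Sequences.

(** * Norming functionals of sequences *)

Section Duality.
Variables (R : realType) (q : R).
Hypothesis q1 : 1 <= q.
Implicit Types x y : cseq R.

Let q0 : 0 < q. Proof. exact: lt_le_trans q1. Qed.
Let qn0 : q != 0. Proof. by rewrite gt_eqF. Qed.

(** Young's inequality with the conjugate power of a written as a power of [a ^ (q - 1)]. In this
    form it also holds for q = 1, where the conjugate exponent is infinite. *)
Lemma young_powR (a b : R) : 0 <= a -> 0 <= b ->
  a `^ (q - 1) * b <= (1 - q^-1) * a `^ q + q^-1 * b `^ q.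
Proof.
move=> a0 b0; have [->|qN1] := eqVneq q 1.
  by rewrite subrr powRr0 invr1 subrr mul0r add0r !mul1r powRr1.
have q2 : 0 < q - 1 by rewrite subr_gt0 lt_neqAle eq_sym qN1.
pose r := q / (q - 1).
have r0 : 0 < r by rewrite divr_gt0.
have rq : r^-1 = 1 - q^-1 by rewrite /r invf_div mulrBl mulfV// mul1r.
have := @conjugate_powR R (a `^ (q - 1)) b r q (powR_ge0 _ _) b0 r0 q0.
rewrite rq subrK => /(_ erefl); rewrite -powRrM.
rewrite /r mulrCA mulfV ?gt_eqF// mulr1.
by rewrite mulrC -rq mulrC (mulrC (b `^ q)) [_ * r^-1]mulrC.
Qed.

Lemma sum_le_nlp x M : lp q x -> \sum_(k < M) nc (x k) `^ q <= nlp q x `^ q.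
Proof.
move=> hx; rewrite -lee_fin -poweR_EFin -lp_nlp// -lpnorm_pow// -sumEFin.
rewrite -nneseries_esumT; last by move=> k; rewrite lee_fin powR_ge0.
rewrite -(big_mkord xpredT (fun k => (nc (x k) `^ q)%:E)).
by apply: nneseries_lim_ge => k _ _; rewrite lee_fin powR_ge0.
Qed.

Lemma nlp_le_partial x B : 0 <= B ->
  (forall M, \sum_(k < M) nc (x k) `^ q <= B `^ q) -> nlp q x <= B.
Proof.
move=> B0 h.
suff h1 : (\esum_(k in [set: nat]) (nc (x k) `^ q)%:E <= (B `^ q)%:E)%E.
  have: (lpnorm q x <= B%:E)%E.
    rewrite -[leRHS](poweRe1 (x := B%:E))// -[X in poweR B%:E X](mulfV qn0).
    rewrite poweRrM; apply: gt0_ler_poweR h1.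
    - by rewrite invr_ge0 ltW.
    - by rewrite in_itv /= leey andbT; exact: esum_powq_ge0.
    - by rewrite in_itv /= leey andbT lee_fin powR_ge0.
  have := @lpnorm_ge0 _ q x; rewrite /nlp.
  by case: (lpnorm q x).
rewrite -nneseries_esumT; last by move=> k; rewrite lee_fin powR_ge0.
apply: lime_le; first by apply: is_cvg_nneseries => k _ _; rewrite lee_fin powR_ge0.
apply: nearW => M; rewrite big_mkord sumEFin lee_fin; exact: h.
Qed.

Definition slinear (F : cseq R -> R[i]) :=
  forall (a : R[i]) x y, F (a *: x + y) = a * F x + F y.

(** For every cut-off M, a functional supported on the first M coordinates norms the truncation of
    x. Such functionals are defined and linear on all sequences, which is why [slinear] asks for no
    more than plain linearity. *)
Lemma nlp_dual x B : 0 <= B -> lp q x ->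
  (forall F, slinear F -> (forall y, lp q y -> nc (F y) <= nlp q y) ->
    nc (F x) <= B) -> nlp q x <= B.
Proof.
move=> B0 hx h; apply: nlp_le_partial => // M.
set S := \sum_(k < M) _.
have S0 : 0 <= S by apply: sumr_ge0 => k _; exact: powR_ge0.
have [->|Sn0] := eqVneq S 0; first exact: powR_ge0.
have Sp : 0 < S by rewrite lt_neqAle eq_sym Sn0.
pose X := S `^ q^-1.
have Xp : 0 < X by exact: powR_gt0.
have XS : X `^ q = S by rewrite /X -powRrM mulVf// powRr1.
pose a k := nc (x k) / X.
have a0 k : 0 <= a k by rewrite divr_ge0 ?nc_ge0 ?ltW.
have suma : \sum_(k < M) a k `^ q = 1.
  rewrite -(mulfV Sn0) /S mulr_suml; apply: eq_bigr => k _.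
  rewrite /a powRM ?nc_ge0 ?invr_ge0 ?ltW//; congr (_ * _).
  by rewrite -/S -[in RHS]XS -powR_inv1 ?ltW// -powRrM mulN1r powRN.
(* The equality case of Hölder: conjugate phase times the power q - 1 of the normalized modulus.
   Where x k = 0 the division gives 0, hence only an inequality in [ncc]. *)
pose c k : R[i] := ((x k : R[i])^*%C / (nc (x k))%:C%C) * (a k `^ (q - 1))%:C%C.
have ncc k : nc (c k) <= a k `^ (q - 1).
  rewrite /c !Normc.normcM Normc.normcV nc_real nc_conj nc_real.
  rewrite (ger0_norm (nc_ge0 _)) (ger0_norm (powR_ge0 _ _)).
  have [e|e] := eqVneq (nc (x k)) 0; first by rewrite e !mul0r powR_ge0.
  by rewrite mulfV// mul1r.
pose F (y : cseq R) : R[i] := \sum_(k < M) c k * y k.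
have FX : F x = X%:C%C.
  have e : \sum_(k < M) X * a k `^ q = X by rewrite -mulr_sumr suma mulr1.
  rewrite -e rmorph_sum /F; apply: eq_bigr => j _; rewrite /c.
  rewrite -(mulr_powRB1 (a0 j) q0) mulrA [X * a j]mulrC /a divfK ?gt_eqF//.
  rewrite rmorphM -/(a j) mulrAC; congr (_ * _).
  have [e0|e0] := eqVneq (x j) 0; first by rewrite e0 nc0 mulr0.
  rewrite mulrAC [_^*%C * _]mulrC mulc_conj expr2 rmorphM mulfK//.
  by rewrite (inj_eq (@complexI _)) nc_eq0.
have := h F; rewrite FX.
rewrite nc_real gtr0_norm// => h'.
have {h'} : X <= B.
  apply: h'.
    by move=> b y z; rewrite /F mulr_sumr -big_split; apply: eq_bigr => j _ /=;
      rewrite mulrDr mulrCA.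
  move=> y hy.
  have [e|Yn0] := eqVneq (nlp q y) 0.
    rewrite /F big1 ?nc0 ?nlp_ge0// => j _.
    by rewrite (nlp_eq0 q1 hy e) mulr0.
  have Y0 : 0 < nlp q y by rewrite lt_neqAle eq_sym Yn0 nlp_ge0.
  rewrite -[leRHS]mul1r -ler_pdivrMr// (le_trans (ler_wpM2r _ (nc_sum _ _ _)))//.
    by rewrite invr_ge0 ltW.
  rewrite mulr_suml.
  apply: (@le_trans _ _ (\sum_(k < M) ((1 - q^-1) * a k `^ q +
      q^-1 * (nc (y k) / nlp q y) `^ q))).
    apply: ler_sum => j _.
    have b0 : 0 <= nc (y j) / nlp q y by rewrite divr_ge0 ?nc_ge0 ?ltW.
    apply: le_trans (young_powR (a0 j) b0).
    by rewrite Normc.normcM -mulrA ler_wpM2r.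
  rewrite big_split /= -!mulr_sumr suma mulr1 -[leRHS](subrK q^-1).
  rewrite lerD2l ler_piMr ?invr_ge0 ?(ltW q0)//.
  have -> : 1 = (nlp q y `^ q) * ((nlp q y)^-1) `^ q.
    by rewrite -powRM ?invr_ge0 ?ltW// mulfV// powR1.
  under eq_bigr do rewrite powRM ?nc_ge0 ?invr_ge0 ?(ltW Y0)//.
  by rewrite -mulr_suml ler_wpM2r ?powR_ge0// sum_le_nlp.
move=> XB; rewrite -XS ge0_ler_powR ?nnegrE ?(ltW q0)// ltW//.
Qed.

End Duality.

(** * Subspaces as predicates, and estimates for determinants *)

Lemma subspaceD (C : fieldType) (E : lmodType C) (S : set E) x y :
  subspace S -> S x -> S y -> S (x + y).
Proof. by move=> [_ h] Sx Sy; rewrite -[x]scale1r; exact: h. Qed.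

Lemma subspaceZ (C : fieldType) (E : lmodType C) (S : set E) a x :
  subspace S -> S x -> S (a *: x).
Proof. by move=> [S0 h] Sx; rewrite -[_ *: _]addr0; exact: h. Qed.

Lemma subspaceN (C : fieldType) (E : lmodType C) (S : set E) x :
  subspace S -> S x -> S (- x).
Proof. by rewrite -scaleN1r; exact: subspaceZ. Qed.

Lemma subspaceB (C : fieldType) (E : lmodType C) (S : set E) x y :
  subspace S -> S x -> S y -> S (x - y).
Proof. by move=> hS Sx Sy; apply: subspaceD => //; exact: subspaceN. Qed.

Lemma subspace_sum (C : fieldType) (E : lmodType C) (S : set E)
    (I : Type) (r : seq I) (P : pred I) (F : I -> E) :
  subspace S -> (forall i, P i -> S (F i)) -> S (\sum_(i <- r | P i) F i).
Proof.
by move=> hS h; elim/big_ind: _ => //; [case: hS|move=> x y; exact: subspaceD].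
Qed.

Lemma basis_of_subspace (C : fieldType) (E : lmodType C) (S : set E) d
    (v : 'I_d -> E) : basis_of S v -> subspace S.
Proof.
move=> [_ ->]; split; first by exists (fun=> 0); rewrite big1// => i _; rewrite scale0r.
move=> a x y [c ->] [c' ->]; exists (fun i => a * c i + c' i).
rewrite scaler_sumr -big_split; apply: eq_bigr => i _ /=.
by rewrite scalerA scalerDl.
Qed.

Lemma has_dim_subspace (C : fieldType) (E : lmodType C) (S : set E) d :
  has_dim S d -> subspace S.
Proof. by move=> [v]; exact: basis_of_subspace. Qed.

Lemma det_replace_row (C : comNzRingType) d (s : 'I_d) (c : 'I_d -> C) :
  \det (\matrix_(i, j) if i == s then c j else (i == j)%:R) = c s.
Proof.
set E := \matrix_(i, j) _; rewrite (expand_det_row _ s).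
have cofE j : cofactor E s j = (j == s)%:R.
  have -> : cofactor E s j = cofactor 1%:M s j.
    rewrite /cofactor; congr (_ * \det _); apply/matrixP => a b; rewrite !mxE.
    by rewrite eq_sym (negbTE (neq_lift _ _)).
  have /matrixP/(_ j s) : \adj (1%:M : 'M[C]_d) = 1%:M.
    by rewrite -[LHS]mul1mx mul_mx_adj det1.
  by rewrite !mxE.
rewrite (bigD1 s)//= big1 => [|j js]; rewrite cofE ?(negbTE js) ?mulr0//.
by rewrite eqxx mulr1 addr0 !mxE eqxx.
Qed.

Lemma det_le (R : realType) d (M : 'M[R[i]]_d) (B : R) :
  (forall i j, nc (M i j) <= B) -> nc (\det M) <= d`!%:R * B ^+ d.
Proof.
move=> h; apply: le_trans (nc_sum _ _ _) _.
have -> : d`!%:R * B ^+ d = \sum_(s : 'S_d) B ^+ d.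
  by rewrite sumr_const card_Sn mulr_natl.
apply: ler_sum => s _; rewrite Normc.normcM nc_sign mul1r nc_prod.
rewrite -[X in _ ^+ X]card_ord -prodr_const; apply: ler_prod => i _.
by rewrite nc_ge0 h.
Qed.

(** The intervals with centre r k and radius e k meet pairwise, so the supremum of their left ends
    lies in all of them. Applied to real and imaginary parts, this supplies the limit of a Cauchy
    sequence of scalars. *)
Lemma approx_limit (R : realType) (r e : nat -> R) :
  (forall k l, `|r k - r l| <= e k + e l) ->
  exists rho, forall k, `|rho - r k| <= e k.
Proof.
move=> h; pose A := [set r k - e k | k in [set: nat]].
have ub l : ubound A (r l + e l).
  move=> _ [k _ <-]; have := h k l; rewrite ler_distlC => /andP[h1 h2].
  by have := h k l; rewrite ler_norml => /andP[_]; lra.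
have hs : has_sup A by split; [exists (r 0%N - e 0%N); exists 0%N|exists (r 0%N + e 0%N)].
exists (sup A) => k; rewrite ler_norml; apply/andP; split.
  have : r k - e k <= sup A by apply: sup_upper_bound => //; exists k.
  by lra.
have : sup A <= r k + e k by apply: ge_sup; [case: hs|exact: ub].
by lra.
Qed.

(** * Nearly normalized bases *)

Section FiniteDimension.
Variables (R : realType) (q : R).
Hypothesis q1 : 1 <= q.
Implicit Types x y : cseq R.

Definition nlp_closed (F : set (cseq R)) := forall x, lp q x ->
  (forall e : R, 0 < e -> exists2 y, F y & nlp q (x - y) < e) -> F x.

Lemma dist_pos F b : subspace F -> F `<=` lp q -> nlp_closed F ->
  lp q b -> ~ F b ->
  exists2 dl : R, 0 < dl &
    forall a u, F u -> dl * nc a <= nlp q (a *: b + u).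
Proof.
move=> sF Fl cF lb nFb.
have [e [e0 he]] : exists e : R, 0 < e /\ forall y, F y -> e <= nlp q (b - y).
  apply: contrapT => hn; apply: nFb; apply: cF => // e e0.
  apply: contrapT => hn'; apply: hn; exists e; split=> // y Fy.
  by rewrite leNgt; apply/negP => h; apply: hn'; exists y.
exists e => // a u Fu.
have [->|a0] := eqVneq a 0; first by rewrite nc0 mulr0 nlp_ge0.
have -> : a *: b + u = a *: (b - (- a^-1) *: u).
  by rewrite scalerBr scalerA mulrN mulfV// scaleN1r opprK.
rewrite nlpZ// mulrC ler_wpM2l ?nc_ge0// he//; exact: subspaceZ.
Qed.

(** Let a k *: b + u k tend to x. By [dist_pos] the a k form a Cauchy sequence; if [al] is their
    limit, x - al *: b is a limit of the u k and so lies in F. *)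
Lemma closed_add_line F b : subspace F -> F `<=` lp q -> nlp_closed F ->
  lp q b -> ~ F b -> nlp_closed [set x | exists a u, F u /\ x = a *: b + u].
Proof.
move=> sF Fl cF lb nFb x lx hx.
have [dl dl0 hdl] := dist_pos sF Fl cF lb nFb.
pose e k : R := k.+1%:R^-1.
have e0 k : 0 < e k by rewrite invr_gt0.
have /choice[au hau] : forall k, exists au : R[i] * cseq R,
    F au.2 /\ nlp q (x - (au.1 *: b + au.2)) < e k.
  move=> k; have [_ [a [u [Fu ->]]] h] := hx _ (e0 k).
  by exists (a, u).
pose a k := (au k).1; pose u k := (au k).2.
have Fu k : F (u k) by case: (hau k).
have lau k : lp q (a k *: b + u k) by apply: lpD => //; [exact: lpZ|exact: Fl].
have h k : nlp q (x - (a k *: b + u k)) < e k by case: (hau k).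
have ha k l : nc (a k - a l) <= e k / dl + e l / dl.
  rewrite -mulrDl ler_pdivlMr// mulrC.
  apply: le_trans (hdl _ _ (subspaceB sF (Fu k) (Fu l))) _.
  have -> : (a k - a l) *: b + (u k - u l) =
      (x - (a l *: b + u l)) - (x - (a k *: b + u k)).
    by rewrite opprB [RHS]addrC [RHS]addrA subrK scalerBl opprD [RHS]addrACA.
  apply: le_trans (nlpD q1 (lpB q1 lx (lau l)) (lpN q1 (lpB q1 lx (lau k)))) _.
  by rewrite nlpN// addrC lerD// ltW.
have [rho hrho] := @approx_limit R (fun k => complex.Re (a k)) (fun k => e k / dl)
  (fun k l => le_trans (eq_ind _ (fun z => `|z| <= nc (a k - a l)) (nc_re _)
     _ (raddfB _ _ _)) (ha k l)).
have [iot hiot] := @approx_limit R (fun k => complex.Im (a k)) (fun k => e k / dl)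
  (fun k l => le_trans (eq_ind _ (fun z => `|z| <= nc (a k - a l)) (nc_im _)
     _ (raddfB _ _ _)) (ha k l)).
pose al : R[i] := (rho +i* iot)%C.
have hal k : nc (al - a k) <= 2 * (e k / dl).
  apply: le_trans (nc_le _) _; rewrite mulr_natl mulr2n.
  have := hrho k; have := hiot k; rewrite /al.
  by case: (a k) => r1 r2 /= h1 h2; rewrite lerD.
exists al, (x - al *: b); split; last by rewrite addrC subrK.
have lxab : lp q (x - al *: b) by apply: lpB => //; exact: lpZ.
apply: cF => // eps eps0.
(* The distance from x - al *: b to u k is at most e k for the approximation of x, plus |al - a k|
   |b|, where |al - a k| is at most 2 e k / dl (real and imaginary parts). *)
pose M := 1 + 2 / dl * nlp q b.
have M0 : 0 < M by rewrite ltr_pwDl// !mulr_ge0 ?invr_ge0 ?nlp_ge0// ltW.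
have [k hk] : exists k, e k * M < eps.
  exists (Num.truncn (M / eps)); rewrite /e mulrC ltr_pdivrMr//.
  rewrite mulrC -ltr_pdivrMr//; exact: truncnS_gt.
exists (u k) => //.
have -> : x - al *: b - u k = (x - (a k *: b + u k)) - (al - a k) *: b.
  by rewrite scalerBl opprB opprD !addrA [in RHS](addrAC x) subrK [RHS]addrAC.
apply: le_lt_trans (nlpD q1 (lpB q1 lx (lau k)) (lpN q1 (lpZ q1 _ lb))) _.
rewrite nlpN// nlpZ//; apply: lt_trans hk.
rewrite /M mulrDr mulr1 ltr_leD//.
rewrite mulrA ler_wpM2r ?nlp_ge0//; apply: le_trans (hal k) _.
by rewrite !mulrA [_ * 2]mulrC.
Qed.

(** Induction on d: the line through the first vector is absorbed into the closed subspace, which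
    bounds the other coefficients; [dist_pos] then bounds the first. Used with F = W_i^c, this makes
    the projection onto W_i bounded without an open mapping argument. *)
Lemma coef_bound d F (b : 'I_d -> cseq R) :
  subspace F -> F `<=` lp q -> nlp_closed F -> (forall t, lp q (b t)) ->
  (forall c, F (\sum_t c t *: b t) -> forall t, c t = 0) ->
  exists2 B : R, 0 < B & forall c u, F u -> forall t,
    nc (c t) <= B * nlp q (\sum_t c t *: b t + u).
Proof.
elim: d F b => [|d IH] F b sF Fl cF lb ind; first by exists 1 => // c u _ [].
have nFb : ~ F (b ord0).
  move=> Fb; have := ind (fun t => (t == ord0)%:R) _ ord0 => /=.
  have -> : \sum_t (t == ord0)%:R *: b t = b ord0.
    rewrite (bigD1 ord0)//= ?eqxx scale1r big1 ?addr0// => t t0.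
    by rewrite (negbTE t0) scale0r.
  by move=> /(_ Fb)/eqP; rewrite oner_eq0.
pose G := [set x | exists a u, F u /\ x = a *: b ord0 + u].
have sG : subspace G.
  split; first by exists 0, 0; rewrite scale0r addr0; case: sF.
  move=> a _ _ [a1 [u1 [F1 ->]]] [a2 [u2 [F2 ->]]].
  exists (a * a1 + a2), (a *: u1 + u2); split; first by case: sF => _; apply.
  by rewrite scalerDr scalerDl scalerA addrACA.
have Gl : G `<=` lp q.
  by move=> _ [a [u [Fu ->]]]; apply: lpD => //; [exact: lpZ|exact: Fl].
have cG : nlp_closed G by apply: closed_add_line.
have [||B B0 hB] := IH G (fun t => b (lift ord0 t)) sG Gl cG.
- by move=> t.
- move=> c [a [u [Fu e]]] t.
  pose c' (s : 'I_d.+1) := if unlift ord0 s is Some r then c r else - a.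
  have := ind c' _ (lift ord0 t); rewrite /c' liftK; apply.
  rewrite big_ord_recl; under eq_bigr do rewrite liftK.
  by rewrite unlift_none e addrA scaleNr addNr add0r.
have [dl dl0 hdl] := dist_pos sF Fl cF (lb ord0) nFb.
pose C := 1 + \sum_(t < d) B * nlp q (b (lift ord0 t)).
have C0 : 0 < C.
  by rewrite ltr_pwDl// sumr_ge0// => t _; rewrite mulr_ge0 ?nlp_ge0// ltW.
exists (B + C / dl) => [|c u Fu t]; first by rewrite addr_gt0// divr_gt0.
set x := \sum_t c t *: b t + u.
have xE : x = \sum_t c (lift ord0 t) *: b (lift ord0 t) + (c ord0 *: b ord0 + u).
  by rewrite /x big_ord_recl [c ord0 *: _ + _]addrC -addrA.
have lx : lp q x.
  by apply: lpD => //; [apply: lp_sum => // s _; exact: lpZ|exact: Fl].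
have hl s : nc (c (lift ord0 s)) <= B * nlp q x.
  rewrite xE; apply: (hB (fun s => c (lift ord0 s))).
  by exists (c ord0), u.
case: (unliftP ord0 t) => [s ->|->].
  apply: le_trans (hl s) _; rewrite ler_wpM2r ?nlp_ge0// lerDl.
  by rewrite divr_ge0// ltW.
have h0 : nc (c ord0) <= C / dl * nlp q x.
  rewrite mulrAC ler_pdivlMr// mulrC; apply: le_trans (hdl _ _ Fu) _.
  have -> : c ord0 *: b ord0 + u = x - \sum_t c (lift ord0 t) *: b (lift ord0 t).
    by rewrite xE addrAC subrr add0r.
  have l2 : lp q (\sum_t c (lift ord0 t) *: b (lift ord0 t)).
    by apply: lp_sum => // s _; exact: lpZ.
  apply: le_trans (nlpD q1 lx (lpN q1 l2)) _.
  rewrite nlpN// mulrDl mul1r lerD2l mulr_suml.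
  have nl := @nlp_sum _ q q1 _ (index_enum 'I_d) xpredT
    (fun s => c (lift ord0 s) *: b (lift ord0 s)) (fun s _ => lpZ q1 _ (lb _)).
  apply: (le_trans nl).
  apply: ler_sum => s _; rewrite nlpZ// mulrAC ler_wpM2r ?nlp_ge0//.
apply: le_trans h0 _; rewrite ler_wpM2r ?nlp_ge0// lerDr ltW//.
Qed.

Lemma near_auerbach d W (b : 'I_d -> cseq R) (B : R) :
  basis_of W b -> (forall t, lp q (b t)) -> 0 < B ->
  (forall c t, nc (c t) <= B * nlp q (\sum_t c t *: b t)) ->
  exists w : 'I_d -> cseq R, [/\ basis_of W w, forall t, nlp q (w t) <= 1
    & forall c t, nc (c t) <= 2 * nlp q (\sum_t c t *: w t)].
Proof.
move=> [bi bW] lb B0 hB.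
pose ro (M : 'M[R[i]]_d) s := \sum_t M s t *: b t.
have lro M s : lp q (ro M s) by apply: lp_sum => // t _; exact: lpZ.
(* Volumes, relative to [b], of d-tuples in the unit ball. They are bounded because [hB] bounds
   coefficients, and the normalized [b] itself gives a positive one, [D]. *)
pose A := [set nc (\det M) | M in [set M | forall s, nlp q (ro M s) <= 1]].
have ubA : ubound A (d`!%:R * B ^+ d).
  move=> _ [M hM <-]; apply: det_le => i j.
  apply: le_trans (hB (M i) j) _; rewrite ler_piMr ?(ltW B0)//; exact: hM.
have bn0 t : 0 < nlp q (b t).
  rewrite lt_neqAle nlp_ge0 andbT eq_sym; apply/eqP => e.
  have := hB (fun s => (s == t)%:R) t; rewrite eqxx Normc.normc1.
  have -> : \sum_s (s == t)%:R *: b s = b t.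
    rewrite (bigD1 t)//= eqxx scale1r big1 ?addr0// => s st.
    by rewrite (negbTE st) scale0r.
  by rewrite e mulr0 ler10.
pose D : 'M[R[i]]_d := diag_mx (\row_t ((nlp q (b t))^-1)%:C%C).
have AD : A (nc (\det D)).
  exists D => // s; rewrite /ro (bigD1 s)//= big1 => [|t ts].
    rewrite addr0 nlpZ// !mxE eqxx nc_real ger0_norm ?invr_ge0 ?nlp_ge0//.
    by rewrite mulVf// gt_eqF.
  by rewrite !mxE eq_sym (negbTE ts) scale0r.
have D0 : 0 < nc (\det D).
  rewrite det_diag nc_prod prodr_gt0// => t _; rewrite mxE nc_real normr_gt0.
  by rewrite invr_eq0 gt_eqF.
have hs : has_sup A by split; [exists (nc (\det D))|exists (d`!%:R * B ^+ d)].
have S0 : 0 < sup A by apply: lt_le_trans D0 _; exact: sup_upper_bound.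
(* A tuple reaching more than half the supremum is enough, at the price of the factor 2 in the
   coefficient bound. *)
have [|_ [M hM <-] hd] := @sup_adherent R A (sup A / 2) _ hs.
  by rewrite divr_gt0.
have dM : 0 < nc (\det M) by lra.
have uM : M \in unitmx by rewrite unitmxE unitfE -nc_gt0.
have comb (c : 'rV[R[i]]_d) :
    \sum_s c 0 s *: ro M s = \sum_t (c *m M) 0 t *: b t.
  under eq_bigr do rewrite scaler_sumr.
  rewrite exchange_big; apply: eq_bigr => t _ /=.
  by rewrite mxE scaler_suml; apply: eq_bigr => s _; rewrite scalerA.
exists (ro M); split; [|exact: hM|].
- split=> [c hc r|].
    have := comb (\row_t c t); under eq_bigr do rewrite mxE.
    rewrite hc => /esym/bi h; have : (\row_t c t) *m M = 0.
      by apply/rowP => t; rewrite h mxE.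
    move=> /(congr1 (mulmx^~ (invmx M))); rewrite (mulmxK uM) mul0mx => /rowP/(_ r).
    by rewrite !mxE.
  rewrite bW; apply/seteqP; split=> x /= [c ->].
    exists (fun t => ((\row_t c t) *m invmx M) 0 t); rewrite comb mulmxKV//.
    by apply: eq_bigr => t _; rewrite mxE.
  exists (fun t => ((\row_t c t) *m M) 0 t); rewrite -comb.
  by apply: eq_bigr => t _; rewrite mxE.
- move=> c t; set x := \sum_t _.
  have lx : lp q x by apply: lp_sum => // s _; apply: lpZ.
  have [x0|xn0] := eqVneq (nlp q x) 0.
    have := nlp_eq0 q1 lx x0; rewrite /x.
    have := comb (\row_t c t); under eq_bigr do rewrite mxE.
    move=> -> /bi h; have : (\row_t c t) *m M = 0.
      by apply/rowP => s; rewrite h mxE.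
    move=> /(congr1 (mulmx^~ (invmx M))); rewrite (mulmxK uM) mul0mx => /rowP/(_ t).
    by rewrite !mxE => ->; rewrite nc0 mulr_ge0 ?nlp_ge0.
  have xp : 0 < nlp q x by rewrite lt_neqAle eq_sym xn0 nlp_ge0.
  (* Replaces the t-th vector by x / |x|, which multiplies the determinant by c t / |x|. The new
     volume is at most [sup A], hence less than 2 |det M|. *)
  pose E := \matrix_(i, j) if i == t then c j * ((nlp q x)^-1)%:C%C else (i == j)%:R.
  have AE : A (nc (\det (E *m M))).
    exists (E *m M); last exact: erefl.
    move=> s.
    have roE : ro (E *m M) s = \sum_j E s j *: ro M j.
      have := comb (row s E); under eq_bigr do rewrite mxE.
      by move=> ->; apply: eq_bigr => j _; rewrite -row_mul [in RHS]mxE.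
    rewrite roE; have [->|st] := eqVneq s t.
      have -> : \sum_j E t j *: ro M j = ((nlp q x)^-1)%:C%C *: x.
        rewrite /x scaler_sumr; apply: eq_bigr => j _.
        by rewrite mxE eqxx scalerA mulrC.
      rewrite nlpZ// nc_real ger0_norm ?invr_ge0 ?nlp_ge0//.
      by rewrite mulVf.
    have -> : \sum_j E s j *: ro M j = ro M s; last exact: hM.
    rewrite (bigD1 s)//= mxE (negbTE st) eqxx scale1r big1 ?addr0// => j js.
    by rewrite mxE (negbTE st) eq_sym (negbTE js) scale0r.
  have := sup_upper_bound hs AE.
  rewrite det_mulmx det_replace_row !Normc.normcM nc_real ger0_norm; last first.
    by rewrite invr_ge0 nlp_ge0.
  rewrite mulrAC (ler_pdivrMr _ _ xp) => h.
  have h2 : nc (c t) * nc (\det M) <= (2 * nc (\det M)) * nlp q x.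
    by apply: le_trans h _; rewrite ler_wpM2r ?nlp_ge0//; lra.
  by rewrite -(ler_pM2r dM); lra.
Qed.

End FiniteDimension.

(** * Sums over finite subsets of a fixed size *)

Section SumsOverFiniteSets.
Variable R : realType.
Local Open Scope ereal_scope.

Lemma esumZ_le (T : choiceType) (A : set T) (c : R) (a : T -> \bar R) :
  (0 <= c)%R -> (forall t, 0 <= a t) ->
  \esum_(t in A) (c%:E * a t) <= c%:E * \esum_(t in A) a t.
Proof.
move=> c0 a0; apply: ge_ereal_sup => _ [X [finX XA] <-].
rewrite -ge0_mule_fsumr//; rewrite lee_wpmul2l ?lee_fin//.
by apply: esum_ge; exists X.
Qed.

Lemma sume_const_ord k (x : \bar R) : \sum_(i < k) x = k%:R%:E * x.
Proof.
elim: k => [|k IH]; first by rewrite big_ord0 mul0e.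
by rewrite big_ord_recl IH -[X in X + _]mul1e -ge0_muleDl ?lee_fin// -EFinD -natr1 addrC.
Qed.

(** Double counting: a set J with a point outside it is the same as a set of size b + 1 with a
    marked element, so every such set occurs b + 1 times. *)
Lemma esum_fsetU1 (g : {fset nat} -> \bar R) b : (forall J, 0 <= g J) ->
  \esum_(J in [set J : {fset nat} | #|` J| = b])
    \esum_(k in [set k | k \notin J]) g (k |` J)%fset =
  \sum_(i < b.+1) \esum_(J in [set J : {fset nat} | #|` J| = b.+1]) g J.
Proof.
move=> g0; rewrite -esum_sum; last by [].
rewrite esum_esum; last by [].
transitivity (\esum_(J in [set J : {fset nat} | #|` J| = b.+1])
   \esum_(k in [set k | k \in J]) g J).
  rewrite esum_esum; last by [].
  rewrite (reindex_esum ([set J : {fset nat} | #|` J| = b.+1] `*``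
      (fun J => [set k | k \in J])) _ (fun x => (x.1 `\ x.2, x.2)%fset)).
    apply: eq_esum => -[J k] /= [_ kJ]; by rewrite fsetD1K.
  split=> [[J k] /= [cJ kJ]|[J k] [J' k']|[J k] /= [cJ kJ]].
  - split; last by rewrite !inE eqxx.
    by have := cardfsD1 k J; rewrite cJ kJ add1n => -[].
  - rewrite !inE /= => -[_ kJ] [_ kJ'] [e1 e2]; congr (_, _) => //.
    by rewrite -(fsetD1K kJ) -(fsetD1K kJ') e1 e2.
  - exists (k |` J, k)%fset => /=; last by rewrite fsetU1K.
    by rewrite cardfsU1 kJ cJ !inE eqxx.
apply: eq_esum => J /= cJ; rewrite esum_fset; last by [].
  rewrite fsbig_finite ?set_fsetK//.
  by rewrite big_const_seq count_predT big_const_ord -cJ.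
exact: finite_fset.
Qed.

End SumsOverFiniteSets.

Lemma linear_on_sum (C : fieldType) (E F : lmodType C) (S : set E) (f : E -> F)
    (I : Type) (r : seq I) (P : pred I) (c : I -> C) (x : I -> E) :
  subspace S -> linear_on S f -> (forall i, P i -> S (x i)) ->
  f (\sum_(i <- r | P i) c i *: x i) = \sum_(i <- r | P i) c i *: f (x i).
Proof.
move=> sS lf Sx; have f0 : f 0 = 0.
  have := lf (-1) 0 0 sS.1 sS.1.
  by rewrite scaleN1r oppr0 add0r scaleN1r addNr.
suff [] : f (\sum_(i <- r | P i) c i *: x i) = \sum_(i <- r | P i) c i *: f (x i)
  /\ S (\sum_(i <- r | P i) c i *: x i) by [].
elim/big_rec2: _ => [|i y1 y2 Pi [<- Sy]]; first by split => //; exact: sS.1.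
by split; [exact: lf (Sx i Pi) Sy|case: sS => _; apply => //; exact: Sx].
Qed.

Lemma lp_subspace (R : realType) (q : R) : 1 <= q -> subspace (@lp R q).
Proof.
move=> q1; split=> [|a x y lx ly]; first exact: lp0.
by apply: lpD => //; exact: lpZ.
Qed.

(** * Mixed norms and contraction by functionals *)

Section Contraction.
Variables (R : realType) (m n : nat) (p : 'I_m -> R) (v : 'I_n -> mseq R m).
Hypothesis p1 : forall i, 1 <= p i.
Hypothesis vX : forall r, Xspace p (v r).
Variables (cs : 'I_n -> 'I_m) (th : 'I_n -> cseq R -> R[i]^o) (B : R).
Hypothesis B1 : 1 <= B.
Hypothesis th_lin : forall s, linear_on (lp (p (cs s))) (th s).
Hypothesis th_le : forall s x, lp (p (cs s)) x ->
  nc (th s x) <= B * nlp (p (cs s)) x.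

Let p0 i : 0 < p i. Proof. exact: lt_le_trans (p1 i). Qed.
Let B0 : 0 <= B. Proof. exact: le_trans B1. Qed.

(* The columns are coordinates (inl) or values of functionals (inr); the latter are
   traded for coordinates, one component at a time. *)
Definition label_value (a : 'I_m * nat + 'I_n) (r : 'I_n) : R[i] :=
  match a with inl ik => v r ik.1 ik.2 | inr s => th s (v r (cs s)) end.

Definition label_minor (L : seq ('I_m * nat + 'I_n)) : R :=
  nc (coldet label_value L).

Lemma label_minor_ge0 L : 0 <= label_minor L. Proof. exact: nc_ge0. Qed.

Lemma label_minor_perm L L' : size L = n -> perm_eq L' L ->
  label_minor L' = label_minor L.
Proof.
move=> sL pL; have [e h] := coldet_perm R[i] sL pL.
by rewrite /label_minor h Normc.normcM nc_sign mul1r.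
Qed.

(** By cofactor expansion the minor is a linear form in its first column. With y the corresponding
    combination of the i-th components of the vectors, the functional column gives [th s y] and the
    coordinate columns give the y k, so the bound on [th s] applies to y. *)
Lemma label_minor_functional s L (i := cs s) :
  ((label_minor (inr s :: L) `^ p i)%:E <= (B `^ p i)%:E *
    \esum_(k in [set: nat]) (label_minor (inl (i, k) :: L) `^ p i)%:E)%E.
Proof.
have n0 : (0 < n)%N by case: n s {i} => // -[].
have [kap hk] := coldet_cons label_value L.
pose y : cseq R := \sum_r kap r *: v r i.
have ly : lp (p i) y by apply: lp_sum => // r _; apply: lpZ => //; exact: vX.
have thy : coldet label_value (inr s :: L) = th s y.
  rewrite hk// /y (linear_on_sum _ _ (lp_subspace (p1 i)) (@th_lin s))//.
  by move=> r _; exact: vX.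
have yk k : coldet label_value (inl (i, k) :: L) = y k.
  by rewrite hk// /y fct_sumE.
rewrite /label_minor thy.
under eq_esum do rewrite yk.
rewrite lpnorm_pow// lp_nlp// poweR_EFin -EFinM lee_fin -powRM ?nlp_ge0//.
rewrite ge0_ler_powR ?(ltW (p0 _))// ?nnegrE ?nc_ge0 ?mulr_ge0 ?nlp_ge0//.
exact: th_le.
Qed.

Definition coord_labels (i : 'I_m) (J : {fset nat}) : seq ('I_m * nat + 'I_n) :=
  [seq inl (i, k) | k <- enum_fset J].

(** The functionals of component i are traded one at a time. A new coordinate already in J repeats a
    column and gives 0, so only larger sets J remain; each arises b + 1 times in a step, whence the
    factorial. *)
Lemma label_minor_elim i (S : seq 'I_n) L :
  (forall s, s \in S -> cs s = i) -> (size S + size L)%N = n ->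
  ((label_minor (map inr S ++ L) `^ p i)%:E <=
    ((B `^ p i) ^+ size S * (size S)`!%:R)%:E *
    \esum_(J in [set J : {fset nat} | #|` J| = size S])
      (label_minor (coord_labels i J ++ L) `^ p i)%:E)%E.
Proof.
have pw_ge0 x : (0 <= (label_minor x `^ p i)%:E)%E by rewrite lee_fin powR_ge0.
elim: S L => [|s S IH] L hS sz /=.
  rewrite expr0 mul1r mul1e.
  apply: le_trans (esum_ge1 (t := fset0) _ _) => //.
have csi : cs s = i by apply: hS; rewrite inE eqxx.
have hS' t : t \in S -> cs t = i by move=> tS; apply: hS; rewrite inE tS orbT.
have sz' : (size S + size (inr s :: L))%N = n by rewrite /= addnS -addSn.
have -> : label_minor (inr s :: map inr S ++ L) =
    label_minor (map inr S ++ inr s :: L).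
  apply/esym; apply: label_minor_perm; first by rewrite /= size_cat size_map.
  by rewrite -cat1s perm_catCA.
apply: le_trans (IH _ hS' sz') _.
set b := size S; set cb : R := (B `^ p i) ^+ b * b`!%:R.
have cb0 : 0 <= cb by rewrite mulr_ge0 ?exprn_ge0 ?powR_ge0.
pose g J := (label_minor (coord_labels i J ++ L) `^ p i)%:E.
have step J : #|` J| = b ->
  ((label_minor (coord_labels i J ++ inr s :: L) `^ p i)%:E <=
   (B `^ p i)%:E * \esum_(k in [set k | k \notin J]) g (k |` J)%fset)%E.
  move=> cJ.
  have -> : label_minor (coord_labels i J ++ inr s :: L) =
      label_minor (inr s :: coord_labels i J ++ L).
    apply: label_minor_perm.
      by rewrite /= size_cat size_map -[size _]/(#|` J|) cJ; exact: sz.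
    by rewrite -cat1s perm_catCA.
  rewrite -csi; apply: le_trans (label_minor_functional _ _) _; rewrite csi.
  apply: lee_wpmul2l; first by rewrite lee_fin powR_ge0.
  rewrite [X in (_ <= X)%E]esum_mkcond.
  apply: le_esum => k _; case: ifPn => [/set_mem /= kJ|/negP kJ'].
    rewrite /g lee_fin; apply: ler_eq; congr (_ `^ _); apply/esym.
    apply: label_minor_perm.
      by rewrite /= size_cat size_map -[size _]/(#|` J|) cJ; exact: sz.
    rewrite -cat_cons perm_cat2r /coord_labels -map_cons perm_map//.
    apply: uniq_perm; rewrite ?fset_uniq//= ?fset_uniq ?andbT//.
    by move=> x; rewrite !inE.
  have kJ : k \in J by apply: contrapT => /negP kJ; apply/kJ'/mem_set.
  rewrite lee_fin /label_minor coldet_dup ?nc0 ?powR0 ?gt_eqF//.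
    by rewrite /= size_cat size_map -[size _]/(#|` J|) cJ; exact: sz.
  rewrite /= mem_cat negb_and negbK; apply/orP; left; apply/orP; left.
  exact: map_f.
apply: (@le_trans _ _ (cb%:E * \esum_(J in [set J : {fset nat} | #|` J| = b])
   ((B `^ p i)%:E * \esum_(k in [set k | k \notin J]) g (k |` J)%fset))%E).
  by rewrite lee_wpmul2l ?lee_fin//; apply: le_esum.
apply: (@le_trans _ _ (cb%:E * ((B `^ p i)%:E *
   \esum_(J in [set J : {fset nat} | #|` J| = b])
     \esum_(k in [set k | k \notin J]) g (k |` J)%fset))%E).
  rewrite lee_wpmul2l ?lee_fin//; apply: esumZ_le; rewrite ?powR_ge0//.
  by move=> J; apply: esum_ge0 => k _; exact: pw_ge0.
rewrite esum_fsetU1; last by move=> J; exact: pw_ge0.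
rewrite sume_const_ord !muleA -!EFinM.
rewrite le_eqVlt; apply/orP; left; apply/eqP; congr (_%:E * _)%E.
by rewrite /cb factS natrM exprS; ring.
Qed.

Definition functionals_at (l : 'I_m) : seq 'I_n := [seq t <- enum 'I_n | cs t == l].

Let a (l : 'I_m) : int := (size (functionals_at l))%:Z.

Definition block_labels (s : seq 'I_m) (I : 'I_m -> {fset nat}) (l : 'I_m) :=
  if l \in s then map inr (functionals_at l) else coord_labels l (I l).

Definition labels (s : seq 'I_m) (I : 'I_m -> {fset nat}) :=
  flatten [seq block_labels s I l | l <- enum 'I_m].

Lemma size_functionals : (\sum_l size (functionals_at l))%N = n.
Proof.
rewrite -[RHS](size_enum_ord n) -sum1_size (partition_big cs xpredT)//=.
by apply: eq_bigr => l _; rewrite /functionals_at -sum1_size big_filter.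
Qed.

Lemma size_labels s I : (forall l, l \notin s -> (#|` I l|)%:Z = a l) ->
  size (labels s I) = n.
Proof.
move=> hI; rewrite /labels size_flatten /shape -map_comp sumnE big_map big_enum /=.
rewrite -[RHS]size_functionals; apply: eq_bigr => l _; rewrite /= /block_labels.
case: ifPn => ls; first by rewrite size_map.
by rewrite size_map -[LHS]/(#|` I l|); have := hI l ls => -[].
Qed.

Lemma labels_split s I i :
  perm_eq (labels s I) (block_labels s I i ++
     flatten [seq block_labels s I l | l <- rem i (enum 'I_m)]).
Proof.
rewrite -[X in perm_eq _ X]/(flatten [seq block_labels s I l | l <- i :: rem i (enum 'I_m)]).
by apply/perm_flatten/perm_map/perm_to_rem; rewrite mem_enum.
Qed.

(** The p_l-th root of the constant in [label_minor_elim], with n in place of the number of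
    functionals, so that it does not depend on the type of the block. *)
Definition elim_const (l : 'I_m) : R := ((B `^ p l) ^+ n * n`!%:R) `^ (p l)^-1.

Lemma elim_const_ge0 l : 0 <= elim_const l. Proof. exact: powR_ge0. Qed.

Lemma mixed_norm_ge0 (b : 'I_m -> int) s f I : (forall I, (0 <= f I)%E) ->
  (0 <= mixed_norm p b s f I)%E.
Proof. by move=> f0; case: s => [|i s] //=; exact: poweR_ge0. Qed.

(** Components in s have functional columns, the others coordinate columns given by I. Each step of
    the induction trades the functionals of one component for the outermost variable of the mixed
    norm. *)
Lemma label_minor_mixed s I : uniq s ->
  (forall l, l \notin s -> (#|` I l|)%:Z = a l) ->
  ((label_minor (labels s I))%:E <= (\prod_(l <- s) elim_const l)%:E *
     mixed_norm p a s (fun I => (nc (plucker v I))%:E) I)%E.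
Proof.
elim: s I => [|i s IH] I /=.
  move=> _ hI; rewrite big_nil mul1e lee_fin.
  have hp : perm_eq (labels [::] I) (map inl (points I)).
    rewrite /points map_allpairs; apply: perm_allpairs_dep => // l _.
    by rewrite perm_sym perm_sort.
  have sz : size ([seq inl ik | ik <- points I] : seq ('I_m * nat + 'I_n)) = n.
    by rewrite -(perm_size hp) size_labels.
  by rewrite (label_minor_perm sz hp) /label_minor coldet_map.
move=> /andP[iNs us] hI; pose f (I : 'I_m -> {fset nat}) := (nc (plucker v I))%:E.
set rest := flatten [seq block_labels (i :: s) I l | l <- rem i (enum 'I_m)].
have sz : size (labels (i :: s) I) = n by exact: size_labels.
have pS := labels_split (i :: s) I i.
rewrite -/rest /block_labels inE eqxx /= in pS.
have sz2 : (size (functionals_at i) + size rest)%N = n.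
  by rewrite -[RHS]sz (perm_size pS) size_cat size_map.
have iNrem : i \notin rem i (enum 'I_m) by rewrite mem_rem_uniq ?enum_uniq// inE eqxx.
have fS t : t \in functionals_at i -> cs t = i.
  by rewrite mem_filter => /andP[/eqP].
pose upd J := fun l => if l == i then J else I l : {fset nat}.
have mle J : #|` J| = size (functionals_at i) ->
    ((label_minor (coord_labels i J ++ rest))%:E <=
     (\prod_(l <- s) elim_const l)%:E * mixed_norm p a s f (upd J))%E.
  move=> cJ.
  have hu l : l \notin s -> (#|` upd J l|)%:Z = a l.
    rewrite /upd; case: eqVneq => [->|li] ls; first by rewrite cJ.
    by apply: hI; rewrite inE (negbTE li).
  have pJ := labels_split s (upd J) i.
  have eJ : block_labels s (upd J) i = coord_labels i J.
    by rewrite /block_labels (negbTE iNs) /upd eqxx.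
  rewrite eJ in pJ.
  have er : flatten [seq block_labels s (upd J) l | l <- rem i (enum 'I_m)] = rest.
    congr flatten; apply/eq_in_map => l lr; rewrite /block_labels inE /upd.
    have -> : (l == i) = false by apply: contraNF iNrem => /eqP e; rewrite -[X in X \in _]e.
    by [].
  rewrite er perm_sym in pJ.
  by rewrite (label_minor_perm (size_labels hu) pJ); exact: IH.
set M := \prod_(l <- s) elim_const l in mle *.
have M0 : 0 <= M by apply: prodr_ge0 => l _; exact: elim_const_ge0.
have f0 I' : (0 <= f I')%E by rewrite lee_fin nc_ge0.
have mx0 J : (0 <= mixed_norm p a s f (upd J))%E by exact: mixed_norm_ge0.
have pn0 : p i != 0 by rewrite gt_eqF.
have -> : label_minor (labels (i :: s) I) =
    label_minor (map inr (functionals_at i) ++ rest).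
  by apply: label_minor_perm => //; rewrite size_cat size_map.
have cE : [set J : {fset nat} | #|` J|%:Z = a i] =
    [set J : {fset nat} | #|` J| = size (functionals_at i)].
  by apply/seteqP; split=> J /=; rewrite /a; [case|move=> ->].
rewrite cE; set E := (\esum_(J in _) _)%E.
have E0 : (0 <= E)%E by apply: esum_ge0 => J _; exact: poweR_ge0.
set c := (B `^ p i) ^+ n * n`!%:R.
have c0 : 0 <= c by rewrite mulr_ge0 ?exprn_ge0 ?powR_ge0.
have key : ((label_minor (map inr (functionals_at i) ++ rest) `^ p i)%:E <=
    (c * M `^ p i)%:E * E)%E.
  apply: le_trans (label_minor_elim fS sz2) _.
  apply: (@le_trans _ _ (c%:E *
      \esum_(J in [set J : {fset nat} | #|` J| = size (functionals_at i)])
      (label_minor (coord_labels i J ++ rest) `^ p i)%:E)%E).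
    apply: lee_wpmul2r.
      by apply: esum_ge0 => J _; rewrite lee_fin powR_ge0.
    have sn : (size (functionals_at i) <= n)%N by rewrite -[X in (_ <= X)%N]sz2 leq_addr.
    have Bp : 1 <= B `^ p i by rewrite -(powRr0 B) ler_powR// ltW.
    rewrite lee_fin ler_pM ?exprn_ge0 ?powR_ge0// ?ler_nat ?leq_fact//.
    by rewrite ler_weXn2l.
  have -> : (c * M `^ p i)%:E = (c%:E * (M `^ p i)%:E)%E by [].
  rewrite -muleA; apply: lee_wpmul2l; rewrite ?lee_fin//.
  apply: le_trans (esumZ_le _ (powR_ge0 _ _) _); last by move=> J; exact: poweR_ge0.
  apply: le_esum => J /= cJ; rewrite -poweR_EFin -[X in (X * _)%E]poweR_EFin.
  rewrite -poweRM ?lee_fin//; last exact: mx0.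
  apply: gt0_ler_poweR; rewrite ?(ltW (p0 i))//.
  - by rewrite in_itv /= leey andbT lee_fin label_minor_ge0.
  - by rewrite in_itv /= leey andbT mule_ge0 ?lee_fin//; exact: mx0.
  - exact: mle.
rewrite big_cons -/M -[leLHS]poweRe1 ?lee_fin ?label_minor_ge0//.
rewrite -[X in poweR _ X](mulfV pn0) poweRrM poweR_EFin.
have -> : (((elim_const i * M)%:E) * poweR E (p i)^-1 =
    poweR ((c * M `^ p i)%:E * E) (p i)^-1)%E.
  rewrite poweRM//; last by rewrite lee_fin mulr_ge0 ?powR_ge0.
  rewrite poweR_EFin (powRM _ c0) ?powR_ge0//.
  by rewrite -powRrM mulfV// powRr1.
apply: gt0_ler_poweR key.
- by rewrite invr_ge0 ltW.
- by rewrite in_itv /= leey andbT lee_fin powR_ge0.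
- by rewrite in_itv /= leey andbT mule_ge0// lee_fin mulr_ge0 ?powR_ge0.
Qed.

Lemma contraction (ord : seq 'I_m) : perm_eq ord (enum 'I_m) ->
  ((nc (\det (\matrix_(r < n, s < n) th s (v r (cs s)))))%:E <=
    (\prod_l elim_const l)%:E * block_norm p ord a v)%E.
Proof.
move=> po; have inord l : l \in ord by rewrite (perm_mem po) mem_enum.
have uo : uniq ord by rewrite (perm_uniq po) enum_uniq.
have hI l : l \notin ord -> (#|` (fset0 : {fset nat})|)%:Z = a l by rewrite inord.
have pL : perm_eq (map inr (enum 'I_n)) (labels ord (fun=> fset0)).
  have -> : labels ord (fun=> fset0) =
      map inr (flatten [seq functionals_at l | l <- enum 'I_m]).
    rewrite map_flatten -map_comp; congr flatten; apply: eq_map => l.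
    by rewrite /block_labels inord.
  apply: perm_map; apply/seq.permP => q.
  rewrite count_flatten sumnE -map_comp big_map big_enum /=.
  rewrite -sum1_count (partition_big cs xpredT)//=; apply: eq_bigr => l _.
  by rewrite -sum1_count /functionals_at big_filter_cond; apply: eq_bigl => t;
    rewrite andbC.
have := label_minor_mixed uo hI; rewrite (perm_big _ po) big_enum /=.
apply: le_trans; rewrite -(label_minor_perm (size_labels hI) pL) /label_minor coldet_map.
rewrite -val_ord_tuple coldet_tuple.
rewrite lee_fin; apply: ler_eq; congr (nc (\det _)); apply/matrixP => r s.
by rewrite !mxE tnth_ord_tuple.
Qed.

End Contraction.

(** * Mixed norms of functions dominated by products *)

Section ProductBound.
Variable R : realType.

(** The left side is an elementary symmetric function of the h k, hence at most the b-th power of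
    their sum. *)
Lemma esum_prod_le (h : nat -> R) (H : R) b : (forall k, 0 <= h k) -> 0 <= H ->
  (\esum_(k in [set: nat]) (h k)%:E <= H%:E)%E ->
  (\esum_(J in [set J : {fset nat} | #|` J| = b])
     (\prod_(k <- enum_fset J) h k)%:E <= (H ^+ b)%:E)%E.
Proof.
move=> h0 H0 hH; pose g (J : {fset nat}) := (\prod_(k <- enum_fset J) h k)%:E.
have pr0 (J : {fset nat}) : 0 <= \prod_(k <- enum_fset J) h k.
  by apply: prodr_ge0.
have g0 J : (0 <= g J)%E by rewrite lee_fin.
elim: b => [|b IH].
  have -> : [set J : {fset nat} | #|` J| = 0%N] = [set fset0].
    apply/seteqP; split=> J /= => [/eqP|->]; last by rewrite cardfs0.
    by rewrite cardfs_eq0 => /eqP.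
  rewrite esum_set1; last exact: g0.
  by rewrite big_seq_fset0 expr0.
(* Bounding one copy by b + 1 copies gives up a factorial, but brings the sum into the form of
   [esum_fsetU1]. *)
apply: (@le_trans _ _ (\sum_(i < b.+1)
    \esum_(J in [set J : {fset nat} | #|` J| = b.+1]) g J)%E).
  rewrite big_ord_recl leeDl// sume_ge0// => i _; exact: esum_ge0.
rewrite -esum_fsetU1//.
apply: (@le_trans _ _ (\esum_(J in [set J : {fset nat} | #|` J| = b]) (H%:E * g J))%E).
  apply: le_esum => J /= _; rewrite muleC.
  apply: (@le_trans _ _ (g J * \esum_(k in [set: nat]) (h k)%:E)%E); last first.
    by rewrite lee_wpmul2l.
  apply: le_trans (esumZ_le (a := fun k => (h k)%:E) _ (pr0 J) _); last first.
    by move=> k; rewrite lee_fin.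
  rewrite [X in (X <= _)%E]esum_mkcond.
  apply: le_esum => k _; case: ifPn => [/set_mem /= kJ|_]; last first.
    by rewrite -EFinM lee_fin mulr_ge0.
  by rewrite /g big_fsetU1//= -EFinM mulrC.
apply: le_trans (esumZ_le _ H0 g0) _.
by rewrite exprS EFinM lee_wpmul2l ?lee_fin.
Qed.

Variables (m : nat) (p : 'I_m -> R).
Hypothesis p1 : forall i, 1 <= p i.
Variables (g : 'I_m -> nat -> R) (G M : R) (a : 'I_m -> int).
Variable f : ('I_m -> {fset nat}) -> \bar R.
Hypotheses (g0 : forall i k, 0 <= g i k) (G0 : 0 <= G) (M0 : 0 <= M).
Hypothesis gG : forall i,
  (\esum_(k in [set: nat]) (g i k `^ p i)%:E <= (G `^ p i)%:E)%E.
Hypothesis f0 : forall I, (0 <= f I)%E.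
Hypothesis fg : forall I, (forall l, #|` I l|%:Z = a l) ->
  (f I <= (M * \prod_l \prod_(k <- enum_fset (I l)) g l k)%:E)%E.

Let p0 i : 0 < p i. Proof. exact: lt_le_trans (p1 i). Qed.

Lemma mixed_norm_prod_le s I : uniq s -> (forall l, l \notin s -> #|` I l|%:Z = a l) ->
  (mixed_norm p a s f I <= (M * \prod_l (if l \in s then G ^+ `|a l|%N
     else \prod_(k <- enum_fset (I l)) g l k))%:E)%E.
Proof.
have pr0 l (J : {fset nat}) : 0 <= \prod_(k <- enum_fset J) g l k.
  by apply: prodr_ge0.
elim: s I => [|i s IH] I /=; first by move=> _ hI; apply: fg => l; exact: hI.
move=> /andP[iNs us] hI.
pose upd J := fun l => if l == i then J else I l : {fset nat}.
set rest := \prod_(l | l != i) (if l \in i :: s then G ^+ `|a l|%N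
     else \prod_(k <- enum_fset (I l)) g l k).
have rest0 : 0 <= rest.
  by apply: prodr_ge0 => l _; case: ifP => _; rewrite ?exprn_ge0.
rewrite (bigD1 i)//= inE eqxx /= -/rest.
have hJ J : #|` J|%:Z = a i ->
    (mixed_norm p a s f (upd J) <=
     (M * rest * \prod_(k <- enum_fset J) g i k)%:E)%E.
  move=> cJ; have hu l : l \notin s -> #|` upd J l|%:Z = a l.
    rewrite /upd; case: eqVneq => [->//|li] ls.
    by apply: hI; rewrite inE (negbTE li).
  apply: le_trans (IH _ us hu) _; rewrite (bigD1 i)//= (negbTE iNs) {1}/upd eqxx.
  rewrite lee_fin -mulrA [rest * _]mulrC; apply: ler_eq; congr (_ * (_ * _)).
  by apply: eq_bigr => l li; rewrite inE /upd (negbTE li).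
have mx0 J : (0 <= mixed_norm p a s f (upd J))%E by exact: mixed_norm_ge0.
have pn0 : p i != 0 by rewrite gt_eqF.
set c := M * rest; have c0 : 0 <= c by rewrite mulr_ge0.
set E := (\esum_(J in _) _)%E.
have E0 : (0 <= E)%E by apply: esum_ge0 => J _; exact: poweR_ge0.
have key : (E <= ((c * G ^+ `|a i|%N) `^ p i)%:E)%E.
  apply: (@le_trans _ _ (\esum_(J in [set J : {fset nat} | #|` J|%:Z = a i])
      ((c `^ p i)%:E * (\prod_(k <- enum_fset J) (g i k `^ p i))%:E))%E).
    apply: le_esum => J /= cJ; rewrite -EFinM.
    have -> : \prod_(k <- enum_fset J) (g i k `^ p i) =
        (\prod_(k <- enum_fset J) g i k) `^ p i.
      have : (\prod_(k <- enum_fset J) (g i k `^ p i) =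
        (\prod_(k <- enum_fset J) g i k) `^ p i) /\
        0 <= \prod_(k <- enum_fset J) g i k.
        elim/big_rec2: _ => [|k x y _ [-> y0]]; first by rewrite powR1.
        by rewrite powRM// mulr_ge0.
      by case.
    rewrite -powRM// -poweR_EFin; apply: gt0_ler_poweR; rewrite ?(ltW (p0 i))//.
    - by rewrite in_itv /= leey andbT; exact: mx0.
    - by rewrite in_itv /= leey andbT lee_fin mulr_ge0.
    - exact: hJ.
  apply: le_trans (esumZ_le _ (powR_ge0 _ _) _) _.
    by move=> J; rewrite lee_fin; apply: prodr_ge0 => k _; exact: powR_ge0.
  rewrite powRM ?exprn_ge0// EFinM lee_wpmul2l ?lee_fin ?powR_ge0//.
  case: (a i) => b /=; last first.
    by rewrite (_ : [set J : {fset nat} | _] = set0) ?esum_set0 ?lee_fin ?powR_ge0//;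
      apply/seteqP; split.
  have -> : [set J : {fset nat} | #|` J|%:Z = b%:Z] = [set J | #|` J| = b].
    by apply/seteqP; split=> J /=; [case|move=> ->].
  have -> : (G ^+ b) `^ p i = (G `^ p i) ^+ b.
    by rewrite -(powR_mulrn _ G0) -powRrM mulrC powRrM powR_mulrn// powR_ge0.
  by apply: esum_prod_le => [k||]; [exact: powR_ge0|exact: powR_ge0|exact: gG].
have -> : M * (G ^+ `|a i| * rest) = ((c * G ^+ `|a i|%N) `^ p i) `^ (p i)^-1.
  by rewrite -powRrM mulfV// powRr1 ?mulr_ge0 ?exprn_ge0// /c -mulrA [rest * _]mulrC.
rewrite -poweR_EFin; apply: gt0_ler_poweR key.
- by rewrite invr_ge0 ltW.
- by rewrite in_itv /= leey andbT.
- by rewrite in_itv /= leey andbT lee_fin powR_ge0.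
Qed.

Lemma mixed_norm_prod_bound ord : perm_eq ord (enum 'I_m) ->
  (mixed_norm p a ord f (fun=> fset0) <= (M * G ^+ (\sum_l `|a l|%N))%:E)%E.
Proof.
move=> po; have inord l : l \in ord by rewrite (perm_mem po) mem_enum.
have uo : uniq ord by rewrite (perm_uniq po) enum_uniq.
apply: le_trans (mixed_norm_prod_le uo _) _ => [l|]; first by rewrite inord.
rewrite -prodrXr lee_fin; apply: ler_eq; congr (_ * _).
by apply: eq_bigr => l _; rewrite inord.
Qed.

End ProductBound.

(** * The sum norm and the gap *)

Section AbsoluteNorm.
Variables (R : realType) (m : nat) (p : 'I_m -> R) (N : 'rV[R]_m -> R).
Hypothesis p1 : forall i, 1 <= p i.
Hypothesis N_abs : absolute_norm N.

Let NZ a x : N (a *: x) = `|a| * N x. Proof. by case: N_abs. Qed.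
Let ND x y : N (x + y) <= N x + N y. Proof. by case: N_abs. Qed.

Lemma abs_norm_ge0 x : 0 <= N x.
Proof.
have : N (x - x) <= N x + N (- x) by exact: ND.
rewrite subrr -scaleN1r NZ normrN1 mul1r -(scale0r (0 : 'rV[R]_m)) NZ normr0 mul0r.
by rewrite -mulr2n pmulrn_lge0.
Qed.

Let e i : 'rV[R]_m := delta_mx 0 i.

Let e_gt0 i : 0 < N (e i).
Proof.
rewrite lt_neqAle abs_norm_ge0 andbT eq_sym; apply/eqP.
case: N_abs => h _ _ _ /h /rowP/(_ i); rewrite !mxE !eqxx => /eqP.
by rewrite oner_eq0.
Qed.

(* x plus its image under the sign changes fixing the i-th coordinate is
   2 x_i e_i. *)
Lemma abs_norm_coord (x : 'rV[R]_m) i : `|x 0 i| * N (e i) <= N x.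
Proof.
pose y : 'rV[R]_m := \row_j (if j == i then x 0 j else - x 0 j).
have Ny : N y = N x.
  case: N_abs => _ _ _ Na; rewrite -Na -[RHS]Na; congr N.
  by apply/rowP => j; rewrite !mxE; case: ifP => _; rewrite ?normrN.
have : N (x + y) <= N x + N y by exact: ND.
have -> : x + y = (2 * x 0 i) *: e i.
  apply/rowP => j; rewrite !mxE eqxx /=; case: eqVneq => [->|_].
    by rewrite mulr1 mulr_natl mulr2n.
  by rewrite subrr mulr0.
rewrite NZ Ny normrM ger0_norm// -mulrA => h.
by rewrite -(ler_pM2l (ltr0n R 2)) (le_trans h)// mulr_natl mulr2n.
Qed.

Lemma abs_norm_le_sum (x : 'rV[R]_m) : N x <= \sum_i `|x 0 i| * N (e i).
Proof.
rewrite [X in N X]row_sum_delta; elim/big_rec2: _ => [|i a b _ h].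
  by rewrite -(scale0r (0 : 'rV[R]_m)) NZ normr0 mul0r.
by apply: le_trans (ND _ _) _; rewrite NZ lerD2l.
Qed.

(** Replaces the arbitrary absolute norm in the estimates: it is additive over the components, and
    equivalent to [Xnorm] by [norm_equiv]. *)
Definition snorm (x : mseq R m) : R := \sum_i nlp (p i) (x i).

Lemma snorm_ge0 x : 0 <= snorm x.
Proof. by apply: sumr_ge0 => i _; exact: nlp_ge0. Qed.

Lemma nlp_le_snorm x i : nlp (p i) (x i) <= snorm x.
Proof.
by rewrite /snorm (bigD1 i)//= lerDl sumr_ge0// => j _; exact: nlp_ge0.
Qed.

Lemma norm_equiv : exists2 kap : R, 1 <= kap &
  forall x, snorm x <= kap * Xnorm p N x /\ Xnorm p N x <= kap * snorm x.
Proof.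
pose kap := 1 + \sum_i (N (e i) + (N (e i))^-1).
have s0 (P : pred 'I_m) : 0 <= \sum_(i | P i) (N (e i) + (N (e i))^-1).
  by apply: sumr_ge0 => i _; rewrite addr_ge0 ?invr_ge0 ?abs_norm_ge0.
exists kap => [|x]; first by rewrite lerDl.
split.
  apply: (@le_trans _ _ (\sum_i (N (e i))^-1 * Xnorm p N x)).
    apply: ler_sum => i _; rewrite mulrC ler_pdivlMr ?e_gt0//.
    apply: le_trans (abs_norm_coord _ i); rewrite mxE ger0_norm//.
    exact: nlp_ge0.
  rewrite -mulr_suml ler_wpM2r ?abs_norm_ge0// /kap big_split /=.
  by rewrite addrA lerDr addr_ge0// sumr_ge0// => i _; exact: abs_norm_ge0.
apply: le_trans (abs_norm_le_sum _) _; rewrite /snorm mulr_sumr.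
apply: ler_sum => i _; rewrite mxE ger0_norm ?nlp_ge0// mulrC.
rewrite ler_wpM2r ?nlp_ge0// /kap (bigD1 i)//= addrCA -addrA lerDl.
by rewrite !addr_ge0 ?invr_ge0 ?abs_norm_ge0.
Qed.

Lemma XnormZ a x : Xnorm p N (a *: x) = nc a * Xnorm p N x.
Proof.
rewrite /Xnorm -[nc a]ger0_norm ?nc_ge0// -NZ; congr N.
by apply/rowP => i; rewrite !mxE nlpZ.
Qed.

Lemma Xnorm_ge0 x : 0 <= Xnorm p N x. Proof. exact: abs_norm_ge0. Qed.

Section Gap.
Variables S T : set (mseq R m).
Hypotheses (sS : subspace S) (sT : subspace T) (SX : S `<=` Xspace p).

Lemma dist_pt_ge0 u (U : set (mseq R m)) : 0 <= dist_pt p N u U.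
Proof.
rewrite /dist_pt; have [->|/set0P U0] := eqVneq U set0.
  by rewrite image_set0 inf0.
apply: lb_le_inf; first by case: U0 => v Uv; exists (Xnorm p N (u - v)); exists v.
by move=> _ [v _ <-]; exact: Xnorm_ge0.
Qed.

Lemma dist_pt_le u (U : set (mseq R m)) v : U v ->
  dist_pt p N u U <= Xnorm p N (u - v).
Proof.
move=> Uv; apply: ge_inf; last by exists v.
by exists 0 => _ [w _ <-]; exact: Xnorm_ge0.
Qed.

Lemma half_gap_ge0 (U1 U2 : set (mseq R m)) : 0 <= half_gap p N U1 U2.
Proof.
rewrite /half_gap; set A := (X in sup X).
(* [sup] has the default value 0 on sets that are empty or unbounded above. *)
case: (pselect (has_sup A)) => [hs|/sup_out ->//].
have [[x [u Uu ux]] _] := hs.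
by apply: le_trans (dist_pt_ge0 u U2) _; apply: sup_upper_bound => //; exists u.
Qed.

Lemma half_gap_le (U1 U2 : set (mseq R m)) eta : 0 <= eta ->
  (forall u, U1 u -> Xnorm p N u = 1 ->
    exists2 v, U2 v & Xnorm p N (u - v) <= eta) -> half_gap p N U1 U2 <= eta.
Proof.
move=> e0 h; rewrite /half_gap; set A := (X in sup X).
case: (pselect (has_sup A)) => [[A0 _]|/sup_out ->//].
apply: ge_sup => // _ [u [U1u u1] <-]; have [v Tv] := h u U1u u1.
by apply: le_trans; exact: dist_pt_le.
Qed.

Lemma half_gap_lt eta u : half_gap p N S T < eta -> S u ->
  exists2 v, T v & Xnorm p N (u - v) <= eta * Xnorm p N u.
Proof.
move=> h Su; have [u0|un0] := eqVneq (Xnorm p N u) 0.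
  exists 0; first by case: sT.
  by rewrite subr0 u0 mulr0.
have up : 0 < Xnorm p N u by rewrite lt_neqAle eq_sym un0 Xnorm_ge0.
pose a : R[i] := ((Xnorm p N u)^-1)%:C%C.
have na : nc a = (Xnorm p N u)^-1 by rewrite nc_real ger0_norm// invr_ge0 Xnorm_ge0.
have Sau : S (a *: u) by exact: subspaceZ.
have au1 : Xnorm p N (a *: u) = 1 by rewrite XnormZ na mulVf.
have : dist_pt p N (a *: u) T < eta.
  apply: le_lt_trans h; apply: sup_upper_bound; last by exists (a *: u).
  split; first by exists (dist_pt p N (a *: u) T); exists (a *: u).
  exists 1 => _ [w [Sw w1] <-].
  apply: le_trans (dist_pt_le w (v := 0) _) _; first by case: sT.
  by rewrite subr0 w1.
move=> /inf_lt [|_ [v Tv <-] hv].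
  exists (Xnorm p N (a *: u - 0)); exists 0 => //; by case: sT.
exists (a^-1 *: v); first exact: subspaceZ.
have an0 : a != 0 by rewrite -nc_eq0 na invr_eq0.
have -> : u - a^-1 *: v = a^-1 *: (a *: u - v).
  by rewrite scalerBr scalerA mulVf// scale1r.
by rewrite XnormZ Normc.normcV na invrK mulrC ler_wpM2r ?Xnorm_ge0// ltW.
Qed.

End Gap.

Lemma gap_ge0 S T : 0 <= gap p N S T.
Proof. by rewrite /gap le_max half_gap_ge0. Qed.

Lemma gap_lt S T eta : subspace S -> subspace T ->
  gap p N S T < eta ->
  (forall u, S u -> exists2 v, T v & Xnorm p N (u - v) <= eta * Xnorm p N u) /\
  (forall u, T u -> exists2 v, S v & Xnorm p N (u - v) <= eta * Xnorm p N u).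
Proof.
by move=> sS sT; rewrite /gap gt_max => /andP[h1 h2]; split=> u; apply: half_gap_lt.
Qed.

Lemma gap_le S T eta : 0 <= eta ->
  (forall u, S u -> Xnorm p N u = 1 ->
    exists2 v, T v & Xnorm p N (u - v) <= eta) ->
  (forall u, T u -> Xnorm p N u = 1 ->
    exists2 v, S v & Xnorm p N (u - v) <= eta) ->
  gap p N S T <= eta.
Proof. by move=> e0 h1 h2; rewrite /gap ge_max !half_gap_le. Qed.

Lemma dist_ge0 V Sg : 0 <= dist p N V Sg.
Proof.
rewrite /dist; have [->|/set0P U0] := eqVneq Sg set0.
  by rewrite image_set0 inf0.
apply: lb_le_inf; first by case: U0 => v Uv; exists (gap p N V v); exists v.
by move=> _ [v _ <-]; exact: gap_ge0.
Qed.

Lemma dist_le V Sg W : Sg W -> dist p N V Sg <= gap p N V W.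
Proof.
move=> SW; apply: ge_inf; last by exists W.
by exists 0 => _ [w _ <-]; exact: gap_ge0.
Qed.

Lemma dist_lt V Sg eta : Sg !=set0 -> dist p N V Sg < eta ->
  exists2 W, Sg W & gap p N V W < eta.
Proof.
move=> [W0 SW0] /inf_lt [|_ [W SW <-] h]; last by exists W.
by exists (gap p N V W0); exists W0.
Qed.

End AbsoluteNorm.

(** * Frames of a chart *)

Section Frames.
Variables (R : realType) (m n : nat) (p : 'I_m -> R) (nn : 'I_m -> nat).
Hypothesis p1 : forall i, 1 <= p i.
Hypothesis nn_sum : (\sum_i nn i = n)%N.

Lemma W_subspace (ch : chart p nn n) i : subspace (W ch i).
Proof. exact: has_dim_subspace (W_dim ch i). Qed.

(* The coefficient functionals of a nearly normalized basis of W_i, extended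
   to all of l^{p_i} by 0 on W_i^c. *)
Lemma component_basis (ch : chart p nn n) i :
  exists (w : 'I_(nn i) -> cseq R) (th : 'I_(nn i) -> cseq R -> R[i]^o),
  [/\ forall t, W ch i (w t) /\ nlp (p i) (w t) <= 1,
      forall x, W ch i x -> x = \sum_t th t x *: w t,
      forall s t, th t (w s) = (s == t)%:R,
      forall t, linear_on (lp (p i)) (th t) /\ (forall u, Wc ch i u -> th t u = 0)
    & (forall t x, W ch i x -> nc (th t x) <= 2 * nlp (p i) x) /\
      exists B, forall t x, lp (p i) x -> nc (th t x) <= B * nlp (p i) x].
Proof.
have [b hb] := W_dim ch i.
have lb t : lp (p i) (b t).
  apply: (@W_sub _ _ _ _ _ ch); rewrite hb.2; exists (fun s => (s == t)%:R).
  rewrite (bigD1 t)//= eqxx scale1r big1 ?addr0// => s st.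
  by rewrite (negbTE st) scale0r.
have Wsum v : basis_of (W ch i) v -> forall c : 'I_(nn i) -> R[i],
    W ch i (\sum_t c t *: v t).
  by move=> hv c; rewrite hv.2; exists c.
have [|B B0 hB] := coef_bound (p1 i) (Wc_subspace ch i) (@Wc_sub _ _ _ _ _ ch i)
    (@Wc_closed _ _ _ _ _ ch i) lb.
  by move=> c hc; apply: hb.1; apply: (@W_Wc_cap _ _ _ _ _ ch i) => //; exact: Wsum.
have [|w [hw w1 hc]] := near_auerbach (p1 i) hb lb B0.
  by move=> c t; have := hB c 0 (Wc_subspace ch i).1 t; rewrite addr0.
have lw t : lp (p i) (w t).
  apply: (@W_sub _ _ _ _ _ ch); rewrite hw.2; exists (fun s => (s == t)%:R).
  rewrite (bigD1 t)//= eqxx scale1r big1 ?addr0// => s st.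
  by rewrite (negbTE st) scale0r.
(* Applied a second time, now to [w]: the factor 2 of [near_auerbach] holds on W_i only, whereas B'
   bounds the functionals on the whole of l^{p_i}. *)
have [|B' B'0 hB'] := coef_bound (p1 i) (Wc_subspace ch i) (@Wc_sub _ _ _ _ _ ch i)
    (@Wc_closed _ _ _ _ _ ch i) lw.
  by move=> c hc'; apply: hw.1; apply: (@W_Wc_cap _ _ _ _ _ ch i) => //; exact: Wsum.
have /choice[th hth] : forall x, exists c : 'I_(nn i) -> R[i], lp (p i) x ->
    exists2 u, Wc ch i u & x = \sum_t c t *: w t + u.
  move=> x; case: (pselect (lp (p i) x)) => [lx|nlx]; last by exists (fun=> 0).
  have [y [u [Wy Wu ->]]] := @W_Wc_sum _ _ _ _ _ ch i x lx.
  move: Wy; rewrite hw.2 => -[c ->]; exists c => _; by exists u.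
have delta_w s : \sum_t (s == t)%:R *: w t = w s.
  rewrite (bigD1 s)//= eqxx scale1r big1 ?addr0// => t ts.
  by rewrite eq_sym (negbTE ts) scale0r.
have thU x c u : lp (p i) x -> Wc ch i u -> x = \sum_t c t *: w t + u ->
    forall t, th x t = c t.
  move=> lx Wu xE t; have [u' Wu' xE'] := hth x lx.
  apply/eqP; rewrite -subr_eq0; apply/eqP.
  have e : \sum_t (th x t - c t) *: w t = u - u'.
    under eq_bigr do rewrite scalerBl.
    rewrite sumrB.
    have -> : \sum_t th x t *: w t = x - u'.
      by apply/eqP; rewrite eq_sym subr_eq -xE'.
    have -> : \sum_t c t *: w t = x - u.
      by apply/eqP; rewrite eq_sym subr_eq -xE.
    by rewrite opprB addrC addrA subrK.
  apply: (hw.1 (fun t => th x t - c t)); apply: (@W_Wc_cap _ _ _ _ _ ch i).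
    exact: Wsum.
  by rewrite e; apply: subspaceB => //; exact: Wc_subspace.
have Wc0 : Wc ch i 0 by case: (Wc_subspace ch i).
have Ww t : W ch i (w t) by rewrite -(delta_w t); exact: Wsum.
exists w, (fun t x => th x t); split => //.
- move=> x Wx; have lx := @W_sub _ _ _ _ _ ch i x Wx.
  move: (Wx); rewrite {1}hw.2 => -[c xE].
  rewrite {1}xE; apply: eq_bigr => t _; congr (_ *: _).
  by rewrite (thU x c 0) ?addr0.
- move=> s t; apply: (thU (w s) (fun t => (s == t)%:R) 0) => //.
  by rewrite addr0 delta_w.
- move=> t; split=> [a x y lx ly|u Wu]; last first.
    apply: (thU u (fun=> 0) u) => //; first exact: (@Wc_sub _ _ _ _ _ ch i).
    by rewrite big1 ?add0r// => s _; rewrite scale0r.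
  have [u Wu xE] := hth x lx; have [u' Wu' yE] := hth y ly.
  apply: (thU _ (fun t => a * th x t + th y t) (a *: u + u')).
  + by apply: lpD => //; exact: lpZ.
  + by case: (Wc_subspace ch i) => _; apply.
  + rewrite {1}xE {1}yE scalerDr addrACA; congr (_ + _).
    rewrite scaler_sumr -big_split; apply: eq_bigr => s _ /=.
    by rewrite scalerA scalerDl.
- split=> [t x Wx|].
    have lx := @W_sub _ _ _ _ _ ch i x Wx.
    move: (Wx); rewrite {1}hw.2 => -[c xE].
    by rewrite (thU x c 0) ?addr0// xE.
  exists B' => t x lx; have [u Wu xE] := hth x lx.
  by rewrite {2}xE; exact: hB'.
Qed.

(** The bound 2 in [frame_le] is the same for all charts. The bound in [frame_bounded] depends on
    the chart; it yields the finite size in [chart_bound_exists]. *)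
Record frame (ch : chart p nn n) (sg : 'I_n -> 'I_m) (w : 'I_n -> cseq R)
    (th : 'I_n -> cseq R -> R[i]^o) : Prop := Frame {
  frame_fiber : forall i, size [seq t <- enum 'I_n | sg t == i] = nn i;
  frame_W : forall s, W ch (sg s) (w s);
  frame_le1 : forall s, nlp (p (sg s)) (w s) <= 1;
  frame_expand : forall i x, W ch i x -> x = \sum_(s | sg s == i) th s x *: w s;
  frame_dual : forall s t, sg s = sg t -> th t (w s) = (s == t)%:R;
  frame_lin : forall s, linear_on (lp (p (sg s))) (th s);
  frame_Wc : forall s u, Wc ch (sg s) u -> th s u = 0;
  frame_le : forall s x, W ch (sg s) x -> nc (th s x) <= 2 * nlp (p (sg s)) x;
  frame_bounded : exists B, forall s x, lp (p (sg s)) x ->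
    nc (th s x) <= B * nlp (p (sg s)) x }.

Lemma frame_exists (ch : chart p nn n) : exists sg w th, frame ch sg w th.
Proof.
have [wi hwi] := fin_all_exists (component_basis ch).
have {hwi} [thi hi] := fin_all_exists hwi.
have [f bf] := exists_fibers nn_sum.
pose ff s := tagged (f s).
exists (fun s => tag (f s)), (fun s => wi (tag (f s)) (ff s)),
  (fun s => thi (tag (f s)) (ff s)).
have sumf (V : zmodType) i (F : forall i, 'I_(nn i) -> V) :
    \sum_(s | tag (f s) == i) F _ (ff s) = \sum_t F i t.
  have := @sig_big_dep _ 0 +%R _ _ (pred1 i) (fun i (_ : 'I_(nn i)) => true) F.
  rewrite big_pred1_eq => ->; rewrite (reindex f) /=; last exact: onW_bij.
  by apply: eq_bigl => s; rewrite andbT.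
apply: Frame.
- move=> i; rewrite -(fiber_tag i bf) cardsE cardE {2}/enum_mem -enumT.
  by congr size; apply: eq_filter => s.
- by move=> s; have [h _ _ _ _] := hi (tag (f s)); case: (h (ff s)).
- by move=> s; have [h _ _ _ _] := hi (tag (f s)); case: (h (ff s)).
- move=> i x Wx; have [_ h _ _ _] := hi i.
  by rewrite (sumf _ i (fun i t => thi i t x *: wi i t)); exact: h.
- move=> s t /= e; have fi := bij_inj bf.
  have -> : (s == t) = (f s == f t) by rewrite (inj_eq fi).
  rewrite /ff; case: (f s) (f t) e => i a [j b] /= e; rewrite {}e in a *.
  have [_ _ h _ _] := hi j; rewrite h; congr (nat_of_bool _)%:R.
  by rewrite eq_Tagged.
- by move=> s; have [_ _ _ h _] := hi (tag (f s)); case: (h (ff s)).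
- by move=> s; have [_ _ _ h _] := hi (tag (f s)); case: (h (ff s)).
- by move=> s; have [_ _ _ _ [h _]] := hi (tag (f s)); exact: h.
- have hB i : exists B, forall t x, lp (p i) x -> nc (thi i t x) <= B * nlp (p i) x.
    by have [_ _ _ _ [_ h]] := hi i.
  have [B {}hB] := fin_all_exists hB.
  exists (\sum_i `|B i|) => s x lx; apply: le_trans (hB _ (ff s) x lx) _.
  rewrite ler_wpM2r ?nlp_ge0// (le_trans (ler_norm _))//.
  by rewrite (bigD1 (tag (f s)))//= lerDl sumr_ge0.
Qed.

End Frames.

Lemma linear_on0 (C : fieldType) (E F : lmodType C) (S : set E) (f : E -> F) :
  subspace S -> linear_on S f -> f 0 = 0.
Proof.
move=> sS lf; have := lf (-1) 0 0 sS.1 sS.1.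
by rewrite scaleN1r oppr0 add0r scaleN1r addNr.
Qed.

Section ChartOperators.
Variables (R : realType) (m n : nat) (p : 'I_m -> R) (nn : 'I_m -> nat).
Variable ch : chart p nn n.
Implicit Types Phi : blockop R m.

Lemma V0_subspace : subspace (V0 ch).
Proof.
split=> [i|a x y hx hy i]; first by case: (W_subspace ch i).
by case: (W_subspace ch i) => _; apply.
Qed.

Lemma V0_bas r : V0 ch (bas ch r).
Proof.
rewrite /V0 (bas_basis ch).2; exists (fun s => (s == r)%:R).
rewrite (bigD1 r)//= eqxx scale1r big1 ?addr0// => s sr.
by rewrite (negbTE sr) scale0r.
Qed.

Lemma V0_embed i y : W ch i y -> V0 ch (embed i y).
Proof.
move=> Wy j; rewrite /embed; case: eqVneq => [->//|_].
by case: (W_subspace ch j).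
Qed.

Lemma twist_opE Phi (t : R[i]) : diag_part Phi + t *: off_part Phi =
  fun i j => if i == j then Phi i j else t *: Phi i j.
Proof.
apply: funext => i; apply: funext => j; apply: funext => x; apply: funext => k.
rewrite [LHS]/(diag_part Phi i j x k + t * off_part Phi i j x k).
rewrite /diag_part /off_part; case: eqVneq => _; last exact: add0r.
by rewrite -[RHS]addr0; congr (_ + _); exact: mulr0.
Qed.

Lemma chart_op_twist Phi t : chart_op ch Phi ->
  chart_op ch (diag_part Phi + t *: off_part Phi).
Proof.
move=> h i j; rewrite twist_opE; have [lP wP] := h i j; case: ifP => _ //.
split=> [a x y Wx Wy|x Wx].
  transitivity (t *: (a *: Phi i j x + Phi i j y)).
    by congr (_ *: _); exact: lP.
  by rewrite scalerDr scalerA mulrC -scalerA.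
by apply: subspaceZ; [exact: Wc_subspace|exact: wP].
Qed.

Lemma chart_op_sub Phi (P : 'I_m -> 'I_m -> bool) : chart_op ch Phi ->
  chart_op ch (fun i j => if P i j then Phi i j else 0).
Proof.
move=> h i j; case: (P i j); first exact: h.
split=> [a x y _ _|x _]; first by rewrite scaler0 addr0.
by case: (Wc_subspace ch i).
Qed.

Lemma chart_op_diag Phi : chart_op ch Phi -> chart_op ch (diag_part Phi).
Proof. exact: (chart_op_sub (fun i j => i == j)). Qed.

Lemma chart_op_off Phi : chart_op ch Phi -> chart_op ch (off_part Phi).
Proof.
move=> h; have -> : off_part Phi = fun i j => if i != j then Phi i j else 0.
  by apply: funext => i; apply: funext => j; rewrite /off_part; case: eqP.
exact: (chart_op_sub (fun i j => i != j)).
Qed.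

Lemma app_embed Phi j y : chart_op ch Phi -> W ch j y ->
  app Phi (embed j y) = fun i => Phi i j y.
Proof.
move=> h Wy; apply: funext => i; rewrite /app (bigD1 j)//= /embed eqxx.
rewrite big1 ?addr0// => l /negbTE ->.
exact: linear_on0 (W_subspace ch l) (h i l).1.
Qed.

Lemma app_linear Phi : chart_op ch Phi -> linear_on (V0 ch) (app Phi).
Proof.
move=> h a y z Vy Vz; apply: funext => i; rewrite /app.
transitivity (\sum_j (a *: Phi i j (y j) + Phi i j (z j))).
  by apply: eq_bigr => j _; exact: (h i j).1.
by rewrite big_split -scaler_sumr.
Qed.

Lemma app_sum Phi (I : Type) (r : seq I) (P : pred I) (c : I -> R[i])
    (x : I -> mseq R m) : chart_op ch Phi -> (forall i, P i -> V0 ch (x i)) ->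
  app Phi (\sum_(i <- r | P i) c i *: x i) =
  \sum_(i <- r | P i) c i *: app Phi (x i).
Proof. by move=> h; exact: (linear_on_sum r c V0_subspace (app_linear h)). Qed.

End ChartOperators.

(** * Blocks as polynomials in the chart *)

Section FrameAlgebra.
Variables (R : realType) (m n : nat) (p : 'I_m -> R) (nn : 'I_m -> nat).
Hypothesis p1 : forall i, 1 <= p i.
Hypothesis nn_sum : (\sum_i nn i = n)%N.
Variables (ch : chart p nn n) (sg : 'I_n -> 'I_m) (w : 'I_n -> cseq R).
Variable th : 'I_n -> cseq R -> R[i]^o.
Hypothesis fr : frame ch sg w th.
Implicit Types Phi Psi : blockop R m.

Definition frame_vec s : mseq R m := embed (sg s) (w s).

Definition frame_graph Phi s : mseq R m := frame_vec s + app Phi (frame_vec s).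

Definition bas_coef : 'M[R[i]]_n := \matrix_(r, s) th s (bas ch r (sg s)).

Lemma V0_frame s : V0 ch (frame_vec s).
Proof. by apply: V0_embed; exact: frame_W fr s. Qed.

Lemma V0_expand x : V0 ch x -> x = \sum_s (th s (x (sg s)) : R[i]) *: frame_vec s.
Proof.
move=> Vx; apply: funext => i; rewrite fct_sumE.
rewrite {1}(frame_expand fr (Vx i)) big_mkcond; apply: eq_bigr => s _.
rewrite [RHS]/(_ *: frame_vec s i) /frame_vec /embed eq_sym.
by case: eqVneq => [->|_] //; apply/esym; exact: scaler0.
Qed.

Lemma bas_expand r : bas ch r = \sum_s bas_coef r s *: frame_vec s.
Proof.
by rewrite {1}(V0_expand (V0_bas ch r)); apply: eq_bigr => s _; rewrite mxE.
Qed.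

Lemma bas_coef_unit : bas_coef \in unitmx.
Proof.
have /choice[d hd] : forall s, exists c : 'I_n -> R[i], frame_vec s = \sum_r c r *: bas ch r.
  by move=> s; have := V0_frame s; rewrite /V0 (bas_basis ch).2.
have : \matrix_(s, r) d s r *m bas_coef = 1%:M.
  apply/matrixP => s t; rewrite !mxE.
  have -> : \sum_j (\matrix_(s, r) d s r) s j * bas_coef j t =
      th t (\sum_r d s r *: bas ch r (sg t)).
    rewrite (linear_on_sum _ _ (lp_subspace (p1 (sg t))) (frame_lin (s := t) fr)).
      by apply: eq_bigr => r _; rewrite !mxE.
    by move=> r _; apply: (@W_sub _ _ _ _ _ ch); exact: V0_bas.
  have -> : \sum_r d s r *: bas ch r (sg t) = frame_vec s (sg t).
    by rewrite hd [in RHS]fct_sumE.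
  rewrite /frame_vec /embed; case: eqVneq => [e|ne].
    by rewrite (frame_dual fr).
  rewrite (linear_on0 (lp_subspace (p1 (sg t))) (frame_lin (s := t) fr)).
  by have [st|//] := eqVneq s t; rewrite st eqxx in ne.
by move=> /mulmx1_unit[].
Qed.

Lemma graph_basis_expand Phi r : chart_op ch Phi ->
  graph_basis ch Phi r = \sum_s bas_coef r s *: frame_graph Phi s.
Proof.
move=> h; rewrite /graph_basis {1 2}bas_expand (app_sum _ _ h).
  by rewrite -big_split; apply: eq_bigr => s _; rewrite /frame_graph scalerDr.
by move=> s _; exact: V0_frame.
Qed.

Lemma frame_graphE Phi s i k : chart_op ch Phi ->
  frame_graph Phi s i k = (if sg s == i then w s k else 0) + Phi i (sg s) (w s) k.
Proof.
move=> h; rewrite /frame_graph [LHS]/(frame_vec s i k + app Phi (frame_vec s) i k).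
rewrite (app_embed h (frame_W fr s)); congr (_ + _).
by rewrite /frame_vec /embed eq_sym; case: eqP.
Qed.

(** The factor depends neither on Phi nor on I, so blocks may be computed in the frame, and the
    factor cancels in ratios of block norms. *)
Lemma plucker_graph Phi I : chart_op ch Phi ->
  plucker (graph_basis ch Phi) I = \det bas_coef * plucker (frame_graph Phi) I.
Proof.
move=> h; rewrite /plucker /coord.
apply: (coldet_rows (F := fun a r => graph_basis ch Phi r a.1 a.2)
  (G := fun a r => frame_graph Phi r a.1 a.2)) => a r.
by rewrite (graph_basis_expand _ h) fct_sumE fct_sumE.
Qed.

Lemma plucker_tuple (v : 'I_n -> mseq R m) I (pt : n.-tuple ('I_m * nat)) :
  points I = pt ->
  plucker v I = \det (\matrix_(r, s) (v r (tnth pt s).1 (tnth pt s).2 : R[i])).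
Proof.
move=> e; rewrite /plucker /coord e.
exact: (coldet_tuple (fun a r => v r a.1 a.2 : R[i])).
Qed.

Definition frame_entry Phi r (a : 'I_m * nat) : R[i] :=
  (if sg r == a.1 then w r a.2 else 0) + Phi a.1 (sg r) (w r) a.2.

Lemma twisted_graph Phi I (pt : n.-tuple ('I_m * nat)) (t : R[i]) :
  chart_op ch Phi -> points I = pt ->
  plucker (frame_graph (diag_part Phi + t *: off_part Phi)) I =
  \det (twist sg (fun s => (tnth pt s).1)
          (\matrix_(r, s) frame_entry Phi r (tnth pt s)) t).
Proof.
move=> h e; rewrite (plucker_tuple _ e); congr (\det _).
apply/matrixP => r s; rewrite !mxE /frame_entry; set a := tnth pt s.
rewrite (frame_graphE _ _ _ (chart_op_twist t h)) twist_opE [a.1 == _]eq_sym.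
by case: eqVneq => _ //; rewrite !add0r.
Qed.

Lemma plucker_twist Phi I (pt : n.-tuple ('I_m * nat)) (t : R[i]) :
  chart_op ch Phi -> points I = pt ->
  plucker (graph_basis ch (diag_part Phi + t *: off_part Phi)) I =
  \det bas_coef * \det (twist sg (fun s => (tnth pt s).1)
          (\matrix_(r, s) frame_entry Phi r (tnth pt s)) t).
Proof.
move=> h e; rewrite plucker_graph; last exact: chart_op_twist.
by rewrite (twisted_graph _ h e).
Qed.

Lemma plucker_order delta I Phi :
  \sum_i delta i = 0 -> has_type (shift nn delta) I -> chart_op ch Phi ->
  exists q : {poly R[i]}, forall t : R[i],
    plucker (graph_basis ch (diag_part Phi + t *: off_part Phi)) I
    = t ^+ half_l1 delta * q.[t].
Proof.
move=> d0 hI h; have [pt e dE] := index_tuple nn_sum (frame_fiber fr) d0 hI.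
exists (\det bas_coef *: twist_poly sg (fun s => (tnth pt s).1) delta
  (\matrix_(r, s) frame_entry Phi r (tnth pt s))) => t.
by rewrite (plucker_twist t h e) (det_twist _ dE) hornerZ mulrCA.
Qed.

End FrameAlgebra.

Import (canonicals) mpoly.

(** * Total degree of determinants with affine entries *)

Section PolynomialDegree.
Variables (C : comNzRingType) (d : nat).
Implicit Types q : mpoly.mpoly d C.

Definition mdeg_le k q := forall mon : mpoly.multinom d,
  mpoly.mcoeff mon q != 0 -> (mpoly.mdeg mon <= k)%N.

Lemma mdeg_leD k q1 q2 : mdeg_le k q1 -> mdeg_le k q2 -> mdeg_le k (q1 + q2).
Proof.
move=> h1 h2 mon; rewrite mpoly.mcoeffD.
have [->|n1] := eqVneq (mpoly.mcoeff mon q1) 0; last by move=> _; exact: h1.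
by rewrite add0r; exact: h2.
Qed.

Lemma mdeg_le0 k : mdeg_le k 0.
Proof. by move=> mon; rewrite mpoly.mcoeff0 eqxx. Qed.

Lemma mdeg_leN k q : mdeg_le k q -> mdeg_le k (- q).
Proof. by move=> h mon; rewrite mpoly.mcoeffN oppr_eq0; exact: h. Qed.

Lemma mdeg_leM k l q1 q2 : mdeg_le k q1 -> mdeg_le l q2 -> mdeg_le (k + l) (q1 * q2).
Proof.
move=> h1 h2 mon; rewrite -mpoly.mcoeff_msupp => /mpoly.msuppM_le /allpairsP.
move=> [[m1 m2] /= [s1 s2 ->]]; rewrite mpoly.mdegD leq_add//.
  by apply: h1; rewrite -mpoly.mcoeff_msupp.
by apply: h2; rewrite -mpoly.mcoeff_msupp.
Qed.

Lemma mdeg_leC c : mdeg_le 0 (mpoly.mpolyC d c).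
Proof.
move=> mon; rewrite mpoly.mcoeffC; case: (mon =P _) => [->|_].
  by rewrite mpoly.mdeg0.
by rewrite mulr0 eqxx.
Qed.

Lemma mdeg_leX i : mdeg_le 1 (mpoly.mpolyX C (mpoly.mnm1 i) : mpoly.mpoly d C).
Proof.
move=> mon; rewrite mpoly.mcoeffX; case: (_ =P mon) => [<-|_]; last by rewrite eqxx.
by rewrite mpoly.mdeg1.
Qed.

Lemma mdeg_le_trans k l q : (k <= l)%N -> mdeg_le k q -> mdeg_le l q.
Proof. by move=> kl h mon hm; exact: leq_trans (h mon hm) kl. Qed.

Lemma mdeg_le_sum k (I : Type) (r : seq I) (P : pred I) (F : I -> mpoly.mpoly d C) :
  (forall i, mdeg_le k (F i)) -> mdeg_le k (\sum_(i <- r | P i) F i).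
Proof.
by move=> h; elim/big_ind: _ => //; [exact: mdeg_le0|exact: mdeg_leD].
Qed.

Lemma mdeg_le_det n (A : 'M[mpoly.mpoly d C]_n) :
  (forall i j, mdeg_le 1 (A i j)) -> mdeg_le n (\det A).
Proof.
move=> hA; apply: mdeg_le_sum => s.
have hp : mdeg_le n (\prod_(i < n) A i (s i)).
  suff h (r : seq 'I_n) : mdeg_le (size r) (\prod_(i <- r) A i (s i)).
    by have := h (enum 'I_n); rewrite size_enum_ord big_enum.
  elim: r => [|i r IH]; rewrite ?big_nil ?big_cons.
    rewrite -mpoly.mpolyC1; exact: mdeg_leC.
  exact: (mdeg_leM (hA _ _) IH).
rewrite mulr_sign; case: ifP => _ //; exact: mdeg_leN.
Qed.

End PolynomialDegree.

Lemma plucker_polynomial (R : realType) m n (p : 'I_m -> R) (nn : 'I_m -> nat)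
    (ch : chart p nn n) (I : 'I_m -> {fset nat}) (d : nat) (Phi : 'I_d -> blockop R m) :
  exists q : mpoly.mpoly d R[i],
    (forall mon : mpoly.multinom d,
      mpoly.mcoeff mon q != 0 -> (mpoly.mdeg mon <= n)%N) /\
    forall t : 'I_d -> R[i],
      plucker (graph_basis ch (\sum_k t k *: Phi k)) I = mpoly.meval t q.
Proof.
pose A : 'M[mpoly.mpoly d R[i]]_n := \matrix_(r, s)
  (mpoly.mpolyC d (coord (bas ch r) I s) + \sum_k
     mpoly.mpolyC d (coord (app (Phi k) (bas ch r)) I s) *
     mpoly.mpolyX _ (mpoly.mnm1 k)).
exists (\det A); split=> [mon|t].
  apply: mdeg_le_det => r s; rewrite mxE; apply: mdeg_leD.
    by apply: (@mdeg_le_trans _ _ 0 1) => //; exact: (@mdeg_leC R[i]).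
  apply: mdeg_le_sum => k; apply: (@mdeg_leM _ _ 0 1).
    exact: (@mdeg_leC R[i]).
  exact: (@mdeg_leX R[i]).
rewrite -det_map_mx /plucker; congr (\det _); apply/matrixP => r s.
rewrite !mxE rmorphD /= mpoly.mevalC rmorph_sum /=.
rewrite /coord; have [sI|sI] := ltnP s (size (points I)); last first.
  rewrite !nth_default ?size_map// add0r big1// => k _.
  by rewrite rmorphM /= mpoly.mevalC nth_default ?size_map// mul0r.
have [a0 _] : exists a0, a0 \in points I.
  by case: (points I) sI => // a L _; exists a; rewrite inE eqxx.
rewrite !(nth_map a0)//; set a := nth a0 _ _.
rewrite /graph_basis [LHS]/((bas ch r a.1 a.2 : R[i]) +
  app (\sum_k t k *: Phi k) (bas ch r) a.1 a.2).
congr (_ + _).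
have appE (Psi : blockop R m) : app Psi (bas ch r) a.1 a.2 =
    \sum_j Psi a.1 j (bas ch r j) a.2 by rewrite /app fct_sumE.
have sumE j : (\sum_k t k *: Phi k) a.1 j (bas ch r j) a.2 =
    \sum_k t k *: (Phi k a.1 j (bas ch r j) a.2) by rewrite !fct_sumE.
rewrite appE (eq_bigr _ (fun j _ => sumE j)) exchange_big /=.
apply: eq_bigr => k _.
rewrite rmorphM /= mpoly.mevalC mpoly.mevalXU (nth_map a0)// -/a appE.
by rewrite mulrC mulr_sumr.
Qed.

Lemma lp_delta (R : realType) (q : R) (k : nat) : 1 <= q ->
  lp q (fun l => (l == k)%:R : R[i]^o).
Proof.
move=> q1; rewrite /lp /= /lpnorm poweR_lty//.
have -> : (\esum_(l in [set: nat]) (nc ((l == k)%:R : R[i]) `^ q)%:E)%E =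
    (\esum_(l in [set k]) (1 : \bar R))%E.
  rewrite [RHS]esum_mkcond; apply: eq_esum => l _.
  have [->|lk] := eqVneq l k.
    by rewrite mem_set// Normc.normc1 powR1.
  rewrite nc0 powR0 ?gt_eqF ?(lt_le_trans _ q1)// memNset//=.
  by move=> e; rewrite e eqxx in lk.
by rewrite esum_set1 ?ltry.
Qed.

(** * Nonvanishing of the lowest-order part *)

Section FrameBlocks.
Variables (R : realType) (m n : nat) (p : 'I_m -> R) (nn : 'I_m -> nat).
Hypothesis p1 : forall i, 1 <= p i.
Hypothesis nn_sum : (\sum_i nn i = n)%N.
Variables (ch : chart p nn n) (sg : 'I_n -> 'I_m) (w : 'I_n -> cseq R).
Variable th : 'I_n -> cseq R -> R[i]^o.
Hypothesis fr : frame ch sg w th.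
Implicit Types Phi Psi : blockop R m.

Lemma Wc_of_functionals i x : lp (p i) x ->
  (forall s, sg s = i -> th s x = 0) -> Wc ch i x.
Proof.
move=> lx hx; have [y [u [Wy Wu xE]]] := @W_Wc_sum _ _ _ _ _ ch i x lx.
suff y0 : y = 0 by rewrite xE y0 add0r.
rewrite (frame_expand fr Wy) big1// => s /eqP si.
have ly : lp (p (sg s)) y by rewrite si; exact: (@W_sub _ _ _ _ _ ch).
have lu : lp (p (sg s)) u by rewrite si; exact: (@Wc_sub _ _ _ _ _ ch).
have := hx s si; rewrite xE -[y in y + u]scale1r (frame_lin fr)// scale1r.
rewrite (frame_Wc fr (s := s) (u := u)) ?si// => e.
by have -> : th s y = 0 by [rewrite -[LHS]addr0]; rewrite scale0r.
Qed.

(* Solve n_i linear conditions on sequences supported in the first 2n indices. *)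
Lemma complement_independent i : exists u : 'I_n -> cseq R,
  (forall s, Wc ch i (u s)) /\
  (forall c : 'I_n -> R[i], \sum_s c s *: u s = 0 -> forall s, c s = 0).
Proof.
pose de (k : nat) : cseq R := fun l => (l == k)%:R.
pose Th : 'M[R[i]]_(n + n, n) :=
  \matrix_(k, s) (if sg s == i then th s (de k) : R[i] else 0).
pose K := row_base (kermx Th).
have rK : (n <= \rank (kermx Th))%N.
  by rewrite mxrank_ker; have := rank_leq_col Th; move: (\rank Th) => r; lia.
pose X : 'M[R[i]]_(n, n + n) := pid_mx n *m K.
have fX : row_free X.
  rewrite /row_free mxrankMfree ?row_base_free// rank_pid_mx//.
have XTh : X *m Th = 0.
  apply/eqP; rewrite -sub_kermx (submx_trans (submxMl _ _))//.
  by rewrite eq_row_base.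
pose u s : cseq R := \sum_k X s k *: de k.
have ule s (k : 'I_(n + n)) : u s k = X s k.
  rewrite /u fct_sumE (bigD1 k)//= big1 => [|l lk].
    rewrite addr0; transitivity (X s k * 1); last exact: mulr1.
    by rewrite [LHS]/(X s k * de k k) /de eqxx.
  rewrite [LHS]/(X s l * de l k) /de (_ : (k == l :> nat) = false).
    exact: mulr0.
  by apply/negbTE; rewrite eq_sym.
exists u; split=> [s|c hc s].
  apply: Wc_of_functionals => [|t ti].
    by apply: lp_sum => // k _; apply: lpZ => //; exact: lp_delta.
  rewrite (linear_on_sum _ _ (lp_subspace (p1 (sg t))) (frame_lin (s := t) fr)).
    have /matrixP/(_ s t) := XTh; rewrite !mxE => e; rewrite -[RHS]e.
    by apply: eq_bigr => k _; rewrite !mxE ti eqxx.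
  by move=> k _; exact: lp_delta.
have : (\row_t c t) *m X = 0.
  apply/rowP => k; rewrite !mxE; have := congr1 (fun f : cseq R => f k) hc.
  rewrite fct_sumE => e; rewrite -[RHS]e; apply: eq_bigr => t _.
  by rewrite mxE [RHS]/(c t * u t k) ule.
move=> /eqP; rewrite mulmx_free_eq0// => /eqP/rowP/(_ s).
by rewrite !mxE.
Qed.

(** Take a matching [tau] with the fewest mismatches and an operator sending each mismatched w r
    into the complement in component [tau r], along independent vectors. Placing row r in component
    [tau r] then gives independent vectors, hence a nonzero minor, whose columns have the right
    type. By [det_twist_matching] the coordinate at these columns is a pure power of t, so q is
    constant. *)
Lemma plucker_leading delta : \sum_i delta i = 0 ->
  (forall i, 0 <= shift nn delta i) ->
  exists (I : 'I_m -> {fset nat}) (Phi : blockop R m) (q : {poly R[i]}),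
    [/\ has_type (shift nn delta) I, chart_op ch Phi, q.[0] != 0 &
      forall t : R[i],
        plucker (graph_basis ch (diag_part Phi + t *: off_part Phi)) I
        = t ^+ half_l1 delta * q.[t]].
Proof.
move=> d0 dn; have [tau [ht hm]] := exists_type_matching nn_sum (frame_fiber fr) d0 dn.
have [u hu] := fin_all_exists complement_independent.
pose y r : cseq R := if tau r == sg r then w r else u (tau r) r.
pose v r (a : 'I_m * nat) : R[i] := embed (tau r) (y r) a.1 a.2.
have [|pt hpt] := @independent_minor _ _ n v.
  move=> c hc r.
  pose Am := \sum_(s | (tau s == tau r) && (tau s == sg s)) c s *: w s.
  pose Bm := \sum_(s | (tau s == tau r) && (tau s != sg s)) c s *: u (tau r) s.
  have AB : Am + Bm = 0.
    apply: funext => k; rewrite [RHS]/(0 : R[i]) -[RHS](hc (tau r, k)).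
    rewrite [LHS]/(Am k + Bm k) /Am /Bm !fct_sumE.
    rewrite [RHS](bigID (fun s => tau s == tau r)) /= [X in _ = _ + X]big1 ?addr0.
      rewrite [RHS](bigID (fun s => tau s == sg s)) /=; congr (_ + _).
        apply: eq_bigr => s /andP[/eqP e1 e2].
        by rewrite /v /embed /= e1 eqxx /y e2.
      apply: eq_bigr => s /andP[/eqP e1 e2].
      by rewrite /v /embed /= e1 eqxx /y (negbTE e2) e1.
    by move=> s /negbTE e; rewrite /v /embed /= eq_sym e mulr0.
  have WA : W ch (tau r) Am.
    apply: subspace_sum => [|s /andP[/eqP e1 /eqP e2]]; first exact: W_subspace.
    apply: subspaceZ; first exact: W_subspace.
    by rewrite -e1 e2; exact: frame_W fr s.
  have WB : Wc ch (tau r) Bm.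
    apply: subspace_sum => [|s _]; first exact: Wc_subspace.
    by apply: subspaceZ; [exact: Wc_subspace|case: (hu (tau r))].
  have A0 : Am = 0.
    apply: (@W_Wc_cap _ _ _ _ _ ch (tau r)) => //.
    rewrite (_ : Am = - Bm); first by apply: subspaceN => //; exact: Wc_subspace.
    by apply/eqP; rewrite -addr_eq0 AB.
  have B0 : Bm = 0 by move: AB; rewrite A0 add0r.
  have [e|ne] := eqVneq (tau r) (sg r).
    have := linear_on_sum (index_enum 'I_n) c (lp_subspace (p1 (sg r)))
      (frame_lin (s := r) fr) (P := fun s => (tau s == tau r) && (tau s == sg s))
      (x := w) => h.
    have {h} : th r Am = \sum_(s | (tau s == tau r) && (tau s == sg s)) c s *: th r (w s).
      apply: h => s /andP[/eqP e1 /eqP e2].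
      by rewrite -e -e1 e2; apply: (@W_sub _ _ _ _ _ ch); exact: frame_W fr s.
    rewrite A0 (linear_on0 (lp_subspace (p1 (sg r))) (frame_lin (s := r) fr)).
    rewrite (bigD1 r) ?eqxx ?e//= big1 => [|s /andP[/andP[/eqP e1 /eqP e2] sr]].
      rewrite (frame_dual fr) // eqxx addr0 => /esym e0.
      by rewrite -[LHS]mulr1.
    rewrite (frame_dual fr); last by rewrite -e2 -e e1.
    by rewrite (negbTE sr); apply: scaler0.
  pose c' s := if (tau s == tau r) && (tau s != sg s) then c s else 0.
  have := (hu (tau r)).2 c' _ r; rewrite /c' eqxx ne; apply.
  rewrite -[RHS]B0 /Bm [RHS]big_mkcond; apply: eq_bigr => s _.
  by case: ifP => _ //; rewrite scale0r.
pose L := [tuple pt s | s < n].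
have cL : coldet (fun a r => v r a) L != 0.
  rewrite coldet_tuple; congr (\det _ != 0): hpt.
  by apply/matrixP => r s; rewrite !mxE tnth_mktuple.
have uL : uniq L.
  by apply: contraNT cL => nu; rewrite coldet_dup ?size_tuple.
pose I i := [fset a.2 | a in (L : seq _) & a.1 == i]%fset.
have pI : perm_eq (points I) L by rewrite perm_sym; exact: points_traces.
have pvI : plucker (fun r => embed (tau r) (y r)) I != 0.
  have [e he] := coldet_perm R[i] (size_tuple L) pI.
  have -> : plucker (fun r => embed (tau r) (y r)) I =
      coldet (fun a r => v r a) (points I) by [].
  by rewrite he mulf_neq0// signr_eq0.
have typeI : has_type (shift nn delta) I.
  move=> i; rewrite -ht -count_points (seq.permP pI) -size_filter.
  rewrite -(minor_type (tau := tau) (c := fun s => (pt s).1) hpt).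
    rewrite size_filter -[X in count _ X]map_tnth_enum count_map -size_filter.
    by congr (size _)%:Z; apply: eq_filter => s /=; rewrite tnth_mktuple.
  move=> r s; rewrite mxE /v /embed; case: ((pt s).1 =P tau r) => // _ /eqP h.
  by case: h.
(* Its diagonal is 0, and w s goes to u (tau s) s in component [tau s] when s is mismatched, to 0
   otherwise. *)
pose Phi : blockop R m := fun i j x =>
  \sum_(s | [&& sg s == j, tau s == i & i != j]) (th s x : R[i]) *: u i s.
have hPhi : chart_op ch Phi.
  move=> i j; split=> [a x z Wx Wz|x Wx].
    rewrite /Phi scaler_sumr -big_split; apply: eq_bigr => s /and3P[/eqP sj _ _] /=.
    rewrite (frame_lin fr) ?sj; do ?exact: (@W_sub _ _ _ _ _ ch).
    by rewrite scalerA -scalerDl.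
  apply: subspace_sum => [|s _]; first exact: Wc_subspace.
  by apply: subspaceZ; [exact: Wc_subspace|case: (hu i)].
have PhiE i r : Phi i (sg r) (w r) = if (tau r == i) && (i != sg r) then u i r else 0.
  rewrite /Phi; case: ifPn => [/andP[e1 e2]|h].
    rewrite (bigD1 r) ?eqxx ?e1//= (frame_dual fr)// eqxx scale1r big1 ?addr0//.
    move=> s /andP[/and3P[/eqP e _ _] sr]; rewrite (frame_dual fr) ?e//.
    by rewrite eq_sym (negbTE sr) scale0r.
  apply: big1 => s /and3P[/eqP e1 e2 e3]; rewrite (frame_dual fr)//.
  have [sr|_] := eqVneq r s; last by rewrite scale0r.
  by move: h; rewrite sr e2 e1 e3.
have [pt' ptE dE] := index_tuple nn_sum (frame_fiber fr) d0 typeI.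
exists I, Phi, (\det (bas_coef ch sg th) * plucker (fun r => embed (tau r) (y r)) I)%:P.
split=> //.
  rewrite hornerC; apply: mulf_neq0; last exact: pvI.
  by have := bas_coef_unit p1 fr; rewrite unitmxE unitfE.
move=> t; rewrite (plucker_twist fr t hPhi ptE) hornerC.
rewrite (det_twist_matching dE (tau := tau) _ hm) => [|r s].
  rewrite mulrCA (plucker_tuple _ ptE); congr (_ * (_ * \det _)).
  apply/matrixP => r s; rewrite !mxE; set a := tnth pt' s.
  rewrite /frame_entry PhiE /embed.
  have [e|ne] := eqVneq a.1 (tau r); last by [].
  rewrite e /y; have [e'|ne'] := eqVneq (tau r) (sg r).
    exact: addr0.
  exact: add0r.
rewrite mxE /frame_entry PhiE; set a := tnth pt' s.
have [e|ne] := eqVneq (sg r) a.1; first by left.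
have [e'|ne'] := eqVneq (tau r) a.1; first by right.
by rewrite /= [X in _ + X](_ : _ = 0) ?addr0 ?eqxx.
Qed.

End FrameBlocks.

(** * First-order part of the unit exchanges *)

Section UnitExchange.
Variables (R : realType) (m n : nat) (p : 'I_m -> R) (nn : 'I_m -> nat).
Hypothesis p1 : forall i, 1 <= p i.
Hypothesis nn_sum : (\sum_i nn i = n)%N.
Variables (ch : chart p nn n) (sg : 'I_n -> 'I_m) (w : 'I_n -> cseq R).
Variable th : 'I_n -> cseq R -> R[i]^o.
Hypothesis fr : frame ch sg w th.
Implicit Types Phi Psi : blockop R m.

Lemma sum_unit_exchange (i j : 'I_m) : \sum_l unit_exchange i j l = 0.
Proof.
rewrite /unit_exchange sumrB (bigD1 i)//= big1 => [|l /negbTE ->//].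
by rewrite eqxx (bigD1 j)//= big1 ?eqxx => [|l /negbTE ->//].
Qed.

(** The coefficients are built from exchange cofactors, which see only same-component entries and so
    agree for all Psi with the diagonal of Phi. The inverse V of the change of basis rewrites Psi_ij
    at frame vectors in terms of the given basis. *)
Lemma plucker_unit_exchange (i j : 'I_m) I Phi :
  i != j -> has_type (shift nn (unit_exchange i j)) I -> chart_op ch Phi ->
  exists lam : 'I_n -> nat -> R[i],
    forall Psi : blockop R m, chart_op ch Psi ->
      (forall l w, W ch l w -> Psi l l w = Phi l l w) ->
      exists q : {poly R[i]},
        [/\ forall t : R[i],
              plucker (graph_basis ch (diag_part Psi + t *: off_part Psi)) I
              = q.[t],
            q`_0 = 0
          & q`_1 = \sum_(r < n) \sum_(k <- I i)
                     lam r k * (Psi i j (bas ch r j) k : R[i])].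
Proof.
move=> ij hI hPhi.
have [pt ptE dE] := index_tuple nn_sum (frame_fiber fr) (sum_unit_exchange i j) hI.
pose c s := (tnth pt s).1.
pose A Psi : 'M[R[i]]_n := \matrix_(r, s) frame_entry sg w Psi r (tnth pt s).
pose D := \det (bas_coef ch sg th).
pose V := invmx (bas_coef ch sg th).
pose lam' s k := \sum_(s' | tnth pt s' == (i, k)) exchange_cofactor sg c (A Phi) s s'.
exists (fun r k => D * \sum_(s | sg s == j) V s r * lam' s k) => Psi hPsi hdiag.
pose q := D *: twist_poly sg c (unit_exchange i j) (A Psi).
exists ('X * q); split.
- move=> t; rewrite (plucker_twist fr t hPsi ptE) (det_twist _ dE).
  by rewrite (half_l1_unit ij) expr1 hornerM hornerX hornerZ mulrCA.
- by rewrite coefXM.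
rewrite coefXM /= -horner_coef0 hornerZ (twist_poly0_unit ij dE).
have frameE s : sg s = j -> Psi i j (w s) = \sum_r V s r *: Psi i j (bas ch r j).
  move=> sj; rewrite -(linear_on_sum _ _ (W_subspace ch j) (hPsi i j).1); last first.
    by move=> r _; exact: V0_bas.
  congr (Psi i j _).
  have e : frame_vec sg w s = \sum_r V s r *: bas ch r.
    have -> : \sum_r V s r *: bas ch r =
        \sum_r V s r *: \sum_t bas_coef ch sg th r t *: frame_vec sg w t.
      by apply: eq_bigr => r _; congr (_ *: _); exact: bas_expand.
    under eq_bigr do rewrite scaler_sumr; rewrite exchange_big /=.
    have h t : \sum_r V s r * bas_coef ch sg th r t = (s == t)%:R.
      have /matrixP/(_ s t) := mulVmx (bas_coef_unit p1 fr).
      by rewrite !mxE.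
    transitivity (\sum_t (s == t)%:R *: frame_vec sg w t : mseq R m).
      rewrite [RHS](bigD1 s)//= eqxx scale1r [X in _ + X]big1 ?addr0// => t ts.
      by rewrite eq_sym (negbTE ts) scale0r.
    apply: eq_bigr => t _; rewrite -h scaler_suml.
    by apply: eq_bigr => r _; rewrite scalerA.
  have := congr1 (fun f : mseq R m => f j) e.
  by rewrite {1}/frame_vec /embed sj eqxx => ->; rewrite fct_sumE.
transitivity (D * \sum_(s | sg s == j) \sum_(k <- I i) lam' s k * Psi i j (w s) k).
  congr (_ * _); apply: eq_bigr => s /eqP sj.
  rewrite /lam'; under [RHS]eq_bigr do rewrite mulr_suml.
  have -> : \sum_(k <- I i) \sum_(s' | tnth pt s' == (i, k))
      exchange_cofactor sg c (A Phi) s s' * Psi i j (w s) k =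
    \sum_(k <- I i) \sum_(s' | c s' == i) if (tnth pt s').2 == k then
      exchange_cofactor sg c (A Phi) s s' * Psi i j (w s) k else 0.
    apply: eq_bigr => k _; rewrite -big_mkcondr; apply: eq_bigl => s'.
    by rewrite /c -pair_eqE.
  rewrite exchange_big /=; apply: eq_bigr => s' /eqP cs'.
  have kI : (tnth pt s').2 \in I i.
    rewrite -mem_points ptE -{1}cs' /c -surjective_pairing; exact: mem_tnth.
  rewrite (bigD1_seq _ kI (fset_uniq _)) /= eqxx big1 ?addr0 => [|k].
    rewrite (eq_exchange_cofactor dE (A' := A Phi)); last first.
      move=> r t e; rewrite !mxE /frame_entry; congr (_ + _).
      rewrite (_ : (tnth pt t).1 = sg r); last by rewrite e.
      by rewrite hdiag//; exact: frame_W fr r.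
    congr (_ * _); rewrite mxE /frame_entry cs' sj eq_sym (negbTE ij).
    by rewrite add0r.
  by rewrite eq_sym => /negbTE ->.
rewrite mulr_sumr.
transitivity (\sum_(s | sg s == j) \sum_(k <- I i) \sum_r
    D * (V s r * lam' s k) * (Psi i j (bas ch r j) k : R[i])).
  apply: eq_bigr => s /eqP sj; rewrite mulr_sumr; apply: eq_bigr => k _.
  rewrite frameE// fct_sumE mulrA mulr_sumr; apply: eq_bigr => r _.
  rewrite [(_ *: _) k]/(V s r * Psi i j (bas ch r j) k).
  by rewrite mulrA; congr (_ * _); rewrite -mulrA; congr (_ * _); rewrite mulrC.
rewrite exchange_big /= [RHS]exchange_big /=; apply: eq_bigr => k _.
rewrite exchange_big /=; apply: eq_bigr => r _.
by rewrite mulr_sumr mulr_suml.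
Qed.

End UnitExchange.

(** * Unit exchanges in adapted coordinates *)

Section AdaptedCoordinates.
Variables (R : realType) (m n : nat) (p : 'I_m -> R) (nn : 'I_m -> nat).
Hypothesis nn_sum : (\sum_i nn i = n)%N.
Variable ch : chart p nn n.

(** On the columns of P the matrix of the graph is the identity, because Phi takes values in
    sequences vanishing on P. Exchanging (j, a) for (i, k) replaces its r-th column, so the
    determinant is the r-th entry of the new column. *)
Lemma adapted_exchange (P : 'I_m -> {fset nat}) : adapted ch P ->
  forall (i j : 'I_m) (a k : nat) (r : 'I_n),
    i != j -> a \in P j -> k \notin P i ->
    r = index (j, a) (points P) :> nat ->
    has_type (shift nn (unit_exchange i j)) (exchange P i j k a) /\
    W ch j (bas ch r j) /\
    exists e : nat, forall Phi : blockop R m, chart_op ch Phi ->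
      plucker (graph_basis ch Phi) (exchange P i j k a)
      = (-1) ^+ e * (Phi i j (bas ch r j) k : R[i]).
Proof.
move=> [hP hWc hbas] i j a k r ij aP kP rE; split; first exact: exchange_type.
split; first exact: V0_bas.
have sP : size (points P) = n.
  rewrite size_points -[RHS]nn_sum; apply: eq_bigr => l _.
  by have := hP l => -[].
pose pt : n.-tuple ('I_m * nat) := Tuple (introT eqP sP).
have ptr : tnth pt r = (j, a).
  by rewrite (tnth_nth (j, a)) /= rE nth_index// mem_points.
have ptinj s t : tnth pt s = tnth pt t -> s = t.
  rewrite !(tnth_nth (j, a)) => /eqP; rewrite nth_uniq ?uniq_points ?sP//.
  by move/eqP/val_inj.
have basE q s : (bas ch q (tnth pt s).1 (tnth pt s).2 : R[i]) = (q == s)%:R.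
  rewrite -hbas /coord (nth_map (j, a)) ?sP//.
  by rewrite -[points P]/(val pt) -(tnth_nth _ pt).
(* By duality with P, the l-th component of this vector vanishes on P_l. It lies in both W_l and
   W_l^c, hence is 0. *)
have bas0 l : l != j -> bas ch r l = 0.
  move=> lj; have Wl := V0_bas ch r l.
  apply: (@W_Wc_cap _ _ _ _ _ ch l) => //; rewrite hWc.
  split; first exact: (@W_sub _ _ _ _ _ ch).
  move=> b bP; have : (l, b) \in points P by rewrite mem_points.
  rewrite -[points P]/(val pt) => /tnthP[s es].
  have := basE r s; rewrite -es /= => ->; case: eqP => // rs.
  by move: es; rewrite -rs ptr => -[lj']; rewrite lj' eqxx in lj.
have sz : size (map (move_point i j a k) (points P)) = n by rewrite size_map.
have [e he] := coldet_perm R[i] sz (perm_exchange ij aP kP).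
exists e => Phi hPhi.
have -> : plucker (graph_basis ch Phi) (exchange P i j k a) =
  coldet (fun b q => graph_basis ch Phi q b.1 b.2 : R[i]) (points (exchange P i j k a)).
  by [].
rewrite he coldet_map; congr (_ * _).
rewrite -[points P]/(val pt) coldet_tuple -det_tr.
have -> : (\matrix_(q, s) (graph_basis ch Phi q (move_point i j a k (tnth pt s)).1
     (move_point i j a k (tnth pt s)).2 : R[i]))^T =
  \matrix_(s, q) if s == r then (graph_basis ch Phi q i k : R[i]) else (s == q)%:R.
  apply/matrixP => s q; rewrite !mxE /move_point.
  have [->|sr] := eqVneq s r; first by rewrite ptr eqxx.
  have -> : (tnth pt s == (j, a)) = false.
    by apply: contraNF sr => /eqP es; apply/eqP/ptinj; rewrite es ptr.
  rewrite [LHS]/((bas ch q (tnth pt s).1 (tnth pt s).2 : R[i]) +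
    app Phi (bas ch q) (tnth pt s).1 (tnth pt s).2) basE eq_sym.
  have : Wc ch (tnth pt s).1 (app Phi (bas ch q) (tnth pt s).1).
    apply: subspace_sum => [|l _]; first exact: Wc_subspace.
    exact: (hPhi _ l).2 _ (V0_bas ch q l).
  rewrite hWc => -[_ ->]; first exact: addr0.
  by rewrite -mem_points -surjective_pairing mem_tnth.
rewrite det_replace_row.
rewrite [LHS]/((bas ch r i k : R[i]) + app Phi (bas ch r) i k) bas0//.
rewrite /app (bigD1 j)//= big1 => [|l lj].
  by rewrite addr0; exact: add0r.
by rewrite bas0//; exact: linear_on0 (W_subspace ch l) (hPhi i l).1.
Qed.

End AdaptedCoordinates.

Lemma nlp_sum_le (R : realType) (q : R) (I : Type) (r : seq I) (P : pred I)
    (F : I -> cseq R) (B : R) : 1 <= q -> (forall i, P i -> lp q (F i)) ->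
  \sum_(i <- r | P i) nlp q (F i) <= B -> nlp q (\sum_(i <- r | P i) F i) <= B.
Proof. by move=> q1 h; apply: le_trans; exact: nlp_sum. Qed.

Section ChartSize.
Variables (R : realType) (m n : nat) (p : 'I_m -> R) (N : 'rV[R]_m -> R).
Variable nn : 'I_m -> nat.
Hypothesis p1 : forall i, 1 <= p i.
Hypothesis N_abs : absolute_norm N.
Hypothesis nn_sum : (\sum_i nn i = n)%N.

Lemma chart_bound_exists (ch : chart p nn n) : exists K, chart_bound ch N K.
Proof.
have [sg [w [th fr]]] := frame_exists p1 nn_sum ch.
have [B hB] := frame_bounded fr.
pose K1 := \sum_(s < n) `|B|; pose K2 := \sum_r Xnorm p N (bas ch r).
have K10 : 0 <= K1 by apply: sumr_ge0.
have K20 : 0 <= K2 by apply: sumr_ge0 => r _; exact: Xnorm_ge0.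
exists (K1 + K2); split=> [i x u Wx Wu|r]; last first.
  apply: le_trans (_ : K2 <= _); last by rewrite lerDr.
  by rewrite /K2 (bigD1 r)//= lerDl sumr_ge0// => s _; exact: Xnorm_ge0.
have lx : lp (p i) x := @W_sub _ _ _ _ _ ch i x Wx.
have lu : lp (p i) u := @Wc_sub _ _ _ _ _ ch i u Wu.
apply: (@le_trans _ _ (K1 * nlp (p i) (x + u))); last first.
  by rewrite ler_wpM2r ?nlp_ge0// lerDl.
rewrite {1}(frame_expand fr Wx) /K1 mulr_suml.
apply: (nlp_sum_le (p1 i)) => [s /eqP si|].
  apply: lpZ => //; apply: (@W_sub _ _ _ _ _ ch); rewrite -si; exact: frame_W fr s.
rewrite big_mkcond; apply: ler_sum => s _; case: eqP => [si|_]; last first.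
  by rewrite mulr_ge0 ?nlp_ge0.
rewrite nlpZ//; apply: (@le_trans _ _ (nc (th s x))).
  by rewrite ler_piMr ?nc_ge0// -si; exact: frame_le1 fr s.
have -> : th s x = th s (x + u).
  have := @frame_lin _ _ _ _ _ _ _ _ _ fr s 1 x u.
  rewrite si !scale1r => ->//; rewrite (frame_Wc fr (s := s) (u := u)) ?si//.
  exact/esym/addr0.
apply: le_trans (hB s (x + u) _) _; first by rewrite si; exact: lpD.
by rewrite si ler_wpM2r ?nlp_ge0// ler_norm.
Qed.

End ChartSize.

(** * Distance to the stratum *)

Section OperatorNorm.
Variables (R : realType) (m n : nat) (p : 'I_m -> R) (N : 'rV[R]_m -> R).
Variable nn : 'I_m -> nat.
Hypothesis p1 : forall i, 1 <= p i.
Hypothesis N_abs : absolute_norm N.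
Hypothesis nn_sum : (\sum_i nn i = n)%N.
Variable kap : R.
Hypothesis kap1 : 1 <= kap.
Hypothesis kapP : forall x : mseq R m,
  snorm p x <= kap * Xnorm p N x /\ Xnorm p N x <= kap * snorm p x.
Variable ch : chart p nn n.
Implicit Type Phi : blockop R m.

Let kap0 : 0 <= kap. Proof. exact: le_trans kap1. Qed.

Lemma snorm_embed j y : snorm p (embed j y) = nlp (p j) y.
Proof.
rewrite /snorm (bigD1 j)//= /embed eqxx big1 ?addr0// => l /negbTE ->.
exact: nlp0.
Qed.

Lemma lp_app Phi x i : chart_op ch Phi -> V0 ch x -> Wc ch i (app Phi x i).
Proof.
move=> h Vx; apply: subspace_sum => [|j _]; first exact: Wc_subspace.
exact: (h i j).2.
Qed.

Lemma snorm_app_le Phi eta : chart_op ch Phi -> 0 <= eta ->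
  (forall i j y, W ch j y -> nlp (p i) (Phi i j y) <= eta * nlp (p j) y) ->
  forall x, V0 ch x -> snorm p (app Phi x) <= m%:R * eta * snorm p x.
Proof.
move=> h e0 hn x Vx.
apply: (@le_trans _ _ (\sum_(i < m) eta * snorm p x)); last first.
  by rewrite sumr_const card_ord -mulrA mulr_natl.
apply: ler_sum => i _; apply: (nlp_sum_le (p1 i)) => [j _|].
  by apply: (@Wc_sub _ _ _ _ _ ch); exact: (h i j).2.
by rewrite mulr_sumr; apply: ler_sum => j _; exact: hn.
Qed.

Lemma opnorm_ge0 Phi : 0 <= opnorm ch N Phi.
Proof.
rewrite /opnorm; set A := (X in sup X).
case: (pselect (has_sup A)) => [hs|/sup_out ->//].
have [[x [u Uu ux]] _] := hs.
apply: (@le_trans _ _ x); first by rewrite -ux; exact: Xnorm_ge0.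
by apply: sup_upper_bound => //; exists u.
Qed.

Lemma opnorm_le_of Phi eta : 0 <= eta ->
  (forall x, V0 ch x -> Xnorm p N (app Phi x) <= eta * Xnorm p N x) ->
  opnorm ch N Phi <= eta.
Proof.
move=> e0 h; rewrite /opnorm; set A := (X in sup X).
case: (pselect (has_sup A)) => [[A0 _]|/sup_out ->//].
apply: ge_sup => // _ [x [Vx x1] <-].
by apply: le_trans (h x Vx) _; rewrite x1 mulr1.
Qed.

Lemma opnorm_le_entries Phi eta : chart_op ch Phi -> 0 <= eta ->
  (forall i j y, W ch j y -> nlp (p i) (Phi i j y) <= eta * nlp (p j) y) ->
  opnorm ch N Phi <= kap ^+ 2 * m%:R * eta.
Proof.
move=> h e0 hn; apply: opnorm_le_of; first by rewrite !mulr_ge0 ?exprn_ge0.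
move=> x Vx; apply: le_trans (kapP _).2 _.
apply: (@le_trans _ _ (kap * (m%:R * eta * (kap * Xnorm p N x)))).
  rewrite ler_wpM2l// (le_trans (snorm_app_le h e0 hn Vx))//.
  by rewrite ler_wpM2l ?mulr_ge0//; exact: (kapP x).1.
by apply: ler_eq; ring.
Qed.

(** Operators on a finite-dimensional space are bounded. This must come before any use of [opnorm],
    since the supremum of an unbounded set would be 0 by default. *)
Lemma entries_bounded Phi : chart_op ch Phi -> exists2 eta, 0 <= eta &
  forall i j y, W ch j y -> nlp (p i) (Phi i j y) <= eta * nlp (p j) y.
Proof.
move=> h; have [sg [w [th fr]]] := frame_exists p1 nn_sum ch.
pose eta := 2 * \sum_i \sum_s nlp (p i) (Phi i (sg s) (w s)).
exists eta => [|i j y Wy].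
  by rewrite mulr_ge0// !sumr_ge0// => i _; rewrite sumr_ge0// => s _; exact: nlp_ge0.
have WS s : sg s == j -> W ch j (w s) by move=> /eqP <-; exact: frame_W fr s.
rewrite {1}(frame_expand fr Wy) (linear_on_sum _ _ (W_subspace ch j) (h i j).1)//.
apply: (nlp_sum_le (p1 i)) => [s sj|].
  apply: lpZ => //; apply: (@Wc_sub _ _ _ _ _ ch); exact: (h i j).2 _ (WS s sj).
apply: (@le_trans _ _ (\sum_s 2 * nlp (p i) (Phi i (sg s) (w s)) * nlp (p j) y)).
  rewrite big_mkcond; apply: ler_sum => s _; case: eqP => [sj|_]; last first.
    by rewrite !mulr_ge0 ?nlp_ge0.
  rewrite nlpZ// sj mulrAC ler_wpM2r ?nlp_ge0// -sj.
  by apply: (frame_le fr (s := s)); rewrite sj.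
rewrite -mulr_suml ler_wpM2r ?nlp_ge0// -mulr_sumr ler_wpM2l//.
rewrite [leRHS](bigD1 i)//= lerDl sumr_ge0// => l _.
by rewrite sumr_ge0// => s _; exact: nlp_ge0.
Qed.

Lemma opnormP Phi x : chart_op ch Phi -> V0 ch x ->
  Xnorm p N (app Phi x) <= opnorm ch N Phi * Xnorm p N x.
Proof.
move=> h Vx; have [eta e0 hn] := entries_bounded h.
have Xx : Xspace p x by move=> i; apply: (@W_sub _ _ _ _ _ ch).
have happ y : V0 ch y -> Xnorm p N (app Phi y) <= kap ^+ 2 * m%:R * eta * Xnorm p N y.
  move=> Vy; apply: le_trans (kapP _).2 _.
  apply: (@le_trans _ _ (kap * (m%:R * eta * (kap * Xnorm p N y)))).
    rewrite ler_wpM2l// (le_trans (snorm_app_le h e0 hn Vy))//.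
    by rewrite ler_wpM2l ?mulr_ge0//; exact: (kapP y).1.
  by apply: ler_eq; ring.
have [x0|xn0] := eqVneq (Xnorm p N x) 0.
  by have := happ x Vx; rewrite x0 !mulr0.
have xp : 0 < Xnorm p N x by rewrite lt_neqAle eq_sym xn0 Xnorm_ge0.
pose a : R[i] := ((Xnorm p N x)^-1)%:C%C.
have na : nc a = (Xnorm p N x)^-1 by rewrite nc_real ger0_norm// invr_ge0 Xnorm_ge0.
have Vax : V0 ch (a *: x) by exact: (subspaceZ a (V0_subspace ch) Vx).
have ax1 : Xnorm p N (a *: x) = 1 by rewrite XnormZ// na mulVf.
have : Xnorm p N (app Phi (a *: x)) <= opnorm ch N Phi.
  apply: sup_upper_bound; last by exists (a *: x).
  split; first by exists (Xnorm p N (app Phi (a *: x))); exists (a *: x).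
  exists (kap ^+ 2 * m%:R * eta) => _ [y [Vy y1] <-].
  by apply: le_trans (happ y Vy) _; rewrite y1 mulr1.
have -> : app Phi (a *: x) = a *: app Phi x.
  have := @app_sum _ _ _ _ _ ch Phi unit [:: tt] xpredT (fun=> a) (fun=> x) h.
  by rewrite !big_seq1; apply.
by rewrite XnormZ// na mulrC ler_pdivrMr.
Qed.

Lemma entry_le Phi eta : chart_op ch Phi -> opnorm ch N Phi <= eta ->
  forall i j y, W ch j y -> nlp (p i) (Phi i j y) <= kap ^+ 2 * eta * nlp (p j) y.
Proof.
move=> h he i j y Wy; have Vx := V0_embed Wy.
have e0 : 0 <= eta by apply: le_trans he; exact: opnorm_ge0.
have -> : Phi i j y = app Phi (embed j y) i by rewrite (app_embed h Wy).
apply: le_trans (nlp_le_snorm _ _ _) _; apply: le_trans (kapP _).1 _.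
apply: (@le_trans _ _ (kap * (eta * (kap * nlp (p j) y)))); last first.
  by apply: ler_eq; ring.
rewrite ler_wpM2l// (le_trans (opnormP h Vx))//.
apply: ler_pM; rewrite ?opnorm_ge0 ?Xnorm_ge0//.
by rewrite -snorm_embed; exact: (kapP _).2.
Qed.

End OperatorNorm.

Section GapComparison.
Variables (R : realType) (m n : nat) (p : 'I_m -> R) (N : 'rV[R]_m -> R).
Variable nn : 'I_m -> nat.
Hypothesis p1 : forall i, 1 <= p i.
Hypothesis N_abs : absolute_norm N.
Hypothesis nn_sum : (\sum_i nn i = n)%N.
Variable kap : R.
Hypothesis kap1 : 1 <= kap.
Hypothesis kapP : forall x : mseq R m,
  snorm p x <= kap * Xnorm p N x /\ Xnorm p N x <= kap * snorm p x.
Variables (ch : chart p nn n) (K : R) (Phi : blockop R m).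
Hypothesis K1 : 1 <= K.
Hypothesis chK : chart_bound ch N K.
Hypothesis hPhi : chart_op ch Phi.
Hypothesis PhiK : opnorm ch N Phi <= K.

Let kap0 : 0 <= kap. Proof. exact: le_trans kap1. Qed.
Let K0 : 0 <= K. Proof. exact: le_trans K1. Qed.

Lemma V0_Xspace x : V0 ch x -> Xspace p x.
Proof. by move=> Vx i; apply: (@W_sub _ _ _ _ _ ch). Qed.

Lemma app_Xspace Psi x : chart_op ch Psi -> V0 ch x -> Xspace p (app Psi x).
Proof. by move=> h Vx i; apply: (@Wc_sub _ _ _ _ _ ch); exact: lp_app. Qed.

Lemma graph_subspace : subspace (graph ch Phi).
Proof.
split.
  exists 0; first by case: (V0_subspace ch).
  by rewrite (linear_on0 (V0_subspace ch) (app_linear hPhi)) addr0.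
move=> a _ _ [x Vx <-] [y Vy <-]; exists (a *: x + y).
  by case: (V0_subspace ch) => _; apply.
by rewrite (app_linear hPhi)// scalerDr addrACA.
Qed.

Lemma diag_graph_zero i : diag_graph ch Phi i 0.
Proof.
exists 0; first by case: (W_subspace ch i).
by rewrite (linear_on0 (W_subspace ch i) (hPhi i i).1) addr0.
Qed.

Lemma diag_graph_has_dim i : has_dim (diag_graph ch Phi i) (nn i).
Proof.
have [v hv] := W_dim ch i.
have Wv t : W ch i (v t).
  rewrite hv.2; exists (fun s => (s == t)%:R).
  rewrite (bigD1 t)//= eqxx scale1r big1 ?addr0// => s st.
  by rewrite (negbTE st) scale0r.
have comb (c : 'I_(nn i) -> R[i]) : \sum_t c t *: (v t + Phi i i (v t)) =
    \sum_t c t *: v t + Phi i i (\sum_t c t *: v t).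
  rewrite (linear_on_sum _ _ (W_subspace ch i) (hPhi i i).1)// -big_split.
  by apply: eq_bigr => t _; rewrite scalerDr.
have Wsum (c : 'I_(nn i) -> R[i]) : W ch i (\sum_t c t *: v t).
  by rewrite hv.2; exists c.
exists (fun t => v t + Phi i i (v t)); split.
  move=> c; rewrite comb => e; apply: hv.1.
  apply: (@W_Wc_cap _ _ _ _ _ ch i) => //.
  have -> : \sum_t c t *: v t = - Phi i i (\sum_t c t *: v t).
    by apply/eqP; rewrite -addr_eq0 e.
  by apply: subspaceN; [exact: Wc_subspace|exact: (hPhi i i).2].
apply/seteqP; split=> y.
  move=> [x Wx <-]; move: (Wx); rewrite {1}hv.2 => -[c xE].
  by exists c; rewrite comb -xE.
by move=> [c ->]; exists (\sum_t c t *: v t) => //; rewrite comb.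
Qed.

Lemma truncation_stratum : stratum p nn (truncation ch Phi).
Proof.
have sD i := has_dim_subspace (diag_graph_has_dim i).
have pE i : part (truncation ch Phi) i = diag_graph ch Phi i.
  apply/seteqP; split=> y.
    by move=> /(_ i); rewrite /embed eqxx.
  move=> h l; rewrite /embed; case: eqVneq => [->//|_].
  exact: diag_graph_zero.
split.
- split=> [i|a x y Vx Vy i]; first by case: (sD i).
  by case: (sD i) => _; apply.
- move=> x h i; have [y Wy <-] := h i; apply: lpD => //.
    exact: (@W_sub _ _ _ _ _ ch).
  by apply: (@Wc_sub _ _ _ _ _ ch); exact: (hPhi i i).2.
- apply: funext => x; apply: propext; split=> h i; last by have := h i; rewrite pE.
  by rewrite pE; exact: h.
- by move=> i; rewrite pE; exact: diag_graph_has_dim.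
Qed.

Lemma diag_off_sum x : app (diag_part Phi) x + app (off_part Phi) x = app Phi x.
Proof.
apply: funext => i.
transitivity (\sum_j (diag_part Phi i j (x j) + off_part Phi i j (x j))).
  by rewrite big_split.
apply: eq_bigr => j _; rewrite /diag_part /off_part.
by case: eqVneq => _; [exact: addr0|exact: add0r].
Qed.

Lemma app_diag x i : app (diag_part Phi) x i = Phi i i (x i).
Proof.
rewrite /app (bigD1 i)//= /diag_part eqxx big1 ?addr0// => j ji.
by rewrite eq_sym (negbTE ji).
Qed.

Lemma projection_Xnorm Psi x : chart_op ch Psi -> V0 ch x ->
  Xnorm p N x <= kap ^+ 2 * K * Xnorm p N (x + app Psi x).
Proof.
move=> h Vx; apply: le_trans (kapP _).2 _.
apply: (@le_trans _ _ (kap * (K * (kap * Xnorm p N (x + app Psi x))))); last first.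
  by apply: ler_eq; ring.
rewrite ler_wpM2l//; apply: (@le_trans _ _ (K * snorm p (x + app Psi x))).
  rewrite /snorm mulr_sumr; apply: ler_sum => i _; apply: chK.1 => //.
  exact: lp_app.
by rewrite ler_wpM2l//; exact: (kapP _).1.
Qed.

Lemma gap_truncation_le :
  gap p N (graph ch Phi) (truncation ch Phi) <=
  kap ^+ 2 * K * opnorm ch N (off_part Phi).
Proof.
have hoff := chart_op_off hPhi; have hdiag := chart_op_diag hPhi.
have op0 : 0 <= opnorm ch N (off_part Phi) by exact: opnorm_ge0.
have off x : V0 ch x -> Xnorm p N (app (off_part Phi) x) <=
    opnorm ch N (off_part Phi) * Xnorm p N x.
  exact: (opnormP p1 N_abs nn_sum kap1 kapP hoff).
have bnd x : Xnorm p N x <= kap ^+ 2 * K -> V0 ch x ->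
    Xnorm p N (app (off_part Phi) x) <= kap ^+ 2 * K * opnorm ch N (off_part Phi).
  by move=> hx Vx; apply: le_trans (off x Vx) _; rewrite mulrC ler_wpM2r.
apply: gap_le => //; first by rewrite !mulr_ge0 ?exprn_ge0.
- move=> _ [x Vx <-] x1; exists (x + app (diag_part Phi) x).
    by move=> i; exists (x i) => //; rewrite -app_diag.
  rewrite -diag_off_sum addrA [_ + app (off_part Phi) x]addrC addrK; apply: bnd => //.
  by apply: le_trans (projection_Xnorm hPhi Vx) _; rewrite x1 mulr1.
- move=> u Tu u1.
  have /choice[x hx] : forall i, exists y, W ch i y /\ y + Phi i i y = u i.
    by move=> i; have [y Wy yE] := Tu i; exists y.
  have Vx : V0 ch x by move=> i; case: (hx i).
  have uE : u = x + app (diag_part Phi) x.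
    apply: funext => i; have [_ <-] := hx i.
    by rewrite [RHS]/(x i + app (diag_part Phi) x i) app_diag.
  exists (x + app Phi x); first by exists x.
  have -> : u - (x + app Phi x) = (-1) *: app (off_part Phi) x.
    by rewrite uE -diag_off_sum scaleN1r addrA opprD addrA subrr add0r.
  rewrite XnormZ// ncN Normc.normc1 mul1r; apply: bnd => //.
  by apply: le_trans (projection_Xnorm hdiag Vx) _; rewrite -uE u1 mulr1.
Qed.

Lemma gap_le1 (S T : set (mseq R m)) : S 0 -> T 0 -> gap p N S T <= 1.
Proof.
by move=> S0 T0; apply: gap_le => // u _ u1; exists 0; rewrite ?subr0 ?u1.
Qed.

(** [A] bounds the map x |-> x + Phi x in [snorm]. [A'] bounds the component z_i of the nearby point
    of S relative to x; its 2 is the bound on [eta]. *)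
Let A := 1 + m%:R * (kap ^+ 2 * K).
Let A' := A * (1 + 2 * kap ^+ 2).
Definition gap_const := kap ^+ 2 * (A + A' + A * K * (A + A')).

Lemma off_entry_le_gap S eta : stratum p nn S -> 0 <= eta -> eta <= 2 ->
  gap p N (graph ch Phi) S < eta ->
  forall i j y, i != j -> W ch j y ->
    nlp (p i) (Phi i j y) <= gap_const * eta * nlp (p j) y.
Proof.
move=> [sS SX SE _] e0 e2 hg i j y ij Wy.
have [h1 h2] := gap_lt p1 N_abs graph_subspace sS hg.
have A1 : 1 <= A by rewrite lerDl !mulr_ge0 ?exprn_ge0.
have A0 : 0 <= A by exact: le_trans A1.
pose et := kap ^+ 2 * eta; have et0 : 0 <= et by rewrite mulr_ge0 ?exprn_ge0.
have near (u v : mseq R m) : Xnorm p N (u - v) <= eta * Xnorm p N u ->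
    snorm p (u - v) <= et * snorm p u.
  move=> h; apply: le_trans (kapP _).1 _.
  apply: (@le_trans _ _ (kap * (eta * (kap * snorm p u)))); last first.
    by apply: ler_eq; rewrite /et; ring.
  rewrite ler_wpM2l// (le_trans h)// ler_wpM2l//; exact: (kapP _).2.
have sgraph x : V0 ch x -> snorm p (x + app Phi x) <= A * snorm p x.
  move=> Vx; apply: (@le_trans _ _ (snorm p x + snorm p (app Phi x))).
    rewrite /snorm -big_split; apply: ler_sum => l _; apply: nlpD => //.
      exact: V0_Xspace.
    exact: app_Xspace.
  rewrite /A mulrDl mul1r lerD2l; apply: snorm_app_le => //.
    by rewrite mulr_ge0 ?exprn_ge0.
  exact: (entry_le p1 N_abs nn_sum kap1 kapP hPhi PhiK).
pose x := embed j y; have Vx := V0_embed Wy : V0 ch x.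
have sx : snorm p x = nlp (p j) y by exact: snorm_embed.
pose v := x + app Phi x.
have vi : v i = Phi i j y.
  rewrite [LHS]/(x i + app Phi x i) /x (app_embed hPhi Wy) /embed (negbTE ij).
  exact: add0r.
have Wvi : Wc ch i (v i) by rewrite vi; exact: (hPhi i j).2.
have lvi : lp (p i) (v i) by exact: (@Wc_sub _ _ _ _ _ ch).
have [z Sz hz] := h1 v (ex_intro2 _ _ x Vx erefl).
have lz l : lp (p l) (z l) by exact: SX.
(* The splitting of S enters here: a component of a vector of S, put back in its place, lies in
   S. *)
have Se : S (embed i (z i)) by move: Sz; rewrite {1}SE => /(_ i).
have hvz : nlp (p i) (v i - z i) <= et * A * snorm p x.
  apply: le_trans (nlp_le_snorm p (v - z) i) _; apply: le_trans (near _ _ hz) _.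
  by rewrite -mulrA ler_wpM2l//; exact: sgraph.
have [_ [x' Vx' <-] hv'] := h2 _ Se.
have {hv'} := near _ _ hv'; rewrite (snorm_embed p1) => hv'.
pose v' := x' + app Phi x'.
have lv' l : lp (p l) (v' l).
  by apply: lpD => //; [exact: V0_Xspace|exact: app_Xspace].
have zi : nlp (p i) (z i) <= A' * snorm p x.
  rewrite -[z i](subrK (v i)) -[z i - v i]opprB.
  apply: le_trans (nlpD (p1 i) (lpN (p1 i) (lpB (p1 i) lvi (lz i))) lvi) _.
  rewrite nlpN//; apply: (@le_trans _ _ (et * A * snorm p x + A * snorm p x)).
    by rewrite lerD//; apply: le_trans (nlp_le_snorm p v i) _; exact: sgraph.
  rewrite -mulrDl ler_wpM2r ?snorm_ge0// /A' [leRHS]mulrDr mulr1 addrC lerD2l.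
  by rewrite mulrC ler_wpM2l// /et mulrC ler_wpM2r ?exprn_ge0.
(* v i has no component in W_i, and v' is near embed i (z i), hence near v at i. *)
have sx' : snorm p x' <= K * (et * A * snorm p x + et * nlp (p i) (z i)).
  have err : \sum_l nlp (p l) (embed i (z i) l - v' l) <= et * nlp (p i) (z i).
    exact: hv'.
  apply: (@le_trans _ _ (K * (\sum_l (nlp (p l) (embed i (z i) l - v' l) +
      (if l == i then nlp (p i) (v i - z i) else 0))))).
    rewrite /snorm mulr_sumr; apply: ler_sum => l _.
    have [->|li] := eqVneq l i.
      have -> : embed i (z i) i = z i by rewrite /embed eqxx.
      have Wd : Wc ch i (app Phi x' i - v i).
        by apply: subspaceB => //; [exact: Wc_subspace|exact: lp_app].
      apply: le_trans (chK.1 i _ _ (Vx' i) Wd) _; rewrite ler_wpM2l//.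
      have -> : x' i + (app Phi x' i - v i) = (v' i - z i) + (z i - v i).
        by rewrite [LHS]addrA [RHS]addrA [in RHS]subrK.
      apply: le_trans (nlpD (p1 i) (lpB (p1 i) (lv' i) (lz i))
        (lpB (p1 i) (lz i) lvi)) _.
      by rewrite nlpB// [X in _ + X <= _]nlpB.
    rewrite addr0 /embed (negbTE li) sub0r nlpN//; apply: chK.1 => //.
    exact: lp_app.
  rewrite ler_wpM2l// big_split /= addrC lerD//.
  by rewrite (bigD1 i)//= eqxx big1 ?addr0// => l /negbTE ->.
have sx'2 : snorm p x' <= K * (et * (A + A') * snorm p x).
  apply: le_trans sx' _; rewrite ler_wpM2l// [et * (A + A')]mulrDr mulrDl lerD2l.
  by rewrite -[leRHS]mulrA ler_wpM2l.
have zi2 : nlp (p i) (z i) <= et * (A' + A * K * (A + A')) * snorm p x.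
  have -> : z i = v' i + (z i - v' i) by rewrite addrC subrK.
  apply: le_trans (nlpD (p1 i) (lv' i) (lpB (p1 i) (lz i) (lv' i))) _.
  have b1 : nlp (p i) (v' i) <= A * (K * (et * (A + A') * snorm p x)).
    apply: le_trans (nlp_le_snorm p v' i) _; apply: le_trans (sgraph _ Vx') _.
    by rewrite ler_wpM2l.
  have b2 : nlp (p i) (z i - v' i) <= et * (A' * snorm p x).
    apply: (@le_trans _ _ (et * nlp (p i) (z i))); last by rewrite ler_wpM2l.
    apply: le_trans hv'; have := nlp_le_snorm p (embed i (z i) - v') i.
    by rewrite [X in nlp _ X]/(embed i (z i) i - v' i) {1}/embed eqxx.
  apply: le_trans (lerD b1 b2) _; apply: ler_eq; ring.
rewrite -vi -sx -[v i](subrK (z i)).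
apply: le_trans (nlpD (p1 i) (lpB (p1 i) lvi (lz i)) (lz i)) _.
by apply: le_trans (lerD hvz zi2) _; apply: ler_eq; rewrite /gap_const /et; ring.
Qed.

Lemma gap_const_ge0 : 0 <= gap_const.
Proof.
have A0 : 0 <= A by rewrite addr_ge0// !mulr_ge0 ?exprn_ge0.
have A'0 : 0 <= A' by rewrite mulr_ge0// addr_ge0// mulr_ge0// exprn_ge0.
by rewrite mulr_ge0 ?exprn_ge0// !addr_ge0// !mulr_ge0// addr_ge0.
Qed.

Lemma opnorm_off_le_dist :
  opnorm ch N (off_part Phi) <=
  kap ^+ 2 * m%:R * gap_const * dist p N (graph ch Phi) (stratum p nn).
Proof.
set d := dist p N _ _; have d0 : 0 <= d by exact: dist_ge0.
have T := truncation_stratum.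
have d1 : d <= 1.
  apply: le_trans (@dist_le _ _ _ _ N_abs _ _ _ T) _; apply: gap_le1.
    by case: graph_subspace.
  by case: T => -[].
rewrite -[leRHS]mulrA; apply: (opnorm_le_entries p1 kap1 kapP).
- exact: chart_op_off.
- by rewrite mulr_ge0// gap_const_ge0.
move=> i j y Wy; rewrite /off_part; case: eqVneq => [_|ij].
  rewrite [X in X <= _]nlp0//; apply: mulr_ge0 (nlp_ge0 _ _).
  by apply: mulr_ge0 => //; exact: gap_const_ge0.
apply/ler_addgt0Pr => e epos.
pose c := gap_const * nlp (p j) y.
have c0 : 0 <= c by rewrite mulr_ge0 ?nlp_ge0// gap_const_ge0.
(* The infimum defining the distance need not be attained. The excess e' costs at most e in the
   estimate, and e' <= 1 together with d <= 1 keeps [eta] within 2. *)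
pose e' := Num.min 1 (e / (c + 1)).
have c1 : 0 < c + 1 by rewrite ltr_wpDl.
have e'0 : 0 < e' by rewrite lt_min ltr01 divr_gt0.
have [||S SS hS] := @dist_lt R m p N (graph ch Phi) (stratum p nn) (d + e').
- by exists (truncation ch Phi).
- by rewrite ltrDl.
have e'1 : e' <= 1 by rewrite ge_min lexx.
have := @off_entry_le_gap S (d + e') SS _ _ hS i j y ij Wy.
move=> /(_ _ _)/le_trans; apply.
- by rewrite addr_ge0// ltW.
- by lra.
rewrite mulrDr mulrDl lerD2l mulrAC -/c.
apply: (@le_trans _ _ (c * (e / (c + 1)))).
  by rewrite ler_wpM2l// ge_min lexx orbT.
by rewrite mulrA ler_pdivrMr// mulrC ler_wpM2l ?(ltW epos)// lerDl.
Qed.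

End GapComparison.

Lemma nlp_abs (R : realType) (q : R) (x : cseq R) :
  lpnorm q (fun k => (nc (x k))%:C%C : R[i]^o) = lpnorm q x.
Proof.
congr (poweR _ _); apply: eq_esum => k _.
by rewrite nc_real ger0_norm ?nc_ge0.
Qed.

(** * Norms of blocks *)

Section BlockUpperBound.
Variables (R : realType) (m n : nat) (p : 'I_m -> R) (nn : 'I_m -> nat).
Hypothesis p1 : forall i, 1 <= p i.
Hypothesis nn_sum : (\sum_i nn i = n)%N.
Variables (ch : chart p nn n) (sg : 'I_n -> 'I_m) (w : 'I_n -> cseq R).
Variable th : 'I_n -> cseq R -> R[i]^o.
Hypothesis fr : frame ch sg w th.
Variables (Phi : blockop R m) (b e E : R).
Hypothesis hPhi : chart_op ch Phi.
Hypotheses (b0 : 0 <= b) (e0 : 0 <= e) (E1 : 1 <= E) (eE : e <= E).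
Hypothesis hdiag : forall i y, W ch i y ->
  nlp (p i) (Phi i i y) <= b * nlp (p i) y.
Hypothesis hoff : forall i j y, i != j -> W ch j y ->
  nlp (p i) (Phi i j y) <= e * nlp (p j) y.

Let f s i : cseq R := fun k => frame_entry sg w Phi s (i, k).
(** Rows are divided by their size e in foreign components, so that one profile [g i] dominates all
    rows, up to a factor e for each mismatch. For e = 0 the inverse is 0, and the foreign entries
    vanish as well. *)
Let gam s i : R := if sg s == i then 1 else e^-1.
Let g i k : R := \sum_s gam s i * nc (f s i k).

Let gam0 s i : 0 <= gam s i.
Proof. by rewrite /gam; case: ifP => _ //; rewrite invr_ge0. Qed.

Let lp_w s : lp (p (sg s)) (w s).
Proof. by apply: (@W_sub _ _ _ _ _ ch); exact: frame_W fr s. Qed.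

Let lp_Phi i s : lp (p i) (Phi i (sg s) (w s)).
Proof.
apply: (@Wc_sub _ _ _ _ _ ch); apply: (hPhi i (sg s)).2; exact: frame_W fr s.
Qed.

Let f_eq s : f s (sg s) = w s + Phi (sg s) (sg s) (w s).
Proof. by apply: funext => k; rewrite /f /frame_entry /= eqxx. Qed.

Let f_neq s i : sg s != i -> f s i = Phi i (sg s) (w s).
Proof.
move=> si; apply: funext => k; rewrite /f /frame_entry /= (negbTE si).
exact: add0r.
Qed.

Let lp_f s i : lp (p i) (f s i).
Proof.
have [<-|si] := eqVneq (sg s) i; last by rewrite f_neq.
by rewrite f_eq; apply: lpD.
Qed.

Let nlp_f_eq s : nlp (p (sg s)) (f s (sg s)) <= 1 + b.
Proof.
rewrite f_eq; apply: le_trans (nlpD (p1 _) (lp_w s) (lp_Phi _ _)) _.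
have h := frame_le1 fr s; apply: lerD => //.
apply: le_trans (hdiag (frame_W fr s)) _; by rewrite ler_piMr.
Qed.

Let nlp_f_neq s i : sg s != i -> nlp (p i) (f s i) <= e.
Proof.
move=> si; rewrite f_neq//; apply: le_trans (hoff _ (frame_W fr s)) _.
  by rewrite eq_sym.
by rewrite ler_piMr//; exact: frame_le1 fr s.
Qed.

Let term_le s i k : nc (f s i k) <= (if sg s == i then 1 else e) * g i k.
Proof.
have g_ge : gam s i * nc (f s i k) <= g i k.
  rewrite /g (bigD1 s)//= lerDl sumr_ge0// => t _.
  by rewrite mulr_ge0 ?nc_ge0.
have [si|si] := eqVneq (sg s) i.
  by rewrite mul1r (le_trans _ g_ge)// /gam si eqxx mul1r.
have [ez|en0] := eqVneq e 0.
  have := nlp_f_neq si; rewrite ez => h; rewrite mul0r.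
  exact: le_trans (nlp_coord (p1 i) k (lp_f s i)) h.
apply: le_trans (ler_wpM2l e0 g_ge); rewrite /gam (negbTE si) mulrA mulfV//.
by rewrite mul1r.
Qed.

Let g_ge0 i k : 0 <= g i k.
Proof. by apply: sumr_ge0 => s _; rewrite mulr_ge0 ?nc_ge0. Qed.

Definition profile_const : R := n%:R * (1 + b).

Lemma profile_const_ge0 : 0 <= profile_const.
Proof. by rewrite mulr_ge0// addr_ge0. Qed.

Let esum_g i :
  (\esum_(k in [set: nat]) (g i k `^ p i)%:E <= (profile_const `^ p i)%:E)%E.
Proof.
pose absf s : cseq R := fun k => (nc (f s i k))%:C%C.
have lp_abs s : lp (p i) (absf s) by rewrite /lp /= nlp_abs; exact: lp_f.
pose G : cseq R := \sum_s (gam s i)%:C%C *: absf s.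
have lG : lp (p i) G by apply: lp_sum => // s _; exact: lpZ.
have GE k : nc (G k) = g i k.
  have -> : G k = (g i k)%:C%C.
    rewrite /G fct_sumE /g rmorph_sum; apply: eq_bigr => s _.
    by rewrite rmorphM.
  by rewrite nc_real ger0_norm.
under eq_esum do rewrite -GE.
rewrite lpnorm_pow// lp_nlp// poweR_EFin lee_fin ge0_ler_powR//.
- by rewrite (le_trans _ (p1 i)).
- by rewrite nnegrE nlp_ge0.
- by rewrite nnegrE profile_const_ge0.
apply: (nlp_sum_le (p1 i)) => [s _|]; first exact: lpZ.
rewrite /profile_const mulr_natl -[n in _ *+ n]card_ord -sumr_const.
apply: ler_sum => s _; rewrite nlpZ// nc_real ger0_norm//.
have -> : nlp (p i) (absf s) = nlp (p i) (f s i) by rewrite /nlp nlp_abs.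
rewrite /gam; have [si|si] := eqVneq (sg s) i.
  by rewrite mul1r -si.
have [ez|en0] := eqVneq e 0; first by rewrite ez invr0 mul0r addr_ge0.
apply: (@le_trans _ _ 1); last by rewrite lerDl.
rewrite mulrC ler_pdivrMr ?mul1r; first exact: nlp_f_neq.
by rewrite lt_neqAle eq_sym en0.
Qed.

Lemma plucker_le delta I : \sum_i delta i = 0 -> has_type (shift nn delta) I ->
  nc (plucker (graph_basis ch Phi) I) <=
  nc (\det (bas_coef ch sg th)) * (n`!%:R * E ^+ n * e ^+ half_l1 delta) *
    \prod_l \prod_(k <- enum_fset (I l)) g l k.
Proof.
move=> d0 hI; have [pt ptE dE] := index_tuple nn_sum (frame_fiber fr) d0 hI.
rewrite (plucker_graph fr _ hPhi) Normc.normcM -mulrA ler_wpM2l ?nc_ge0//.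
rewrite (plucker_tuple _ ptE); apply: le_trans (nc_sum _ _ _) _.
have -> : \prod_l \prod_(k <- enum_fset (I l)) g l k =
    \prod_s g (tnth pt s).1 (tnth pt s).2.
  transitivity (\prod_(a <- points I) g a.1 a.2).
    by rewrite (perm_big _ (perm_points I)) big_allpairs_dep big_enum.
  by rewrite ptE big_tuple.
set P := \prod_s _.
have P0 : 0 <= P by apply: prodr_ge0.
have -> : n`!%:R * E ^+ n * e ^+ half_l1 delta * P =
    \sum_(s : 'S_n) E ^+ n * e ^+ half_l1 delta * P.
  by rewrite sumr_const card_Sn -!mulrA mulr_natl.
apply: ler_sum => s _; rewrite Normc.normcM nc_sign mul1r nc_prod.
pose ms := mismatches sg ((fun r => (tnth pt r).1) \o s).
apply: (@le_trans _ _ (e ^+ #|ms| * P)).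
  have -> : e ^+ #|ms| * P = \prod_r ((if sg r == (tnth pt (s r)).1 then 1 else e) *
      g (tnth pt (s r)).1 (tnth pt (s r)).2).
    rewrite big_split /= -prodr_const; congr (_ * _).
      by rewrite big_mkcond; apply: eq_bigr => r _; rewrite finset.inE /=; case: eqP.
    by rewrite /P (reindex_inj (@perm_inj _ s)).
  apply: ler_prod => r _; rewrite nc_ge0 mxE /=.
  rewrite (frame_graphE fr _ _ _ hPhi).
  have := term_le r (tnth pt (s r)).1 (tnth pt (s r)).2.
  by rewrite /f /frame_entry -surjective_pairing.
rewrite ler_wpM2r//.
(* Mismatches beyond the least number contribute further powers of e, which may exceed 1; they are
   absorbed into the power of E. *)
have hms : (half_l1 delta <= #|ms|)%N by apply: half_l1_le_mis.
have msn : (#|ms| - half_l1 delta <= n)%N.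
  by rewrite (leq_trans (leq_subr _ _))// -[X in (_ <= X)%N]card_ord max_card.
rewrite -(subnK hms) exprD ler_wpM2r ?exprn_ge0//.
apply: (@le_trans _ _ (E ^+ (#|ms| - half_l1 delta))).
  by rewrite lerXn2r ?nnegrE// (le_trans e0).
by rewrite ler_weXn2l.
Qed.

Lemma block_upper ord delta : perm_eq ord (enum 'I_m) -> \sum_i delta i = 0 ->
  (block_norm p ord (shift nn delta) (graph_basis ch Phi) <=
    (nc (\det (bas_coef ch sg th)) * (n`!%:R * E ^+ n * e ^+ half_l1 delta) *
       profile_const ^+ n)%:E)%E.
Proof.
move=> po d0; set M := _ * (_ * e ^+ _).
have E0 : 0 <= E by exact: le_trans E1.
have M0 : 0 <= M by rewrite !mulr_ge0 ?nc_ge0 ?exprn_ge0.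
have nc0' I : (0 <= (nc (plucker (graph_basis ch Phi) I))%:E)%E.
  by rewrite lee_fin nc_ge0.
have [dn|/existsNP[i /negP di]] := pselect (forall i, 0 <= shift nn delta i); last first.
  apply: le_trans (mixed_norm_prod_bound p1 g_ge0 profile_const_ge0 (lexx 0)
    esum_g nc0' _ po) _ => [I hI|].
    by move: di; rewrite -(hI i).
  by rewrite mul0r lee_fin mulr_ge0// exprn_ge0// profile_const_ge0.
apply: le_trans (mixed_norm_prod_bound p1 g_ge0 profile_const_ge0 M0
  esum_g nc0' _ po) _ => [I hI|].
  by rewrite lee_fin; exact: plucker_le.
rewrite lee_fin; apply: ler_eq; congr (_ * _ ^+ _).
apply/eqP; rewrite -eqz_nat (big_morph _ PoszD (erefl 0%:Z)).
under eq_bigr do rewrite gez0_abs//.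
by rewrite /shift big_split /= d0 addr0 -nn_sum (big_morph _ PoszD (erefl 0%:Z)).
Qed.

End BlockUpperBound.

(** No index set has such a type, so the product bound holds with constant 0. *)
Lemma block_norm_negative (R : realType) m n (p : 'I_m -> R) ord (a : 'I_m -> int)
    (v : 'I_n -> mseq R m) : (forall i, 1 <= p i) -> perm_eq ord (enum 'I_m) ->
  (exists i, a i < 0) -> (block_norm p ord a v <= 0)%E.
Proof.
move=> p1 po [i ai].
have h := @mixed_norm_prod_bound R m p p1 (fun _ _ => 0) 0 0 a
  (fun I => (nc (plucker v I))%:E).
apply: le_trans (h _ _ _ _ _ _ ord po) _ => //.
- move=> l; rewrite esum1 ?lee_fin ?powR_ge0// => k _.
  by rewrite powR0 ?gt_eqF ?(lt_le_trans _ (p1 l)).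
- by move=> I; rewrite lee_fin nc_ge0.
- by move=> I hI; move: ai; rewrite -(hI i).
Qed.

Section BlockLowerBound.
Variables (R : realType) (m n : nat) (p : 'I_m -> R) (N : 'rV[R]_m -> R).
Variable nn : 'I_m -> nat.
Hypothesis p1 : forall i, 1 <= p i.
Variables (ch : chart p nn n) (sg : 'I_n -> 'I_m) (w : 'I_n -> cseq R).
Variable th : 'I_n -> cseq R -> R[i]^o.
Hypothesis fr : frame ch sg w th.
Variables (K : R) (Phi : blockop R m) (ord : seq 'I_m).
Hypothesis K1 : 1 <= K.
Hypothesis chK : chart_bound ch N K.
Hypothesis hPhi : chart_op ch Phi.
Hypothesis po : perm_eq ord (enum 'I_m).

Let K0 : 0 <= K. Proof. exact: le_trans K1. Qed.
Let B1 : 1 <= 2 * K. Proof. by move: K1; lra. Qed.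

Lemma graph_basis_Xspace r : Xspace p (graph_basis ch Phi r).
Proof.
move=> i; apply: lpD => //.
  apply: (@W_sub _ _ _ _ _ ch); exact: V0_bas.
by apply: (@Wc_sub _ _ _ _ _ ch); apply: lp_app => //; exact: V0_bas.
Qed.

Lemma functional_addWc s y u : lp (p (sg s)) y -> Wc ch (sg s) u ->
  th s (y + u) = th s y.
Proof.
move=> ly Wu; have lu := @Wc_sub _ _ _ _ _ ch _ u Wu.
have := @frame_lin _ _ _ _ _ _ _ _ _ fr s 1 y u ly lu.
rewrite !scale1r => ->; rewrite (frame_Wc fr Wu); exact: addr0.
Qed.

(** The 2 bounds the functional on W_i, and K bounds the projection onto W_i along W_i^c. *)
Lemma functional_le s x : lp (p (sg s)) x ->
  nc (th s x) <= 2 * K * nlp (p (sg s)) x.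
Proof.
move=> lx; have [y [u [Wy Wu ->]]] := @W_Wc_sum _ _ _ _ _ ch _ x lx.
have ly : lp (p (sg s)) y by exact: (@W_sub _ _ _ _ _ ch).
rewrite functional_addWc//; apply: le_trans (frame_le fr Wy) _.
rewrite -mulrA ler_wpM2l//.
exact: chK.1.
Qed.

Definition contraction_const : R := \prod_l elim_const n p (2 * K) l.

Lemma contraction_const_ge0 : 0 <= contraction_const.
Proof. by apply: prodr_ge0 => l _; exact: elim_const_ge0. Qed.

(** The functionals vanish on the complements and do not see Phi, so the contraction of the pivot
    block is the same determinant for every Phi. *)
Lemma pivot_lower : ((nc (\det (bas_coef ch sg th)))%:E <=
  contraction_const%:E * pivot_norm p ord nn (graph_basis ch Phi))%E.
Proof.
have := contraction (v := graph_basis ch Phi) p1 graph_basis_Xspace (cs := sg)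
  (th := th) B1 (fun s => frame_lin (s := s) fr) functional_le po.
rewrite -/contraction_const.
have -> : (fun l => (size (functionals_at sg l))%:Z) = (fun i => (nn i)%:Z).
  by apply: funext => l; rewrite /functionals_at (frame_fiber fr).
have -> // : \matrix_(r, s) th s (graph_basis ch Phi r (sg s)) = bas_coef ch sg th.
apply/matrixP => r s; rewrite !mxE /graph_basis.
have Vr := V0_bas ch r.
rewrite [_ (sg s)]/(bas ch r (sg s) + app Phi (bas ch r) (sg s)).
rewrite functional_addWc//; last exact: lp_app.
by apply: (@W_sub _ _ _ _ _ ch); exact: Vr.
Qed.

Lemma size_fiber_sum (c : 'I_n -> 'I_m) l :
  (size (functionals_at c l))%:Z = \sum_t (c t == l)%:Z.
Proof.
rewrite /functionals_at size_filter -sum1_count (big_morph _ PoszD (erefl 0%:Z)).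
by rewrite big_mkcond big_enum /=; apply: eq_bigr => t _; case: ifP.
Qed.

(** Replacing the functional at s0 by F on component i changes the type by the unit exchange. The
    contracted matrix is [bas_coef] times the identity with one column replaced, and the diagonal
    entry of that column is F at the entry of Phi. *)
Lemma exchange_lower i s0 F : i != sg s0 -> slinear F ->
  (forall y, lp (p i) y -> nc (F y) <= nlp (p i) y) ->
  ((nc (\det (bas_coef ch sg th)) * nc (F (Phi i (sg s0) (w s0))))%:E <=
  contraction_const%:E *
    block_norm p ord (shift nn (unit_exchange i (sg s0))) (graph_basis ch Phi))%E.
Proof.
move=> ij Flin Fle.
pose cs s := if s == s0 then i else sg s.
pose th' s : cseq R -> R[i]^o := if s == s0 then F else th s.
have hlin s : linear_on (lp (p (cs s))) (th' s).
  rewrite /cs /th'; case: eqP => _; last exact: (frame_lin (s := s) fr).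
  by move=> a x y _ _; exact: Flin.
have hle s x : lp (p (cs s)) x -> nc (th' s x) <= 2 * K * nlp (p (cs s)) x.
  rewrite /cs /th'; case: eqP => _ lx; last exact: functional_le.
  by apply: le_trans (Fle x lx) _; rewrite ler_peMl ?nlp_ge0.
have := contraction p1 graph_basis_Xspace B1 hlin hle po.
rewrite -/contraction_const.
have -> : (fun l => (size (functionals_at cs l))%:Z) = shift nn (unit_exchange i (sg s0)).
  apply: funext => l; rewrite /shift /unit_exchange -(frame_fiber fr l).
  rewrite -/(functionals_at sg l) !size_fiber_sum (bigD1 s0)//= {1}/cs eqxx.
  rewrite [in RHS](bigD1 s0)//= [i == l]eq_sym [sg s0 == l]eq_sym.
  rewrite (eq_bigr (fun t => (sg t == l)%:Z)) => [|t /negbTE ts]; last by rewrite /cs ts.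
  by move: (\sum_(t | _) _) => z; lia.
pose M : 'M[R[i]]_n := \matrix_(t, s)
  if s == s0 then (F (frame_graph sg w Phi t i) : R[i]) else (s == t)%:R.
have -> : \matrix_(r, s) th' s (graph_basis ch Phi r (cs s)) = bas_coef ch sg th *m M.
  apply/matrixP => r s; rewrite !mxE /th' /cs.
  have gE l : graph_basis ch Phi r l =
      \sum_t bas_coef ch sg th r t *: frame_graph sg w Phi t l.
    by rewrite (graph_basis_expand fr _ hPhi) fct_sumE.
  rewrite gE; case: (s =P s0) => [ss|ss].
    have F0 : linear_on (@setT (cseq R)) (F : cseq R -> R[i]^o).
      by move=> a x y _ _; exact: Flin.
    rewrite (linear_on_sum _ _ _ F0)//.
    by apply: eq_bigr => t _; rewrite [X in _ = _ * X]mxE ss eqxx.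
  have lfg t : lp (p (sg s)) (frame_graph sg w Phi t (sg s)).
    apply: lpD => //; first by apply: (@W_sub _ _ _ _ _ ch); exact: (V0_frame fr).
    by apply: (@Wc_sub _ _ _ _ _ ch); apply: lp_app => //; exact: (V0_frame fr).
  rewrite (linear_on_sum _ _ (lp_subspace (p1 (sg s))) (frame_lin (s := s) fr))//.
  apply: eq_bigr => t _; rewrite [X in _ = _ * X]mxE (negbTE (introN eqP ss)).
  congr (_ * _); rewrite /frame_graph.
  rewrite [_ (sg s)]/(frame_vec sg w t (sg s) + app Phi (frame_vec sg w t) (sg s)).
  rewrite functional_addWc; last 2 first.
  - by apply: (@W_sub _ _ _ _ _ ch); exact: (V0_frame fr).
  - by apply: lp_app => //; exact: (V0_frame fr).
  rewrite /frame_vec /embed.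
  case: (sg s =P sg t) => [e|ne].
    by rewrite (frame_dual fr) ?e// eq_sym.
  rewrite (linear_on0 (lp_subspace (p1 (sg s))) (frame_lin (s := s) fr)).
  by have -> : (s == t) = false by apply/eqP => st; apply: ne; rewrite st.
have detM : \det M = F (Phi i (sg s0) (w s0)).
  rewrite -det_tr.
  have -> : M^T = \matrix_(s, t) if s == s0 then (F (frame_graph sg w Phi t i) : R[i])
      else (s == t)%:R.
    by apply/matrixP => s t; rewrite !mxE.
  rewrite det_replace_row; congr F; apply: funext => k.
  rewrite (frame_graphE fr _ _ _ hPhi) eq_sym (negbTE ij).
  exact: add0r.
by rewrite det_mulmx Normc.normcM detM.
Qed.

End BlockLowerBound.

(** * Comparison of block norms with the off-diagonal part *)

Section Comparisons.
Variables (R : realType) (m n : nat) (p : 'I_m -> R) (N : 'rV[R]_m -> R).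
Variables (nn : 'I_m -> nat) (ord : seq 'I_m).
Hypothesis p1 : forall i, 1 <= p i.
Hypothesis N_abs : absolute_norm N.
Hypothesis nn_sum : (\sum_i nn i = n)%N.
Hypothesis po : perm_eq ord (enum 'I_m).
Variable kap : R.
Hypothesis kap1 : 1 <= kap.
Hypothesis kapP : forall x : mseq R m,
  snorm p x <= kap * Xnorm p N x /\ Xnorm p N x <= kap * snorm p x.
Variable K : R.
Hypothesis K1 : 1 <= K.

Let kap0 : 0 <= kap. Proof. exact: le_trans kap1. Qed.
Let K0 : 0 <= K. Proof. exact: le_trans K1. Qed.

(** None of these constants refers to the chart, which enters only through its size K. [entry_const]
    bounds the entries of Phi, [off_const] bounds [kap ^+ 2] times the norm of Phi_off, and 2 * kap
    * K in [det_const] bounds the entries of [bas_coef]. *)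
Definition entry_const : R := kap ^+ 2 * K.
Definition off_const : R := kap ^+ 2 * (kap ^+ 2 * m%:R * entry_const).
Definition upper_const : R :=
  n`!%:R * (1 + off_const) ^+ n * profile_const n entry_const ^+ n.
Definition det_const : R := n`!%:R * (2 * kap * K) ^+ n.
Definition lower_const : R := contraction_const n p K.
Definition ratio_const : R := n%:R * (2 * (lower_const * upper_const)).

Let entry0 : 0 <= entry_const. Proof. by rewrite mulr_ge0 ?exprn_ge0. Qed.
Let off0 : 0 <= off_const. Proof. by rewrite !mulr_ge0 ?exprn_ge0. Qed.
Lemma upper_const_ge0 : 0 <= upper_const.
Proof. by rewrite !mulr_ge0 ?exprn_ge0 ?addr_ge0 ?profile_const_ge0. Qed.
Let upper0 := upper_const_ge0.
Let lower0 : 0 <= lower_const. Proof. exact: contraction_const_ge0. Qed.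

Lemma ratio_const_ge0 : 0 <= ratio_const.
Proof. by apply: mulr_ge0 => //; apply: mulr_ge0 => //; apply: mulr_ge0. Qed.

Lemma det_const_ge0 : 0 <= det_const.
Proof.
apply: mulr_ge0 => //; apply: exprn_ge0; apply: mulr_ge0 => //.
exact: mulr_ge0.
Qed.

Let ratio_const0 := ratio_const_ge0.

Variables (ch : chart p nn n) (Phi : blockop R m).
Hypothesis chK : chart_bound ch N K.
Hypothesis hPhi : chart_op ch Phi.
Hypothesis PhiK : opnorm ch N Phi <= K.

Variables (sg : 'I_n -> 'I_m) (w : 'I_n -> cseq R).
Variable th : 'I_n -> cseq R -> R[i]^o.
Hypothesis fr : frame ch sg w th.

(** The factor common to all blocks. It is at most [lower_const] times the pivot norm, which is at
    most [upper_const] times D, so it cancels from the ratios. *)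
Let D : R := nc (\det (bas_coef ch sg th)).
Let off : R := opnorm ch N (off_part Phi).
Let beta delta : \bar R := block_norm p ord (shift nn delta) (graph_basis ch Phi).
Let piv : \bar R := pivot_norm p ord nn (graph_basis ch Phi).
Let ratio : R := max_ratio p ord nn (graph_basis ch Phi).

Let D_gt0 : 0 < D.
Proof.
by rewrite /D nc_gt0; have := bas_coef_unit p1 fr; rewrite unitmxE unitfE.
Qed.

Let offN0 : 0 <= off. Proof. exact: opnorm_ge0. Qed.

Let entries i j y : W ch j y -> nlp (p i) (Phi i j y) <= entry_const * nlp (p j) y.
Proof. exact: (entry_le p1 N_abs nn_sum kap1 kapP hPhi PhiK). Qed.

Let off_entries i j y : i != j -> W ch j y ->
  nlp (p i) (Phi i j y) <= kap ^+ 2 * off * nlp (p j) y.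
Proof.
move=> ij Wy; have hoff := chart_op_off hPhi.
have := entry_le p1 N_abs nn_sum kap1 kapP hoff (lexx _) i Wy.
by rewrite /off_part (negbTE ij).
Qed.

Let off_le : kap ^+ 2 * off <= off_const.
Proof.
rewrite /off_const ler_wpM2l ?exprn_ge0//.
apply: (opnorm_le_entries p1 kap1 kapP) => //; first exact: chart_op_off.
move=> i j y Wy; rewrite /off_part; case: eqP => _; last exact: entries.
by rewrite [X in X <= _]nlp0// mulr_ge0// nlp_ge0.
Qed.

Lemma block_le_off delta : \sum_i delta i = 0 ->
  (beta delta <= (D * upper_const * (kap ^+ 2 * off) ^+ half_l1 delta)%:E)%E.
Proof.
move=> d0; have e0 : 0 <= kap ^+ 2 * off by rewrite mulr_ge0 ?exprn_ge0.
have E1 : 1 <= 1 + off_const by rewrite lerDl.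
have eE : kap ^+ 2 * off <= 1 + off_const.
  by rewrite (le_trans off_le)// lerDr.
apply: le_trans (block_upper p1 nn_sum fr hPhi entry0 e0 E1 eE
  (fun i y => @entries i i y) off_entries po d0) _.
by rewrite lee_fin; apply: ler_eq; rewrite /upper_const /D; ring.
Qed.

Let beta_ge0 delta : (0 <= beta delta)%E.
Proof. by apply: mixed_norm_ge0 => I; rewrite lee_fin nc_ge0. Qed.

Let beta_fin delta : \sum_i delta i = 0 -> beta delta \is a fin_num.
Proof.
move=> d0; rewrite ge0_fin_numE//; apply: le_lt_trans (block_le_off d0) _.
exact: ltry.
Qed.

Let pivE : piv = beta (fun=> 0).
Proof.
rewrite /piv /beta /pivot_norm; congr block_norm; apply: funext => i.
by rewrite /shift addr0.
Qed.

Let sum0 : \sum_(i < m) (0 : int) = 0. Proof. by rewrite big1. Qed.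

Let piv_fin : piv \is a fin_num. Proof. by rewrite pivE beta_fin. Qed.

Let D_le_piv : D <= lower_const * fine piv.
Proof.
rewrite -lee_fin EFinM fineK//.
exact: (pivot_lower p1 fr K1 chK hPhi po).
Qed.

Let piv_gt0 : 0 < fine piv.
Proof.
rewrite ltNge; apply/negP => h; have := lt_le_trans D_gt0 D_le_piv.
by rewrite ltNge mulr_ge0_le0.
Qed.

Let piv_le : fine piv <= D * upper_const.
Proof.
rewrite -lee_fin fineK// pivE; apply: le_trans (block_le_off sum0) _.
by rewrite /half_l1 big1 ?expr0 ?mulr1.
Qed.

Let ratio_ge i j : i != j ->
  fine (beta (unit_exchange i j)) / fine piv <= ratio.
Proof.
move=> ij; rewrite /ratio /max_ratio.
exact: (le_bigmax_cond 0 (fun ij : 'I_m * 'I_m =>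
  fine (beta (unit_exchange ij.1 ij.2)) / fine piv) (j := (i, j))) ij.
Qed.

Let ratio_ge0 : 0 <= ratio.
Proof. by apply: bigmax_ge_id. Qed.

Lemma ratio_le_off : ratio <= upper_const * lower_const * kap ^+ 2 * off.
Proof.
have rhs0 : 0 <= upper_const * lower_const * kap ^+ 2 * off.
  by rewrite 3?mulr_ge0 ?exprn_ge0.
apply: bigmax_le => // -[i j] /= ij; rewrite ler_pdivrMr//.
have d0 := sum_unit_exchange i j.
have : fine (beta (unit_exchange i j)) <= D * upper_const * (kap ^+ 2 * off).
  rewrite -lee_fin fineK ?beta_fin//; apply: le_trans (block_le_off d0) _.
  by rewrite half_l1_unit.
move=> /le_trans; apply.
have -> : upper_const * lower_const * kap ^+ 2 * off * fine piv =
    lower_const * fine piv * (upper_const * (kap ^+ 2 * off)) by ring.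
have u0 : 0 <= upper_const * (kap ^+ 2 * off).
  by apply: mulr_ge0 => //; apply: mulr_ge0 => //; apply: exprn_ge0.
by rewrite -mulrA; exact: ler_wpM2r u0 _ _ D_le_piv.
Qed.

(** Test by duality against F. The contraction bounds D |F(Phi_ij w)| by the exchange block, that is
    by the ratio times the pivot; as the pivot is at most a multiple of D, the factor D drops
    out. *)
Let frame_entry_le i s : i != sg s ->
  nlp (p i) (Phi i (sg s) (w s)) <= lower_const * upper_const * ratio.
Proof.
move=> ij; have d0 := sum_unit_exchange i (sg s).
apply: (@nlp_dual R (p i) (p1 i)).
- by apply: mulr_ge0 => //; apply: mulr_ge0.
- apply: (@Wc_sub _ _ _ _ _ ch); apply: (hPhi i (sg s)).2; exact: frame_W fr s.
move=> F Flin Fle.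
have h : D * nc (F (Phi i (sg s) (w s))) <=
    lower_const * fine (beta (unit_exchange i (sg s))).
  rewrite -lee_fin [X in (_ <= X)%E]EFinM fineK ?beta_fin//.
  exact: (exchange_lower p1 fr K1 chK hPhi po).
rewrite -(ler_pM2l D_gt0); apply: le_trans h _.
have r := ratio_ge ij; rewrite ler_pdivrMr// in r.
apply: le_trans (ler_wpM2l lower0 r) _.
have -> : D * (lower_const * upper_const * ratio) =
  lower_const * (ratio * (D * upper_const)) by ring.
exact: ler_wpM2l lower0 _ _ (ler_wpM2l ratio_ge0 piv_le).
Qed.

Lemma off_le_ratio : off <= kap ^+ 2 * m%:R * (ratio_const * ratio).
Proof.
apply: (opnorm_le_entries p1 kap1 kapP); first exact: chart_op_off.
  exact: mulr_ge0.
move=> i j y Wy; rewrite /off_part; case: eqVneq => [_|ij].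
  rewrite [X in X <= _]nlp0//; apply: mulr_ge0; last exact: nlp_ge0.
  exact: mulr_ge0.
have WS s : sg s == j -> W ch j (w s) by move=> /eqP <-; exact: frame_W fr s.
rewrite {1}(frame_expand fr Wy) (linear_on_sum _ _ (W_subspace ch j) (hPhi i j).1)//.
apply: (nlp_sum_le (p1 i)) => [s sj|].
  apply: lpZ => //; apply: (@Wc_sub _ _ _ _ _ ch); exact: (hPhi i j).2 _ (WS s sj).
apply: (@le_trans _ _ (\sum_(s < n)
    2 * (lower_const * upper_const) * ratio * nlp (p j) y)); last first.
  rewrite sumr_const card_ord -mulr_natl /ratio_const; apply: ler_eq; ring.
rewrite big_mkcond; apply: ler_sum => s _; case: eqP => [sj|_]; last first.
  apply: mulr_ge0; last exact: nlp_ge0.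
  by apply: mulr_ge0 => //; apply: mulr_ge0 => //; apply: mulr_ge0.
rewrite nlpZ//.
have h1 : nc (th s y) <= 2 * nlp (p j) y.
  by rewrite -sj; apply: (frame_le fr (s := s)); rewrite sj.
have h2 : nlp (p i) (Phi i j (w s)) <= lower_const * upper_const * ratio.
  by rewrite -sj; apply: frame_entry_le; rewrite sj.
apply: le_trans (ler_pM (nc_ge0 _) (nlp_ge0 _ _) h1 h2) _.
by apply: ler_eq; ring.
Qed.

Lemma det_le_const : D <= det_const.
Proof.
apply: det_le => r s; rewrite mxE.
apply: le_trans (frame_le fr (V0_bas ch r (sg s))) _.
rewrite -!mulrA ler_wpM2l//; apply: le_trans (nlp_le_snorm p _ _) _.
apply: le_trans (kapP _).1 _; rewrite ler_wpM2l//; exact: chK.2.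
Qed.

End Comparisons.

(** [half_l1 delta] is the number of mismatches of some matching of n indices. Bounding this
    exponent allows one constant for all delta. *)
Lemma half_l1_le_dim m n (nn : 'I_m -> nat) (sg : 'I_n -> 'I_m) delta :
  (\sum_i nn i = n)%N ->
  (forall i, size [seq t <- enum 'I_n | sg t == i] = nn i) ->
  \sum_i delta i = 0 -> (forall i, 0 <= shift nn delta i) ->
  (half_l1 delta <= n)%N.
Proof.
move=> nn_sum hf d0 dn; have [tau [_ <-]] := exists_type_matching nn_sum hf d0 dn.
by rewrite -[X in (_ <= X)%N]card_ord max_card.
Qed.

Lemma comparisons (R : realType) (m n : nat) (p : 'I_m -> R)
    (N : 'rV[R]_m -> R) (nn : 'I_m -> nat) (ord : seq 'I_m) (K : R) :
  (forall i, 1 <= p i) -> absolute_norm N -> (\sum_i nn i = n)%N ->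
  perm_eq ord (enum 'I_m) -> 1 <= K ->
  exists C : R, 0 < C /\
    forall (ch : chart p nn n) (Phi : blockop R m),
      chart_bound ch N K -> chart_op ch Phi -> opnorm ch N Phi <= K ->
      let V := graph ch Phi in
      let Sigma := stratum p nn in
      [/\ comparable_by C (dist p N V Sigma) (opnorm ch N (off_part Phi)),
          comparable_by C (opnorm ch N (off_part Phi))
            (max_ratio p ord nn (graph_basis ch Phi)),
          forall delta : 'I_m -> int, \sum_i delta i = 0 ->
            (block_norm p ord (shift nn delta) (graph_basis ch Phi)
             <= (C * dist p N V Sigma ^+ half_l1 delta)%R%:E)%E
        & Sigma (truncation ch Phi) /\
          gap p N V (truncation ch Phi) <= C * dist p N V Sigma].
Proof.
move=> p1 N_abs nn_sum po K1.
have [kap kap1 kapP] := norm_equiv p N_abs.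
have kap0 : 0 <= kap by exact: le_trans kap1.
have K0 : 0 <= K by exact: le_trans K1.
pose u := upper_const m n kap K; pose l := lower_const n p K.
pose g := kap ^+ 2 * m%:R * gap_const m kap K.
pose c1 := kap ^+ 2 * K; pose c2 := g.
pose c3 := kap ^+ 2 * m%:R * ratio_const n p kap K.
pose c4 := u * l * kap ^+ 2.
pose c5 := det_const n kap K * u * (1 + kap ^+ 2 * g) ^+ n.
pose c6 := c1 * g.
have k2 : 0 <= kap ^+ 2 by rewrite exprn_ge0.
have k2m : 0 <= kap ^+ 2 * m%:R by rewrite mulr_ge0.
have u0 : 0 <= u by exact: upper_const_ge0.
have l0 : 0 <= l by exact: contraction_const_ge0.
have g0 : 0 <= g by apply: mulr_ge0 => //; exact: gap_const_ge0.
have dc0 : 0 <= det_const n kap K by exact: det_const_ge0.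
have c10 : 0 <= c1 by apply: mulr_ge0.
have c30 : 0 <= c3 by apply: mulr_ge0 => //; exact: ratio_const_ge0.
have c40 : 0 <= c4 by apply: mulr_ge0 => //; apply: mulr_ge0.
have kg0 : 0 <= kap ^+ 2 * g by apply: mulr_ge0.
have kg1 : 0 <= (1 + kap ^+ 2 * g) ^+ n by rewrite exprn_ge0// addr_ge0.
have c50 : 0 <= c5 by apply: mulr_ge0 => //; apply: mulr_ge0.
have c60 : 0 <= c6 by apply: mulr_ge0.
(* A sum of nonnegative constants dominates each of them, so every clause may be proved with its
   own; the 1 makes it positive. *)
exists (1 + c1 + g + c3 + c4 + c5 + c6); split; first by lra.
set C := 1 + _ + _ + _ + _ + _ + _.
move=> ch Phi chK hPhi PhiK V Sigma.
have [sg [w [th fr]]] := frame_exists p1 nn_sum ch.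
set d := dist p N V Sigma; set off := opnorm ch N (off_part Phi).
have d0 : 0 <= d by exact: dist_ge0.
have off0 : 0 <= off by exact: opnorm_ge0.
have hT : Sigma (truncation ch Phi) by exact: truncation_stratum.
have hg : gap p N V (truncation ch Phi) <= c1 * off.
  exact: (gap_truncation_le p1 N_abs nn_sum kap1 kapP K1 chK hPhi).
have offd : off <= g * d.
  exact: (opnorm_off_le_dist p1 N_abs nn_sum kap1 kapP K1 chK hPhi PhiK).
have up x y cc : 0 <= y -> cc <= C -> x <= cc * y -> x <= C * y.
  by move=> y0 cC /le_trans; apply; exact: ler_wpM2r.
split.
- split; last by apply: (up _ _ g) => //; rewrite /C; lra.
  apply: (up _ _ c1) => //; first by rewrite /C; lra.
  apply: le_trans hg; exact: dist_le.
- have r0 : 0 <= max_ratio p ord nn (graph_basis ch Phi) by apply: bigmax_ge_id.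
  split.
    apply: (up _ _ c3) => //; first by rewrite /C; lra.
    rewrite /c3 -[X in _ <= X]mulrA.
    exact: (off_le_ratio p1 N_abs nn_sum po kap1 kapP K1 chK hPhi PhiK fr).
  apply: (up _ _ c4) => //; first by rewrite /C; lra.
  exact: (ratio_le_off p1 N_abs nn_sum po kap1 kapP K1 chK hPhi PhiK fr).
- move=> delta ds.
  (* With a negative entry the exponent [half_l1 delta] may exceed n, but then the block is zero. *)
  have [dn|/existsNP[i /negP di]] := pselect (forall i, 0 <= shift nn delta i); last first.
    apply: le_trans (block_norm_negative _ p1 po _) _.
      by exists i; rewrite ltNge.
    by rewrite lee_fin mulr_ge0 ?exprn_ge0// /C; lra.
  apply: le_trans (block_le_off p1 N_abs nn_sum po kap1 kapP K1 hPhi PhiK fr ds) _.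
  rewrite lee_fin; apply: (up _ _ c5); rewrite ?exprn_ge0//.
    by rewrite /C; lra.
  have hn : (half_l1 delta <= n)%N by exact: half_l1_le_dim (frame_fiber fr) ds dn.
  apply: (@le_trans _ _ (det_const n kap K * u * ((kap ^+ 2 * g) * d) ^+ half_l1 delta)).
    apply: ler_pM.
    + by rewrite mulr_ge0 ?nc_ge0.
    + by rewrite exprn_ge0// mulr_ge0 ?exprn_ge0.
    + by rewrite ler_wpM2r//; exact: (det_le_const kap1 kapP chK fr).
    + have h : kap ^+ 2 * off <= kap ^+ 2 * g * d.
        by rewrite -[X in _ <= X]mulrA ler_wpM2l.
      by rewrite lerXn2r// nnegrE; apply: mulr_ge0.
  rewrite exprMn mulrA; apply: ler_wpM2r; first by rewrite exprn_ge0.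
  apply: ler_wpM2l; first exact: mulr_ge0.
  apply: (@le_trans _ _ ((1 + kap ^+ 2 * g) ^+ half_l1 delta)).
    by rewrite lerXn2r ?nnegrE ?addr_ge0// lerDr.
  by rewrite ler_weXn2l// lerDl.
- split=> //; apply: (up _ _ c6) => //; first by rewrite /C; lra.
  by apply: le_trans hg _; rewrite /c6 -[X in _ <= X]mulrA ler_wpM2l.
Qed.

Theorem theorem7p1 (R : realType) (m n : nat) (p : 'I_m -> R)
    (N : 'rV[R]_m -> R) (nn : 'I_m -> nat) (ord : seq 'I_m)
    (p_ge1 : forall i, 1 <= p i) (N_abs : absolute_norm N)
    (nn_sum : (\sum_i nn i = n)%N) (n_gt0 : (0 < n)%N)
    (* the order in which the mixed norm is iterated *)
    (ord_perm : perm_eq ord (enum 'I_m)) :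
  (* the blocks as functions of Phi, in an arbitrary chart *)
  (forall (ch : chart p nn n),
    (* coordinates of blocks are polynomial in Phi, of degree at most n *)
    (forall (delta : 'I_m -> int) (I : 'I_m -> {fset nat}),
      \sum_i delta i = 0 -> has_type (shift nn delta) I ->
      forall (d : nat) (Phi : 'I_d -> blockop R m),
        (forall k, chart_op ch (Phi k)) ->
        exists q : mpoly.mpoly d R[i],
          (forall mon : mpoly.multinom d,
            mpoly.mcoeff mon q != 0 -> (mpoly.mdeg mon <= n)%N) /\
          forall t : 'I_d -> R[i],
            plucker (graph_basis ch (\sum_k t k *: Phi k)) I
            = mpoly.meval t q) /\
    (* order at least ||delta||_1 / 2 in Phi_off *)
    (forall (delta : 'I_m -> int) (I : 'I_m -> {fset nat}) (Phi : blockop R m),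
      \sum_i delta i = 0 -> has_type (shift nn delta) I -> chart_op ch Phi ->
      exists q : {poly R[i]}, forall t : R[i],
        plucker (graph_basis ch (diag_part Phi + t *: off_part Phi)) I
        = t ^+ half_l1 delta * q.[t]) /\
    (* the part of degree ||delta||_1 / 2 does not vanish identically *)
    (forall delta : 'I_m -> int,
      \sum_i delta i = 0 -> (forall i, 0 <= shift nn delta i) ->
      exists (I : 'I_m -> {fset nat}) (Phi : blockop R m) (q : {poly R[i]}),
        [/\ has_type (shift nn delta) I, chart_op ch Phi, q.[0] != 0 &
          forall t : R[i],
            plucker (graph_basis ch (diag_part Phi + t *: off_part Phi)) I
            = t ^+ half_l1 delta * q.[t]]) /\
    (* degree-one blocks are the unit exchanges *)
    (forall delta : 'I_m -> int, \sum_i delta i = 0 ->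
      (half_l1 delta = 1%N <->
       exists i j : 'I_m, i != j /\ delta = unit_exchange i j)) /\
    (* the degree-one part of the block n + e_i - e_j is linear in the entries
       of Phi_ij, with coefficients depending on the diagonal of Phi only *)
    (forall (i j : 'I_m) (I : 'I_m -> {fset nat}) (Phi : blockop R m),
      i != j -> has_type (shift nn (unit_exchange i j)) I -> chart_op ch Phi ->
      exists lam : 'I_n -> nat -> R[i],
        forall Psi : blockop R m, chart_op ch Psi ->
          (forall l w, W ch l w -> Psi l l w = Phi l l w) ->
          exists q : {poly R[i]},
            [/\ forall t : R[i],
                  plucker (graph_basis ch (diag_part Psi + t *: off_part Psi)) I
                  = q.[t],
                q`_0 = 0
              & q`_1 = \sum_(r < n) \sum_(k <- I i)
                         lam r k * (Psi i j (bas ch r j) k : R[i])]) /\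
    (* in adapted coordinates the entries of Phi_ij are, up to sign, the
       coordinates at the single exchanges *)
    (forall P : 'I_m -> {fset nat}, adapted ch P ->
      forall (i j : 'I_m) (a k : nat) (r : 'I_n),
        i != j -> a \in P j -> k \notin P i ->
        r = index (j, a) (points P) :> nat ->
        has_type (shift nn (unit_exchange i j)) (exchange P i j k a) /\
        W ch j (bas ch r j) /\
        exists e : nat, forall Phi : blockop R m, chart_op ch Phi ->
          plucker (graph_basis ch Phi) (exchange P i j k a)
          = (-1) ^+ e * (Phi i j (bas ch r j) k : R[i]))) /\
  (* every chart has a finite size *)
  (forall ch : chart p nn n, exists K : R, chart_bound ch N K) /\
  (* comparisons, uniform over the charts of size at most K *)
  (forall K c : R, 0 < c ->
    exists C : R, 0 < C /\
    forall (ch : chart p nn n) (Phi : blockop R m),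
      chart_bound ch N K -> chart_op ch Phi -> opnorm ch N Phi <= K ->
      (c%:E <= pivot_norm p ord nn (graph_basis ch Phi))%E ->
      let V := graph ch Phi in
      let Sigma := stratum p nn in
      [/\ comparable_by C (dist p N V Sigma) (opnorm ch N (off_part Phi)),
          comparable_by C (opnorm ch N (off_part Phi))
            (max_ratio p ord nn (graph_basis ch Phi)),
          forall delta : 'I_m -> int, \sum_i delta i = 0 ->
            (block_norm p ord (shift nn delta) (graph_basis ch Phi)
             <= (C * dist p N V Sigma ^+ half_l1 delta)%R%:E)%E
        & Sigma (truncation ch Phi) /\
          gap p N V (truncation ch Phi) <= C * dist p N V Sigma]).
Proof.
split=> [ch|]; last split.
- have [sg [w [th fr]]] := frame_exists p_ge1 nn_sum ch.
  split; [|split; [|split; [|split; [|split]]]].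
  + by move=> delta I _ _ d Phi _; exact: plucker_polynomial.
  + by move=> delta I Phi; exact: (plucker_order nn_sum fr).
  + by move=> delta; exact: (plucker_leading p_ge1 nn_sum fr).
  + by move=> delta; exact: half_l1_unit_exchange.
  + by move=> i j I Phi; exact: (plucker_unit_exchange p_ge1 nn_sum fr).
  + by move=> P hP i j a k r; exact: (adapted_exchange nn_sum hP).
- by move=> ch; exact: chart_bound_exists.
(* [comparisons] is stated for K at least 1; enlarging K only weakens the bounds assumed on the
   chart and on Phi. *)
- move=> K c _; pose K' := Num.max 1 K.
  have KK' : K <= K' by rewrite le_max lexx orbT.
  have [|C [C0 hC]] := @comparisons R m n p N nn ord K' p_ge1 N_abs nn_sum ord_perm _.
    by rewrite le_max lexx.
  exists C; split=> // ch Phi [h1 h2] hPhi PhiK _; apply: hC => //.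
    split=> [i w u Ww Wu|r]; last exact: le_trans KK'.
    by apply: le_trans (h1 i w u Ww Wu) _; rewrite ler_wpM2r// nlp_ge0.
  exact: le_trans KK'.
Qed.
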